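(* Let $n\geq 1$, let $\mathbb{F}$ be an algebraically closed field of characteristic $2$, let $\mathfrak{W}(1;n)$ be the restricted Zassenhaus algebra over $\mathbb{F}$, and let $\mathfrak{t}\subseteq\mathfrak{W}(1;n)$ be a torus of maximal dimension. Then the restricted $\mathfrak{W}(1;n)$-module $P(\mu)=\mathrm{ind}_{\mathfrak{t}}^{\mathfrak{W}(1;n)}(\mathbb{F}(\mu))$ is indecomposable for all $\mu\in\mathfrak{t}^\circledast$. In particular, all projective indecomposable restricted $\mathfrak{W}(1;n)$-modules have maximal possible dimension $2^{2^n-1}$, and $\mathfrak{W}(1;n)$ has maximal $0$-p.i.m.
   Context: Let $\mathbb{F}$ be a field of characteristic $p>0$ (here $p=2$). Zassenhaus algebras: $\mathcal{O}(1;n)$ denotes the truncated divided power $\mathbb{F}$-algebra of dimension $p^n$ with basis $\{x^{(k)}\mid 0\le k\le p^n-1\}$ and product $x^{(a)}x^{(b)}=\binom{a+b}{a}x^{(a+b)}$ (interpreted as $0$ if $a+b\geq p^n$). Let $\partial$ be the derivation of $\mathcal{O}(1;n)$ with $\partial(x^{(0)})=0$ and $\partial(x^{(a)})=x^{(a-1)}$ for $1\le a\le p^n-1$. The Witt (Zassenhaus) algebra is the Lie subalgebra $W(1;n)=\mathrm{span}_{\mathbb{F}}\{e_j=x^{(j+1)}\cdot\partial\mid -1\le j\le p^n-2\}$ of $\mathrm{Der}(\mathcal{O}(1;n))$. The restricted Zassenhaus algebra $\mathfrak{W}(1;n)$ is the minimal $p$-envelope of $W(1;n)$; it coincides with $\mathrm{Der}(W(1;n))$,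 and, identifying $W(1;n)$ with its image in $\mathrm{Der}(W(1;n))$ under the adjoint representation, $\mathfrak{W}(1;n)=\bigoplus_{1\le k\le n-1}\mathbb{F}\cdot\partial^{[p]^k}\oplus W(1;n)$, where the $[p]$-map is the $p$-th power of derivations. Modules: for a finite-dimensional restricted Lie algebra $\mathfrak{L}$ over an algebraically closed field of characteristic $p$, $\underline{u}(\mathfrak{L})$ is its restricted universal enveloping algebra, and restricted $\mathfrak{L}$-modules are $\underline{u}(\mathfrak{L})$-modules; projectivity is understood in this category. A torus $\mathfrak{t}\subseteq\mathfrak{L}$ is an abelian restricted subalgebra all of whose elements are semisimple (i.e. each $x\in\mathfrak t$ lies in the span of $x^{[p]^i}$, $i\ge1$); ''of maximal dimension'' means that its dimension equals $\mathrm{MT}(\mathfrak{L})$, the maximal dimension of a torus of $\mathfrak{L}$. Put $\mathfrak{t}^\circledast=\mathrm{Hom}_{\mathbb{F}_p}(\mathrm{span}_{\mathbb{F}_p}\{t\in\mathfrak{t}\mid t^{[p]}=t\},\mathbb{F}_p)$. The elements $\mu\in\mathfrak{t}^\circledast$ correspond one-to-one to isomorphism classes of irreducible restricted $\mathfrak{t}$-modules, which are all $1$-dimensional; $\mathbb{F}(\mu)$ denotes the module on which each $t\in\mathfrak t$ with $t^{[p]}=t$ acts by $\mu(t)$. For a restricted subalgebra $\mathfrak{t}$ and a restricted $\mathfrak{t}$-module $M$, $\mathrm{ind}_{\mathfrak{t}}^{\mathfrak{L}}(M)=\underline{u}(\mathfrak{L})\otimes_{\underline{u}(\mathfrak{t})}M$.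 The dimension of any projective indecomposable restricted $\mathfrak{L}$-module is at most $p^{\dim(\mathfrak{L})-\mathrm{MT}(\mathfrak{L})}$; ''maximal possible dimension'' means that this bound is attained. $\mathfrak{L}$ is said to have maximal $0$-p.i.m. if the projective cover of the $1$-dimensional trivial restricted $\mathfrak{L}$-module has this maximal possible dimension $p^{\dim(\mathfrak{L})-\mathrm{MT}(\mathfrak{L})}$. *)

(* Defs.v *)
From HB Require Import structures.
From mathcomp Require Import all_boot all_algebra separable.
From mathcomp Require Import boolp.

Set Implicit Arguments.
Unset Strict Implicit.
Unset Printing Implicit Defensive.

Import GRing.Theory.
Local Open Scope ring_scope.
Local Open Scope quotient_scope.

(* Finite-dimensional restricted Lie algebras are realized as subspaces of
   'End(V) closed under the commutator and under the p-th power of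
   endomorphisms, which is the [p]-map of an algebra of derivations. *)
Section RestrictedSubalgebras.
Variables (F : fieldType) (p : nat) (V : vectType F).
Implicit Types (x y : 'End(V)) (L t : {vspace 'End(V)}).

Definition lie_br x y : 'End(V) := ((x \o y) - (y \o x))%VF.

Definition lfun_exp x m : 'End(V) := iter m (comp_lfun x) \1%VF.

Definition p_map x : 'End(V) := lfun_exp x p.

Definition restricted_subalgebra L : Prop :=
  (forall x y, x \in L -> y \in L -> lie_br x y \in L) /\
  (forall x, x \in L -> p_map x \in L).

(* iota 1 m = [:: 1; ...; m]: only the powers x^[p]^i with i >= 1 occur. *)
Definition semisimple x : Prop :=
  exists m, x \in <<[seq iter i p_map x | i <- iota 1 m]>>%VS.

Definition torus t : Prop :=
  [/\ restricted_subalgebra t,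
      forall x y, x \in t -> y \in t -> lie_br x y = 0
    & forall x, x \in t -> semisimple x].

(* The largest dimension of a torus contained in L. *)
Definition MT L : nat :=
  \max_(d < (\dim L).+1 |
     `[< exists t, [/\ torus t, (t <= L)%VS & \dim t = d] >]) d.

Definition toral t x : Prop := x \in t /\ p_map x = x.

(* The F_p-span of the toral elements; 'F_p acts on 'End(V) through the
   canonical representatives 0, ..., p - 1 (p is the characteristic of F). *)
Definition toral_span t x : Prop :=
  exists m (s : 'I_m -> 'End(V)) (c : 'I_m -> 'F_p),
    (forall i, toral t (s i)) /\ x = \sum_i (c i)%:R *: s i.

(* An F_p-linear form on toral_span t, presented by a function on all of
   'End(V); its values outside toral_span t are never used. *)
Record torus_dual t := TorusDual {
  torus_dual_fun :> 'End(V) -> 'F_p;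
  torus_dualP : forall (c : 'F_p) x y, toral_span t x -> toral_span t y ->
    torus_dual_fun (c%:R *: x + y) = c * torus_dual_fun x + torus_dual_fun y }.

End RestrictedSubalgebras.

Arguments lie_br {F V} x y.
Arguments p_map {F} p {V} x.

Section RestrictedEnvelopingAlgebra.
Variables (F : fieldType) (p : nat) (V : vectType F) (L : {vspace 'End(V)}).

(* The restricted enveloping algebra u(L) is the unital associative F-algebra
   with generators x in L, linear in x, subject to xy - yx = [x,y] and
   x^p = x^[p].  It is built as the quotient of formal expressions by the least
   congruence containing the F-algebra axioms (UConst k stands for k * 1) and
   these relations.  In u_genB and u_genP the brackets and [p]-powers are taken
   in 'End(V), hence z is [x,y], resp. x^[p], viewed as an element of L. *)
Inductive u_term :=
  | UGen of subvs_of L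
  | UConst of F
  | UAdd of u_term & u_term
  | UMul of u_term & u_term.

HB.instance Definition _ := gen_eqMixin u_term.
HB.instance Definition _ := gen_choiceMixin u_term.

Inductive u_cong : u_term -> u_term -> Prop :=
  | u_refl a : u_cong a a
  | u_sym a b : u_cong a b -> u_cong b a
  | u_trans b a c : u_cong a b -> u_cong b c -> u_cong a c
  | u_congD a a' b b' :
      u_cong a a' -> u_cong b b' -> u_cong (UAdd a b) (UAdd a' b')
  | u_congM a a' b b' :
      u_cong a a' -> u_cong b b' -> u_cong (UMul a b) (UMul a' b')
  | u_addA a b c : u_cong (UAdd a (UAdd b c)) (UAdd (UAdd a b) c)
  | u_addC a b : u_cong (UAdd a b) (UAdd b a)
  | u_add0 a : u_cong (UAdd (UConst 0) a) a
  | u_mulA a b c : u_cong (UMul a (UMul b c)) (UMul (UMul a b) c)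
  | u_mul1 a : u_cong (UMul (UConst 1) a) a
  | u_mul0 a : u_cong (UMul (UConst 0) a) (UConst 0)
  | u_mulDl a b c : u_cong (UMul (UAdd a b) c) (UAdd (UMul a c) (UMul b c))
  | u_mulDr a b c : u_cong (UMul a (UAdd b c)) (UAdd (UMul a b) (UMul a c))
  | u_constD k l : u_cong (UConst (k + l)) (UAdd (UConst k) (UConst l))
  | u_constM k l : u_cong (UConst (k * l)) (UMul (UConst k) (UConst l))
  | u_constC k a : u_cong (UMul (UConst k) a) (UMul a (UConst k))
  | u_genD x y : u_cong (UGen (x + y)) (UAdd (UGen x) (UGen y))
  | u_genZ k x : u_cong (UGen (k *: x)) (UMul (UConst k) (UGen x))
  | u_genB x y z : vsval z = lie_br (vsval x) (vsval y) ->
      u_cong (UGen z) (UAdd (UMul (UGen x) (UGen y))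
                            (UMul (UConst (-1)) (UMul (UGen y) (UGen x))))
  | u_genP x z : vsval z = p_map p (vsval x) ->
      u_cong (UGen z) (iter p (UMul (UGen x)) (UConst 1)).

Definition u_rel : rel u_term := fun a b => `[< u_cong a b >].

Lemma u_rel_equiv : equiv_class_of u_rel.
Proof.
split.
- by move=> a; apply/asboolP; exact: u_refl.
- by move=> a b; apply/asboolP/asboolP; exact: u_sym.
- by move=> b a c /asboolP h /asboolP k; apply/asboolP; exact: u_trans h k.
Qed.

Canonical u_equiv := EquivRelPack u_rel_equiv.

Section Eval.
Variables (A : algType F) (f : subvs_of L -> A).

Fixpoint u_eval (a : u_term) : A :=
  match a with
  | UGen x => f x
  | UConst k => k%:A
  | UAdd a b => u_eval a + u_eval b
  | UMul a b => u_eval a * u_eval b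
  end.

Hypothesis fD : {morph f : x y / x + y}.
Hypothesis fZ : forall k x, f (k *: x) = k *: f x.
Hypothesis fB : forall x y z, vsval z = lie_br (vsval x) (vsval y) ->
  f z = f x * f y - f y * f x.
Hypothesis fP : forall x z, vsval z = p_map p (vsval x) -> f z = f x ^+ p.

Lemma u_eval_cong a b : u_cong a b -> u_eval a = u_eval b.
Proof.
elim=> {a b} //=.
- by move=> b a c _ -> _ ->.
- by move=> a a' b b' _ -> _ ->.
- by move=> a a' b b' _ -> _ ->.
- by move=> a b c; rewrite addrA.
- by move=> a b; rewrite addrC.
- by move=> a; rewrite scale0r add0r.
- by move=> a b c; rewrite mulrA.
- by move=> a; rewrite scale1r mul1r.
- by move=> a; rewrite scale0r mul0r.
- by move=> a b c; rewrite mulrDl.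
- by move=> a b c; rewrite mulrDr.
- by move=> k l; rewrite scalerDl.
- by move=> k l; rewrite -scalerAl mul1r scalerA.
- by move=> k a; rewrite -scalerAl -scalerAr mul1r mulr1.
- by move=> k x; rewrite fZ -scalerAl mul1r.
- by move=> x y z /fB->; rewrite -scalerAl mul1r scaleN1r.
- move=> x z /fP->; elim: p => [|q IHq] /=; first by rewrite scale1r.
  by rewrite exprS IHq.
Qed.
End Eval.
End RestrictedEnvelopingAlgebra.

Section EnvelopingAlgebraStructure.
Variables (F : fieldType) (p : nat) (pF : p \in [pchar F]).
Variables (V : vectType F) (L : {vspace 'End(V)}).

(* The characteristic hypothesis is recorded in the type because the ring
   structure below requires 1 != 0, which fails for p = 0. *)
Definition u_alg of p \in [pchar F] := {eq_quot u_equiv p L}.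
Local Notation U := (u_alg pF).

HB.instance Definition _ := Choice.on U.
HB.instance Definition _ := EqQuotient.on U.

Definition u_pi a : U := \pi_{eq_quot u_equiv p L} a.
Definition u_repr (u : U) : u_term L := @repr _ {eq_quot u_equiv p L} u.

Lemma u_pi_eq a b : u_cong p a b -> u_pi a = u_pi b.
Proof. by move=> h; apply/eqP; rewrite /u_pi eqmodE; apply/asboolP. Qed.

Lemma u_pi_inj a b : u_pi a = u_pi b -> u_cong p a b.
Proof. by move/eqP; rewrite /u_pi eqmodE => /asboolP. Qed.

Lemma u_reprK : cancel u_repr u_pi.
Proof. exact: reprK. Qed.

Lemma u_reprP a : u_cong p (u_repr (u_pi a)) a.
Proof. by apply: u_pi_inj; rewrite u_reprK. Qed.

Lemma u_ind (P : U -> Prop) : (forall a, P (u_pi a)) -> forall a, P a.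
Proof. by move=> h a; rewrite -[a]u_reprK. Qed.

Definition u_const k : U := u_pi (UConst L k).
Definition u_add (a b : U) : U := u_pi (UAdd (u_repr a) (u_repr b)).
Definition u_mul (a b : U) : U := u_pi (UMul (u_repr a) (u_repr b)).
Definition u_opp (a : U) : U := u_mul (u_const (-1)) a.

Lemma u_piD a b : u_pi (UAdd a b) = u_add (u_pi a) (u_pi b).
Proof. by apply/esym/u_pi_eq; apply: u_congD; exact: u_reprP. Qed.

Lemma u_piM a b : u_pi (UMul a b) = u_mul (u_pi a) (u_pi b).
Proof. by apply/esym/u_pi_eq; apply: u_congM; exact: u_reprP. Qed.

Fact u_addrA : associative u_add.
Proof.
elim/u_ind=> a; elim/u_ind=> b; elim/u_ind=> c.
by rewrite -!u_piD; apply: u_pi_eq; exact: u_addA.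
Qed.

Fact u_addrC : commutative u_add.
Proof.
elim/u_ind=> a; elim/u_ind=> b.
by rewrite -!u_piD; apply: u_pi_eq; exact: u_addC.
Qed.

Fact u_add0r : left_id (u_const 0) u_add.
Proof. by elim/u_ind=> a; rewrite -u_piD; apply: u_pi_eq; exact: u_add0. Qed.

Fact u_mulrA : associative u_mul.
Proof.
elim/u_ind=> a; elim/u_ind=> b; elim/u_ind=> c.
by rewrite -!u_piM; apply: u_pi_eq; exact: u_mulA.
Qed.

Fact u_mul1r : left_id (u_const 1) u_mul.
Proof. by elim/u_ind=> a; rewrite -u_piM; apply: u_pi_eq; exact: u_mul1. Qed.

Fact u_mul0r a : u_mul (u_const 0) a = u_const 0.
Proof. by elim/u_ind: a => a; rewrite -u_piM; apply: u_pi_eq; exact: u_mul0. Qed.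

Fact u_mulC k a : u_mul (u_const k) a = u_mul a (u_const k).
Proof.
by elim/u_ind: a => a; rewrite -!u_piM; apply: u_pi_eq; exact: u_constC.
Qed.

Fact u_mulr1 : right_id (u_const 1) u_mul.
Proof. by move=> a; rewrite -u_mulC u_mul1r. Qed.

Fact u_mulrDl : left_distributive u_mul u_add.
Proof.
elim/u_ind=> a; elim/u_ind=> b; elim/u_ind=> c.
by rewrite -!(u_piD, u_piM); apply: u_pi_eq; exact: u_mulDl.
Qed.

Fact u_mulrDr : right_distributive u_mul u_add.
Proof.
elim/u_ind=> a; elim/u_ind=> b; elim/u_ind=> c.
by rewrite -!(u_piD, u_piM); apply: u_pi_eq; exact: u_mulDr.
Qed.

Fact u_constrD k l : u_const (k + l) = u_add (u_const k) (u_const l).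
Proof. by rewrite -u_piD; apply: u_pi_eq; exact: u_constD. Qed.

Fact u_constrM k l : u_const (k * l) = u_mul (u_const k) (u_const l).
Proof. by rewrite -u_piM; apply: u_pi_eq; exact: u_constM. Qed.

Fact u_addNr : left_inverse (u_const 0) u_opp u_add.
Proof.
move=> a; rewrite /u_opp -{2}[a]u_mul1r -u_mulrDl -u_constrD addNr.
exact: u_mul0r.
Qed.

Fact u_const1_neq0 : u_const 1 != u_const 0.
Proof.
apply/eqP => /u_pi_inj h.
pose f (_ : subvs_of L) : F^o := 0.
have : u_eval f (UConst L 1) = u_eval f (UConst L 0).
  apply: (u_eval_cong _ _ _ _ h).
  - by move=> x y; rewrite /f addr0.
  - by move=> k x; rewrite /f scaler0.
  - by move=> x y z _; rewrite /f mulr0 subr0.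
  - by move=> x z _; rewrite /f expr0n; case: p pF => // /andP[].
by move/eqP; rewrite /= scale1r scale0r oner_eq0.
Qed.

HB.instance Definition _ :=
  GRing.isZmodule.Build U u_addrA u_addrC u_add0r u_addNr.

HB.instance Definition _ := GRing.Zmodule_isNzRing.Build U
  u_mulrA u_mul1r u_mulr1 u_mulrDl u_mulrDr u_const1_neq0.

Definition u_scale k (a : U) : U := u_const k * a.

Fact u_scaleA k l a : u_scale k (u_scale l a) = u_scale (k * l) a.
Proof. by rewrite /u_scale mulrA [u_const (k * l)]u_constrM. Qed.

Fact u_scale1 : left_id 1 u_scale.
Proof. exact: mul1r. Qed.

Fact u_scaleDr : right_distributive u_scale +%R.
Proof. by move=> k a b; rewrite /u_scale mulrDr. Qed.

Fact u_scaleDl a : {morph u_scale^~ a : k l / k + l}.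
Proof. by move=> k l; rewrite /u_scale [u_const _]u_constrD mulrDl. Qed.

HB.instance Definition _ := GRing.Zmodule_isLmodule.Build F U
  u_scaleA u_scale1 u_scaleDr u_scaleDl.

Fact u_scaleAl k (a b : U) : k *: (a * b) = (k *: a) * b.
Proof. exact: mulrA. Qed.

HB.instance Definition _ := GRing.Lmodule_isLalgebra.Build F U u_scaleAl.

Fact u_scaleAr k (a b : U) : k *: (a * b) = a * (k *: b).
Proof.
rewrite /GRing.scale /= /u_scale mulrA [u_const k * a](u_mulC k a).
by rewrite mulrA.
Qed.

HB.instance Definition _ := GRing.Lalgebra_isAlgebra.Build F U u_scaleAr.

Definition u_gen (x : subvs_of L) : U := u_pi (UGen x).

(* Universal property of u(L). *)
Section Lift.
Variables (A : algType F) (f : subvs_of L -> A).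
Hypothesis fD : {morph f : x y / x + y}.
Hypothesis fZ : forall k x, f (k *: x) = k *: f x.
Hypothesis fB : forall x y z, vsval z = lie_br (vsval x) (vsval y) ->
  f z = f x * f y - f y * f x.
Hypothesis fP : forall x z, vsval z = p_map p (vsval x) -> f z = f x ^+ p.

Let g (u : U) := u_eval f (u_repr u).

Let gE a : g (u_pi a) = u_eval f a.
Proof. by apply: (u_eval_cong fD fZ fB fP); exact: u_reprP. Qed.

Let gB : {morph g : a b / a - b}.
Proof.
elim/u_ind=> a; elim/u_ind=> b.
have -> : u_pi a - u_pi b = u_pi (UAdd a (UMul (UConst L (-1)) b)).
  by rewrite u_piD u_piM.
by rewrite !gE /= -scalerAl mul1r scaleN1r.
Qed.

Let gM : {morph g : a b / a * b}.
Proof.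
elim/u_ind=> a; elim/u_ind=> b.
by have -> : u_pi a * u_pi b = u_pi (UMul a b); rewrite ?u_piM // -u_piM !gE.
Qed.

Let g1 : g 1 = 1.
Proof. by rewrite -[1]/(u_pi (UConst L 1)) gE /= scale1r. Qed.

Let gZ : scalable g.
Proof.
by move=> k a; rewrite -[k *: a]/(u_const k * a) gM gE /= -scalerAl mul1r.
Qed.

Definition u_lift : {lrmorphism U -> A} :=
  HB.pack g (GRing.isZmodMorphism.Build _ _ g gB)
    (GRing.isMonoidMorphism.Build _ _ g (conj g1 gM))
    (GRing.isScalable.Build _ _ _ _ g gZ).

Lemma u_liftE x : u_lift (u_gen x) = f x.
Proof. exact: gE. Qed.
End Lift.

Fact u_genDr : {morph u_gen : x y / x + y}.
Proof.
move=> x y; rewrite -[RHS]/(u_add _ _) -u_piD; apply: u_pi_eq; exact: u_genD.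
Qed.

Fact u_genZr k x : u_gen (k *: x) = k *: u_gen x.
Proof.
rewrite -[RHS]/(u_mul (u_const k) _) -u_piM; apply: u_pi_eq; exact: u_genZ.
Qed.

Fact u_genBr x y z : vsval z = lie_br (vsval x) (vsval y) ->
  u_gen z = u_gen x * u_gen y - u_gen y * u_gen x.
Proof.
move=> /(u_genB p)/u_pi_eq; rewrite !(u_piD, u_piM) => h; exact: h.
Qed.

Fact u_genPr x z : vsval z = p_map p (vsval x) -> u_gen z = u_gen x ^+ p.
Proof.
move=> /u_genP/u_pi_eq; rewrite -/(u_gen z) => ->.
by elim: p => [|q IHq] //=; rewrite u_piM IHq exprS.
Qed.

End EnvelopingAlgebraStructure.

Section EnvelopingAlgebraMorphisms.
Variables (F : fieldType) (p : nat) (pF : p \in [pchar F]) (V : vectType F).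
Variables (t L : {vspace 'End(V)}).

Fact u_aug_subproof :
  let f (_ : subvs_of L) : F^o := 0 in
  [/\ {morph f : x y / x + y}, forall k x, f (k *: x) = k *: f x,
   forall x y z, vsval z = lie_br (vsval x) (vsval y) ->
     f z = f x * f y - f y * f x
   & forall x z, vsval z = p_map p (vsval x) -> f z = f x ^+ p].
Proof.
move=> f; split=> [x y|k x|x y z _|x z _]; rewrite /f.
- by rewrite addr0.
- by rewrite scaler0.
- by rewrite mulr0 subr0.
- by rewrite expr0n; case: p pF => // /andP[].
Qed.

(* The augmentation, sending every element of L to 0. *)
Definition u_aug : {lrmorphism u_alg L pF -> F^o} :=
  let: And4 fD fZ fB fP := u_aug_subproof in u_lift pF fD fZ fB fP.

Hypothesis tL : (t <= L)%VS.

Fact u_incl_subproof :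
  let f (x : subvs_of t) := u_gen pF (vsproj L (vsval x)) in
  [/\ {morph f : x y / x + y}, forall k x, f (k *: x) = k *: f x,
   forall x y z, vsval z = lie_br (vsval x) (vsval y) ->
     f z = f x * f y - f y * f x
   & forall x z, vsval z = p_map p (vsval x) -> f z = f x ^+ p].
Proof.
have vL (x : subvs_of t) : vsval (vsproj L (vsval x)) = vsval x.
  by rewrite vsprojK // (subvP tL) // subvsP.
move=> f; split=> [x y|k x|x y z h|x z h]; rewrite /f.
- by rewrite !linearD /= u_genDr.
- by rewrite !linearZ /= u_genZr.
- by apply: u_genBr; rewrite !vL.
- by apply: u_genPr; rewrite !vL.
Qed.

(* The morphism u(t) -> u(L) induced by the inclusion t <= L. *)
Definition u_incl : {lrmorphism u_alg t pF -> u_alg L pF} :=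
  let: And4 fD fZ fB fP := u_incl_subproof in u_lift pF fD fZ fB fP.

End EnvelopingAlgebraMorphisms.

(* Restriction of scalars along phi. *)
Definition pullback (S R : pzRingType) (phi : {rmorphism S -> R})
  (M : lmodType R) : Type := M.

Section Pullback.
Variables (S R : pzRingType) (phi : {rmorphism S -> R}) (M : lmodType R).
Local Notation N := (pullback phi M).

HB.instance Definition _ := GRing.Zmodule.on N.

Definition pullback_scale (s : S) (m : N) : N := phi s *: (m : M).

Fact pullback_scaleA a b m :
  pullback_scale a (pullback_scale b m) = pullback_scale (a * b) m.
Proof. by rewrite /pullback_scale scalerA rmorphM. Qed.

Fact pullback_scale1 : left_id 1 pullback_scale.
Proof. by move=> m; rewrite /pullback_scale rmorph1 scale1r. Qed.

Fact pullback_scaleDr : right_distributive pullback_scale +%R.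
Proof. by move=> a m n; rewrite /pullback_scale scalerDr. Qed.

Fact pullback_scaleDl m : {morph pullback_scale^~ m : a b / a + b}.
Proof. by move=> a b; rewrite /pullback_scale rmorphD scalerDl. Qed.

HB.instance Definition _ := GRing.Zmodule_isLmodule.Build S N
  pullback_scaleA pullback_scale1 pullback_scaleDr pullback_scaleDl.
End Pullback.

Section InducedModule.
Variables (S R : pzRingType) (phi : {rmorphism S -> R}) (M : lmodType S).

(* The left R-module R (x)_S M, where S acts on R on the right through phi: the
   abelian group with generators r (x) m, additive in r and in m, and relations
   (r * phi s) (x) m = r (x) (s *: m). *)
Inductive ind_term :=
  | ITens of R & M
  | IAdd of ind_term & ind_term
  | IOpp of ind_term
  | IZero.

HB.instance Definition _ := gen_eqMixin ind_term.
HB.instance Definition _ := gen_choiceMixin ind_term.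

Inductive ind_cong : ind_term -> ind_term -> Prop :=
  | ind_refl a : ind_cong a a
  | ind_sym a b : ind_cong a b -> ind_cong b a
  | ind_trans b a c : ind_cong a b -> ind_cong b c -> ind_cong a c
  | ind_congD a a' b b' :
      ind_cong a a' -> ind_cong b b' -> ind_cong (IAdd a b) (IAdd a' b')
  | ind_congN a a' : ind_cong a a' -> ind_cong (IOpp a) (IOpp a')
  | ind_addA a b c : ind_cong (IAdd a (IAdd b c)) (IAdd (IAdd a b) c)
  | ind_addC a b : ind_cong (IAdd a b) (IAdd b a)
  | ind_add0 a : ind_cong (IAdd IZero a) a
  | ind_addN a : ind_cong (IAdd (IOpp a) a) IZero
  | ind_tensDl r r' m :
      ind_cong (ITens (r + r') m) (IAdd (ITens r m) (ITens r' m))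
  | ind_tensDr r m m' :
      ind_cong (ITens r (m + m')) (IAdd (ITens r m) (ITens r m'))
  | ind_tensZ r s m : ind_cong (ITens (r * phi s) m) (ITens r (s *: m)).

Definition ind_rel : rel ind_term := fun a b => `[< ind_cong a b >].

Lemma ind_rel_equiv : equiv_class_of ind_rel.
Proof.
split.
- by move=> a; apply/asboolP; exact: ind_refl.
- by move=> a b; apply/asboolP/asboolP; exact: ind_sym.
- by move=> b a c /asboolP h /asboolP k; apply/asboolP; exact: ind_trans h k.
Qed.

Canonical ind_equiv := EquivRelPack ind_rel_equiv.

Definition ind : Type := {eq_quot ind_equiv}.

HB.instance Definition _ := Choice.on ind.

Definition ind_pi a : ind := \pi_{eq_quot ind_equiv} a.
Definition ind_repr (u : ind) : ind_term := @repr _ {eq_quot ind_equiv} u.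

Lemma ind_pi_eq a b : ind_cong a b -> ind_pi a = ind_pi b.
Proof. by move=> h; apply/eqP; rewrite /ind_pi eqmodE; apply/asboolP. Qed.

Lemma ind_pi_inj a b : ind_pi a = ind_pi b -> ind_cong a b.
Proof. by move/eqP; rewrite /ind_pi eqmodE => /asboolP. Qed.

Lemma ind_reprK : cancel ind_repr ind_pi.
Proof. exact: reprK. Qed.

Lemma ind_reprP a : ind_cong (ind_repr (ind_pi a)) a.
Proof. by apply: ind_pi_inj; rewrite ind_reprK. Qed.

Lemma ind_ind (P : ind -> Prop) : (forall a, P (ind_pi a)) -> forall a, P a.
Proof. by move=> h a; rewrite -[a]ind_reprK. Qed.

Definition ind_add (a b : ind) := ind_pi (IAdd (ind_repr a) (ind_repr b)).
Definition ind_opp (a : ind) := ind_pi (IOpp (ind_repr a)).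

Lemma ind_piD a b : ind_pi (IAdd a b) = ind_add (ind_pi a) (ind_pi b).
Proof. by apply/esym/ind_pi_eq; apply: ind_congD; exact: ind_reprP. Qed.

Lemma ind_piN a : ind_pi (IOpp a) = ind_opp (ind_pi a).
Proof. by apply/esym/ind_pi_eq; apply: ind_congN; exact: ind_reprP. Qed.

Fact ind_addrA : associative ind_add.
Proof.
elim/ind_ind=> a; elim/ind_ind=> b; elim/ind_ind=> c.
by rewrite -!ind_piD; apply: ind_pi_eq; exact: ind_addA.
Qed.

Fact ind_addrC : commutative ind_add.
Proof.
elim/ind_ind=> a; elim/ind_ind=> b.
by rewrite -!ind_piD; apply: ind_pi_eq; exact: ind_addC.
Qed.

Fact ind_add0r : left_id (ind_pi IZero) ind_add.
Proof.
by elim/ind_ind=> a; rewrite -ind_piD; apply: ind_pi_eq; exact: ind_add0.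
Qed.

Fact ind_addNr : left_inverse (ind_pi IZero) ind_opp ind_add.
Proof.
elim/ind_ind=> a.
by rewrite -ind_piN -ind_piD; apply: ind_pi_eq; exact: ind_addN.
Qed.

HB.instance Definition _ :=
  GRing.isZmodule.Build ind ind_addrA ind_addrC ind_add0r ind_addNr.

Definition tens (r : R) (m : M) : ind := ind_pi (ITens r m).

Fixpoint ind_act (r : R) (a : ind_term) : ind :=
  match a with
  | ITens r' m => tens (r * r') m
  | IAdd a b => ind_act r a + ind_act r b
  | IOpp a => - ind_act r a
  | IZero => 0
  end.

Lemma tensDl r r' m : tens (r + r') m = tens r m + tens r' m.
Proof. by rewrite -[RHS]ind_piD; apply: ind_pi_eq; exact: ind_tensDl. Qed.

Lemma tensDr r m m' : tens r (m + m') = tens r m + tens r m'.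
Proof. by rewrite -[RHS]ind_piD; apply: ind_pi_eq; exact: ind_tensDr. Qed.

Lemma tensZ r s m : tens (r * phi s) m = tens r (s *: m).
Proof. by apply: ind_pi_eq; exact: ind_tensZ. Qed.

Lemma ind_act_cong r a b : ind_cong a b -> ind_act r a = ind_act r b.
Proof.
elim=> {a b} //=.
- by move=> b a c _ -> _ ->.
- by move=> a a' b b' _ -> _ ->.
- by move=> a a' _ ->.
- by move=> a b c; rewrite addrA.
- by move=> a b; rewrite addrC.
- by move=> a; rewrite add0r.
- by move=> a; rewrite addNr.
- by move=> r1 r2 m; rewrite mulrDr tensDl.
- by move=> r1 m m'; rewrite tensDr.
- by move=> r1 s m; rewrite mulrA tensZ.
Qed.

Definition ind_scale (r : R) (u : ind) : ind := ind_act r (ind_repr u).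

Lemma ind_scaleE r a : ind_scale r (ind_pi a) = ind_act r a.
Proof. by apply: ind_act_cong; exact: ind_reprP. Qed.

Fact ind_scaleDr : right_distributive ind_scale +%R.
Proof.
move=> r; elim/ind_ind=> a; elim/ind_ind=> b.
have -> : ind_pi a + ind_pi b = ind_pi (IAdd a b) by rewrite ind_piD.
by rewrite !ind_scaleE.
Qed.

Fact ind_scaleDl u : {morph ind_scale^~ u : r s / r + s}.
Proof.
elim/ind_ind: u => a r s; rewrite !ind_scaleE.
elim: a => [r' m|a IHa b IHb|a IHa|] /=.
- by rewrite mulrDl tensDl.
- by rewrite IHa IHb addrACA.
- by rewrite IHa opprD.
- by rewrite addr0.
Qed.

Fact ind_scale1 : left_id 1 ind_scale.
Proof.
elim/ind_ind=> a; rewrite ind_scaleE.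
elim: a => [r' m|a IHa b IHb|a IHa|] //=.
- by rewrite mul1r.
- by rewrite IHa IHb ind_piD.
- by rewrite IHa ind_piN.
Qed.

Fact ind_scaleA r s u : ind_scale r (ind_scale s u) = ind_scale (r * s) u.
Proof.
have sN v : ind_scale r (- v) = - ind_scale r v.
  elim/ind_ind: v => a; have -> : - ind_pi a = ind_pi (IOpp a) by rewrite ind_piN.
  by rewrite !ind_scaleE.
elim/ind_ind: u => a; rewrite !ind_scaleE.
elim: a => [r' m|a IHa b IHb|a IHa|] /=.
- by rewrite ind_scaleE /= mulrA.
- by rewrite ind_scaleDr IHa IHb.
- by rewrite sN IHa.
- by rewrite -[0]/(ind_pi IZero) ind_scaleE.
Qed.

HB.instance Definition _ := GRing.Zmodule_isLmodule.Build R ind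
  ind_scaleA ind_scale1 ind_scaleDr ind_scaleDl.

Lemma ind_scale_tens (r r' : R) (m : M) : r *: tens r' m = tens (r * r') m.
Proof. exact: ind_scaleE. Qed.

End InducedModule.

Section Modules.
Variable U : pzRingType.

Definition indecomposable (M : lmodType U) : Prop :=
  (exists m : M, m != 0) /\
  forall A B : {pred M}, GRing.submod_closed A -> GRing.submod_closed B ->
    (forall m, exists a b, [/\ a \in A, b \in B & m = a + b]) ->
    (forall m, m \in A -> m \in B -> m = 0) ->
    (forall a, a \in A -> a = 0) \/ (forall b, b \in B -> b = 0).

Definition projective (P : lmodType U) : Prop :=
  forall (M N : lmodType U) (f : {linear M -> N}) (g : {linear P -> N}),
    (forall y, exists x, f x = y) ->
    exists h : {linear P -> M}, forall x, f (h x) = g x.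

(* f : P -> M is onto with superfluous kernel. *)
Definition projective_cover (P M : lmodType U) : Prop :=
  projective P /\
  exists2 f : {linear P -> M}, (forall y, exists x, f x = y) &
    forall A : {pred P}, GRing.submod_closed A ->
      (forall x, exists a b, [/\ a \in A, f b = 0 & x = a + b]) ->
      forall x, x \in A.

End Modules.

(* M has dimension d over F, F acting through its image in U. *)
Definition has_dim (F : fieldType) (U : algType F) (M : lmodType U) (d : nat) :=
  exists b : 'I_d -> M, forall m : M,
    exists! c : {ffun 'I_d -> F}, m = \sum_i (c i)%:A *: b i.

Section TorusWeights.
Variables (F : closedFieldType) (p : nat) (pF : p \in [pchar F]).

Lemma semisimple_diag n (A : 'M[F]_n) m (a : 'I_m -> F) :
  A = \sum_i a i *: iter (p ^ i.+1)%N (mulmx A) 1%:M ->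
  exists2 P : 'M_n, P \in unitmx & similar_diag P A.
Proof.
case: n A => [|n] A hA; first by rewrite (flatmx0 A); exact: diagonalizable0.
have powE k : iter k (mulmx A) 1%:M = A ^+ k.
  by elim: k => //= k ->; rewrite exprS.
apply/diagonalizableP.
pose q : {poly F} := 'X - \sum_i a i *: 'X^(p ^ i.+1).
have qs : separable_poly q.
  rewrite separable_poly.unlock /q derivB derivX.
  suff -> : (\sum_i a i *: 'X^(p ^ i.+1))^`() = 0 :> {poly F}.
    by rewrite subr0 coprimep1.
  rewrite -[LHS]/(deriv _) linear_sum big1 //= => i _.
  rewrite derivZ derivXn expnS mulrnA mulrnAC -mulr_natr.
  have -> : p%:R = 0 :> {poly F} by rewrite -polyC_natr (pcharf0 pF).
  by rewrite mulr0 scaler0.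
have [r qr] := closed_field_poly_normal q.
have q0 := separable_poly_neq0 qs.
have qe : q %= \prod_(z <- r) ('X - z%:P).
  by rewrite {1}qr eqp_scale // lead_coef_eq0.
exists r; first by rewrite -separable_prod_XsubC -(eqp_separable qe).
rewrite -(eqp_dvdr _ qe); apply: mxminpoly_min.
rewrite /q rmorphB /= horner_mx_X rmorph_sum /= {1}hA; apply/eqP.
rewrite subr_eq0; apply/eqP/eq_bigr => i _.
by rewrite linearZ /= rmorphXn /= horner_mx_X powE.
Qed.

Variables (V : vectType F) (t : {vspace 'End(V)}).
Hypothesis tP : torus p t.

(* A torus is simultaneously diagonalizable. *)
Lemma torus_weights : exists N (phi : {linear 'End(V) -> 'rV[F]_N}),
  (forall x, x \in t -> phi x = 0 -> x = 0) /\
  (forall x i, x \in t -> phi (p_map p x) 0 i = phi x 0 i ^+ p).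
Proof.
have [_ tC tS] := tP.
pose n : nat := \dim {:V}; pose e := vbasis {:V}.
have eb : basis_of {:V} e := vbasisP _.
have [mx [mxM mx1 mx_inj]] : exists mx : {linear 'End(V) -> 'M[F]_n},
    [/\ forall x y, mx (x \o y)%VF = mx y *m mx x, mx \1%VF = 1%:M
      & forall x, mx x = 0 -> x = 0].
  pose f : {linear 'End(V) -> 'M[F]_n} := HB.pack (passmx.mxof e e)
    (GRing.isLinear.Build _ _ _ _ _ (passmx.mxof_linear e e)).
  exists f; split=> [x y||x /eqP]; first exact: passmx.mxof_comp.
    exact: passmx.mxof1 (basis_free eb).
  by rewrite /= passmx.mxof_eq0 // => /eqP.
have mxX x m : mx (lfun_exp x m) = iter m (mulmx^~ (mx x)) 1%:M.
  elim: m => [|m IHm]; first exact: mx1.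
  by rewrite iterS -IHm -mxM.
have mxX' A m : iter m (mulmx^~ A) 1%:M = iter m (mulmx A) 1%:M :> 'M[F]_n.
  have c k : A *m iter k (mulmx A) 1%:M = iter k (mulmx A) 1%:M *m A.
    by elim: k => [|k IHk] /=; rewrite ?mulmx1 ?mul1mx // {1}IHk mulmxA.
  by elim: m => //= m ->; rewrite c.
have itX x i : iter i (p_map p) x = lfun_exp x (p ^ i).
  have D y k l : lfun_exp y (k + l) = (lfun_exp y k \o lfun_exp y l)%VF.
    by elim: k => [|k IHk] /=; rewrite ?comp_lfun1l // IHk comp_lfunA.
  elim: i => [|i IHi] /=; first by rewrite /lfun_exp /= comp_lfun1r.
  rewrite IHi /p_map expnS; move: (p ^ i)%N => k.
  rewrite {1}/lfun_exp.
  by elim: {1 2}p => [|j IHj]; rewrite ?mul0n // mulSn D -IHj.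
have mdiag x : x \in t -> exists2 P : 'M_n, P \in unitmx & similar_diag P (mx x).
  move=> /tS[m]; set s := [seq _ | _ <- _] => xs.
  have szs : size s == m by rewrite size_map size_iota.
  have /= xE := @coord_span _ _ _ (Tuple szs) _ xs.
  apply: (@semisimple_diag _ _ m (fun i => coord (Tuple szs) i x)).
  rewrite {1}xE linear_sum; apply: eq_bigr => i _; rewrite linearZ /=.
  congr (_ *: _); rewrite (nth_map 0%N) ?size_iota // nth_iota // add1n itX.
  by rewrite mxX mxX'.
have mcomm x y : x \in t -> y \in t -> comm_mx (mx x) (mx y).
  move=> xt yt; apply/esym/eqP; rewrite -subr_eq0 -!mxM -linearB /=.
  by move: (tC _ _ xt yt); rewrite /lie_br => ->; rewrite linear0.
have /codiagonalizableP[P Pu /allP Pd] :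
    {in [seq mx x | x <- vbasis t] &, forall f g, comm_mx f g} /\
    {in [seq mx x | x <- vbasis t], forall f,
       exists2 P : 'M_n, P \in unitmx & similar_diag P f}.
  split=> [f g /mapP[x xt ->] /mapP[y yt ->]|f /mapP[x xt ->]].
    by apply: mcomm; exact: vbasis_mem.
  by apply: mdiag; exact: vbasis_mem.
pose D x := P *m mx x *m invmx P.
have DL : linear D.
  by move=> k x y; rewrite /D linearP mulmxDr mulmxDl -scalemxAr -scalemxAl.
have Dd x i j : x \in t -> i != j -> D x i j = 0.
  pose DD : {linear 'End(V) -> 'M[F]_n} :=
    HB.pack D (GRing.isLinear.Build _ _ _ _ D DL).
  move=> xt ij; rewrite (coord_vbasis xt) -[D]/(DD : _ -> _) linear_sum summxE.
  apply: big1 => k _; rewrite linearZ mxE.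
  have /Pd : mx (vbasis t)`_k \in [seq mx x | x <- vbasis t].
    by apply: map_f; apply: mem_nth; rewrite size_tuple.
  by move=> /(similar_diagP _ Pu)/(_ i j ij) h; rewrite [X in _ * X]h mulr0.
have DX x m : D (lfun_exp x m) = iter m (mulmx (D x)) 1%:M.
  rewrite /D mxX mxX'; elim: m => [|m IHm] /=; first by rewrite mulmx1 mulmxV.
  by rewrite -IHm !mulmxA (mulmxKV Pu) -!mulmxA.
have D0 x : D x = 0 -> x = 0.
  rewrite /D => /(congr1 (fun M => invmx P *m M *m P)).
  rewrite mulmx0 mul0mx !mulmxA mulVmx // mul1mx mulmxKV // => h.
  exact: mx_inj.
clearbody D.
pose f x : 'rV[F]_n := \row_i D x i i.
have fL : linear f by move=> k x y; apply/rowP => i; rewrite !mxE DL !mxE.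
pose phi : {linear 'End(V) -> 'rV[F]_n} :=
  HB.pack f (GRing.isLinear.Build _ _ _ _ f fL).
exists n, phi; split=> [x xt x0|x i xt].
  have /eqP : D x = 0.
    apply/matrixP => i j; rewrite [RHS]mxE; have [<-|] := eqVneq i j; last exact: Dd.
    by move/rowP: x0 => /(_ i); rewrite !mxE.
  by move/eqP/D0.
rewrite !mxE DX.
have /diag_mxP[d ->] : is_diag_mx (D x).
  by apply/is_diag_mxP => j k jk; apply: Dd.
suff h k : iter k (mulmx (diag_mx d)) 1%:M = diag_mx (\row_j d 0 j ^+ k).
  by rewrite h !mxE eqxx mulr1n.
elim: k => [|k IHk] /=.
  by apply/matrixP => j l; rewrite !mxE expr0.
rewrite IHk mulmx_diag; congr diag_mx; apply/rowP => j; rewrite !mxE exprS //.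
Qed.

Lemma Frob_fixed (a : F) : a ^+ p = a -> exists m : 'F_p, a = m%:R.
Proof.
move=> ap; have pp := pcharf_prime pF.
pose q : {poly F} := 'X^p - 'X.
have sq : size q = p.+1.
  by rewrite size_polyDl ?size_polyXn // size_polyN size_polyX ltnS prime_gt1.
case: (pickP (fun m : 'F_p => a == m%:R)) => [m /eqP|nm]; first by exists m.
pose s := a :: [seq (m : nat)%:R | m : 'F_p <- enum 'F_p].
suff : (size s < size q)%N.
  by rewrite /= size_map -cardE card_Fp // sq ltnn.
apply: max_poly_roots; first by rewrite -size_poly_eq0 sq.
  rewrite /= /root /q !hornerE ap subrr eqxx /=.
  apply/allP => _ /mapP[m _ ->].
  by rewrite /root !hornerE -(pFrobenius_autE pF) pFrobenius_aut_nat subrr.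
rewrite /= map_inj_uniq ?enum_uniq ?andbT.
  by apply/mapP => -[m _ am]; move: (nm m); rewrite am eqxx.
have lt (m : 'F_p) : (m < p)%N by rewrite -[X in (_ < X)%N](Fp_cast pp).
suff h (m l : 'F_p) : (m <= l)%N -> (m : nat)%:R = (l : nat)%:R :> F -> m = l.
  by move=> m l; case/orP: (leq_total m l) => ml /esym e; [|apply/esym]; apply: h.
move=> ml e; apply/val_inj/eqP; rewrite /= eqn_leq ml /= -subn_eq0 -leqn0.
have : (p %| l - m)%N.
  by rewrite (dvdn_pcharf pF) natrB // e subrr.
case: (posnP (l - m)%N) => [-> //|lm /(dvdn_leq lm)].
by rewrite leqNgt (leq_ltn_trans (leq_subr _ _) (lt l)).
Qed.

Lemma Fp_natrD (a b : 'F_p) : (nat_of_ord (a + b)%R)%:R = a%:R + b%:R :> F.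
Proof.
rewrite -natrD -[RHS](GRing.natr_mod_pchar pF) /= /Zp_add /=.
by congr (_ %% _)%:R; rewrite Fp_cast ?(pcharf_prime pF).
Qed.

Lemma Fp_natrM (a b : 'F_p) : (nat_of_ord (a * b)%R)%:R = a%:R * b%:R :> F.
Proof.
rewrite -natrM -[RHS](GRing.natr_mod_pchar pF) /=.
by congr (_ %% _)%:R; rewrite Fp_cast ?(pcharf_prime pF).
Qed.

(* t has an F-basis of toral elements that is also an F_p-basis of toral_span t,
   so mu extends to an F-linear form f on t with f (x^[p]) = (f x)^p. *)
Lemma torus_dual_extend (mu : torus_dual p t) :
  exists f : subvs_of t -> F^o,
  [/\ {morph f : x y / x + y} /\ forall k x, f (k *: x) = k *: f x,
   forall x y z, vsval z = lie_br (vsval x) (vsval y) ->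
     f z = f x * f y - f y * f x,
   forall x z, vsval z = p_map p (vsval x) -> f z = f x ^+ p
   & forall x, p_map p (vsval x) = vsval x -> f x = (mu (vsval x))%:R].
Proof.
have [N [phi [phi0 phiP]]] := torus_weights.
have [[_ tp] tC _] := tP.
pose d := \dim t; pose b := vbasis t.
pose A : 'M[F]_(N, d) := \matrix_(i, j) phi b`_j 0 i.
have Afull : row_full A.
  rewrite /row_full -mxrank_tr -/(row_free _) -kermx_eq0; apply/rowV0P => v.
  move=> /sub_kermxP vA.
  have /phi0 h : \sum_j v 0 j *: b`_j \in t.
    by apply: rpred_sum => j _; rewrite rpredZ // vbasis_mem // mem_nth // size_tuple.
  have : \sum_j v 0 j *: b`_j = 0.
    apply: h; apply/rowP => i; move/rowP: vA => /(_ i); rewrite !mxE => <-.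
    rewrite linear_sum summxE; apply: eq_bigr => j _.
    by rewrite linearZ !mxE.
  move/freeP: (basis_free (vbasisP t)) => fr /fr v0.
  by apply/rowP => j; rewrite v0 mxE.
pose k := fullrankfun Afull; pose B := rowsub k A.
have Bu : B \in unitmx := fullrowsub_unit Afull.
pose c l := \sum_j invmx B j l *: b`_j.
have bt j : (j < d)%N -> b`_j \in t.
  by move=> jd; rewrite vbasis_mem // mem_nth // size_tuple.
have ct l : c l \in t by apply: rpred_sum => j _; rewrite rpredZ // bt.
have phic l i : phi (c l) 0 (k i) = (i == l)%:R.
  rewrite linear_sum summxE.
  have := mulmxV Bu => /matrixP/(_ i l); rewrite !mxE => <-.
  by apply: eq_bigr => j _; rewrite linearZ !mxE mulrC.
have kinj x : x \in t -> (forall i, phi x 0 (k i) = 0) -> x = 0.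
  move=> xt x0; rewrite (coord_vbasis xt).
  pose v := \col_j coord b j x.
  suff v0 : v = 0.
    by apply: big1 => j _; move/colP: v0 => /(_ j); rewrite !mxE => ->; rewrite scale0r.
  rewrite -[v](mulKmx Bu) (_ : B *m v = 0) ?mulmx0 //.
  apply/colP => i; rewrite !mxE -[RHS](x0 i) [in RHS](coord_vbasis xt) linear_sum summxE.
  by apply: eq_bigr => j _; rewrite linearZ !mxE mulrC.
have xE x : x \in t -> x = \sum_l phi x 0 (k l) *: c l.
  move=> xt; apply/eqP; rewrite -subr_eq0; apply/eqP/kinj.
    by rewrite rpredB // rpred_sum // => l _; rewrite rpredZ.
  move=> i; rewrite linearB /= linear_sum !mxE summxE (bigD1 i) //= big1 => [|l li].
    by rewrite linearZ !mxE phic eqxx mulr1 addr0 subrr.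
  by rewrite linearZ !mxE phic eq_sym (negPf li) mulr0.
have ctor l : toral p t (c l).
  split=> //; apply/eqP; rewrite -subr_eq0; apply/eqP/kinj.
    by rewrite rpredB // tp.
  move=> i; rewrite linearB /= !mxE phiP // phic -(pFrobenius_autE pF).
  by rewrite pFrobenius_aut_nat subrr.
pose f (x : subvs_of t) : F^o := \sum_l phi (vsval x) 0 (k l) * (mu (c l))%:R.
have f0 z : vsval z = 0 -> f z = 0.
  by move=> z0; apply: big1 => l _; rewrite z0 linear0 mxE mul0r.
have span_c m (g : 'I_m -> 'I_d) (a : 'I_m -> 'F_p) :
    toral_span p t (\sum_i (a i)%:R *: c (g i)).
  by exists m, (c \o g), a; split=> [i|] //; apply: ctor.
exists f; split.
- split=> [x y|a x].
    rewrite /f -big_split; apply: eq_bigr => l _.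
    by rewrite /= linearD mxE mulrDl.
  rewrite /f scaler_sumr; apply: eq_bigr => l _.
  by rewrite /= linearZ mxE -mulrA.
- by move=> x y z zE; rewrite f0 ?zE ?tC ?subvsP // mulrC subrr.
- move=> x z zE; rewrite /f -(pFrobenius_autE pF) rmorph_sum.
  apply: eq_bigr => l _; rewrite zE phiP ?subvsP // rmorphM /=.
  by rewrite pFrobenius_aut_nat pFrobenius_autE.
move=> x xp.
have /choice[m mE] l : exists m : 'F_p, phi (vsval x) 0 (k l) = m%:R.
  by apply: Frob_fixed; rewrite -phiP ?subvsP // xp.
have mu0 : mu 0 = 0.
  have z : toral_span p t 0.
    by exists 0%N, (fun _ => 0), (fun _ => 0); split=> [[]|] //; rewrite big_ord0.
  have := torus_dualP mu 1 z z; rewrite scaler0 addr0 mul1r => /esym.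
  by rewrite -[RHS]addr0 => /addrI.
have muS : forall n (g : 'I_n -> 'I_d) (a : 'I_n -> 'F_p),
    (mu (\sum_i (a i)%:R *: c (g i)))%:R =
    \sum_i (a i)%:R * (mu (c (g i)))%:R :> F.
  elim=> [|n IHn] g a; first by rewrite !big_ord0 mu0.
  have cs : toral_span p t (c (g ord0)).
    exists 1%N, (fun _ => c (g ord0)), (fun _ => 1); split=> [i|]; first exact: ctor.
    by rewrite big_ord1 scale1r.
  rewrite !big_ord_recl torus_dualP //.
  by rewrite Fp_natrD Fp_natrM IHn.
rewrite /f [in RHS](xE _ (subvsP x)).
under eq_bigr do rewrite mE; under [in RHS]eq_bigr do rewrite mE.
by rewrite (muS d id m).
Qed.

End TorusWeights.

Section TorusModules.
Variables (F : closedFieldType) (p : nat) (pF : p \in [pchar F]).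
Variables (V : vectType F) (t : {vspace 'End(V)}).
Hypothesis tP : torus p t.
Variable mu : torus_dual p t.

Let weight := cid (torus_dual_extend pF tP mu).

(* The character of u(t) attached to mu; torus_charE determines it, since the
   toral elements span t. *)
Definition torus_char : {lrmorphism u_alg t pF -> F^o} :=
  let: And4 (conj fD fZ) fB fP _ := projT2 weight in u_lift pF fD fZ fB fP.

Lemma torus_charE x : p_map p (vsval x) = vsval x ->
  torus_char (u_gen pF x) = (mu (vsval x))%:R.
Proof.
rewrite /torus_char; case: (projT2 weight) => -[fD fZ] fB fP fE /fE <-.
exact: u_liftE.
Qed.

(* F(mu): the space F, with u(t) acting through torus_char; see torus_moduleE. *)
Definition torus_module : lmodType (u_alg t pF) :=
  pullback torus_char (F^o)^o.

Lemma torus_moduleE x (v : torus_module) : p_map p (vsval x) = vsval x ->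
  u_gen pF x *: v = (mu (vsval x))%:R%:A *: v.
Proof.
move=> xp; rewrite -[LHS]/(torus_char (u_gen pF x) * (v : F)) torus_charE //.
by rewrite -[RHS]/(torus_char _ * (v : F)) linearZ /= rmorph1 [_ *: 1]mulr1.
Qed.

Variable L : {vspace 'End(V)}.
Hypothesis tL : (t <= L)%VS.

(* ind_t^L F(mu) = u(L) (x)_{u(t)} F(mu). *)
Definition ind_torus : lmodType (u_alg L pF) :=
  ind (u_incl pF tL) torus_module.

End TorusModules.

Section Pim.
Variables (F : fieldType) (p : nat) (pF : p \in [pchar F]) (V : vectType F).
Variable L : {vspace 'End(V)}.

(* The upper bound for the dimensions of the projective indecomposables. *)
Definition max_pim_dim : nat := (p ^ (\dim L - MT p L))%N.

Definition trivial_module : lmodType (u_alg L pF) :=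
  pullback (u_aug pF L) (F^o)^o.

Definition has_max_0pim : Prop :=
  exists2 P : lmodType (u_alg L pF),
    projective_cover P trivial_module & has_dim P max_pim_dim.
End Pim.

Section Zassenhaus.
Variables (F : fieldType) (p n : nat).

(* O(1;n), in coordinates with respect to the basis dp k = x^(k), k < p^n;
   dp k = 0 for k >= p^n. *)
Definition divpow := 'rV[F]_(p ^ n)%N.

Definition dp (k : nat) : divpow := \row_i ((i : nat) == k)%:R.

Definition dp_mul (f g : divpow) : divpow :=
  \sum_(a < (p ^ n)%N) \sum_(b < (p ^ n)%N)
    (f 0 a * g 0 b * 'C(a + b, a)%:R) *: dp (a + b).

Definition dp_der : 'End(divpow) :=
  linfun (fun f : divpow =>
    \sum_(a < (p ^ n)%N | (0 < a)%N) f 0 a *: dp a.-1).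

Lemma dp_derE f : dp_der f = \sum_(a < (p ^ n)%N | (0 < a)%N) f 0 a *: dp a.-1.
Proof.
pose h (f : divpow) := \sum_(a < (p ^ n)%N | (0 < a)%N) f 0 a *: dp a.-1.
have hL : linear h.
  move=> k g g'; rewrite /h scaler_sumr -big_split /=; apply: eq_bigr => a _.
  by rewrite !mxE scalerDl scalerA.
pose H : {linear divpow -> divpow} :=
  HB.pack h (GRing.isLinear.Build _ _ _ _ h hL).
exact: (lfunE H).
Qed.

(* witt_e k is x^(k) d, that is, e_(k-1) in the indexing e_j = x^(j+1) d. *)
Definition witt_e (k : nat) : 'End(divpow) :=
  linfun (fun f => dp_mul (dp k) (dp_der f)).

Lemma witt_eE k f : witt_e k f = dp_mul (dp k) (dp_der f).
Proof.
pose h f := dp_mul (dp k) (dp_der f).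
have hL : linear h.
  move=> c g g'; rewrite /h linearP /dp_mul scaler_sumr -big_split /=.
  apply: eq_bigr => a _; rewrite scaler_sumr -big_split /=.
  apply: eq_bigr => b _; rewrite !mxE scalerA -scalerDl; congr (_ *: _).
  by rewrite mulrDr mulrDl [_ * (c * _)]mulrCA -!mulrA.
pose H : {linear divpow -> divpow} :=
  HB.pack h (GRing.isLinear.Build _ _ _ _ h hL).
exact: (lfunE H).
Qed.

Definition witt : {vspace 'End(divpow)} := <<mkseq witt_e (p ^ n)%N>>%VS.

(* ad D on W(1;n), which is closed under the bracket, so that vsproj only
   changes the type. *)
Definition witt_ad (D : 'End(divpow)) : 'End(subvs_of witt) :=
  linfun (fun w => vsproj witt (lie_br D (vsval w))).

Lemma witt_adE D w : witt_ad D w = vsproj witt (lie_br D (vsval w)).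
Proof.
pose h (w : subvs_of witt) := vsproj witt (lie_br D (vsval w)).
have hL : linear h.
  move=> c v v'; rewrite /h -linearP; congr (vsproj _ _).
  rewrite /lie_br linearP /= comp_lfunDr comp_lfunDl -comp_lfunZr.
  rewrite -comp_lfunZl.
  by rewrite scalerBr opprD addrACA.
pose H : {linear subvs_of witt -> subvs_of witt} :=
  HB.pack h (GRing.isLinear.Build _ _ _ _ h hL).
exact: (lfunE H).
Qed.

(* The sum of the lines F . d^[p]^k, 1 <= k <= n - 1, and W(1;n), inside
   Der(W(1;n)), elements of W(1;n) being identified with their adjoint maps. *)
Definition zassenhaus : {vspace 'End(subvs_of witt)} :=
  (\sum_(1 <= k < n) <[iter k (p_map p) (witt_ad dp_der)]> +
     <<[seq witt_ad D | D <- mkseq witt_e (p ^ n)%N]>>)%VS.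

End Zassenhaus.

(* Main.v *)
From HB Require Import structures.
From mathcomp Require Import all_boot all_algebra.
From mathcomp Require Import zify.
From mathcomp Require Import boolp.
From mathcomp Require finmap monalg.
Require Import Defs.

Set Implicit Arguments.
Unset Strict Implicit.
Unset Printing Implicit Defensive.

Import GRing.Theory.
Local Open Scope ring_scope.

(** Let J be the annihilator of W(1;n) in u(L), L the restricted Zassenhaus
    algebra.  Every nonzero restricted L-module contains a nonzero vector on
    which the positive part of the standard filtration acts by a character.
    Comparing this vector with x^(2^n - 1) d (character 0) or x^(2^n - 2) d
    (character 1) in W(1;n) shows that J kills some such vector.  Let R consist
    of the elements acting by zero on the derived algebra of W(1;n) and on the
    trivial quotient; as R^2 lies in J, the same holds for R, so R is a
    nilpotent ideal.

    The element S = d + x^(2^n - 1) d satisfies S^(2^n) = S, so its iterates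
    under the [2]-map span an n-dimensional torus.  The eigenvectors of S on
    W(1;n) are determined by one coordinate, so each primitive idempotent e of
    that torus has e u(L) e in F e + J: the left ideal u(L) e is indecomposable.
    These left ideals exhaust the projective indecomposables up to isomorphism,
    and by PBW each has dimension 2^(dim L - n).  An arbitrary torus of
    dimension m gives projectives of dimension 2^(dim L - m); each maps onto
    some u(L) e, so m <= n, with an isomorphism if m = n. *)

(** The comparison with W(1;n) works because u(L), modulo the left ideal killing a primitive vector,
    is spanned by the 2^n powers of d, and on x^(2^n - 1) d these powers act linearly independently.
    Only the characters 0 and 1 occur because x d is toral, hence idempotent in u(L). In
    characteristic 2 the bracket of x^(k) d and x^(a) d has coefficient C(k + a, k), which is even
    for k + a = 2^n, so x^(2^n - 1) d is never reached and W(1;n) is not simple. S permutes a basis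
    of the derived algebra in one cycle of length 2^n - 1: its weights there are the nonzero
    elements of the field with 2^n elements, once each, and the trivial quotient supplies the weight
    0. So all weight spaces of W(1;n) are lines, which makes the corners e u(L) e small. Since u(L)
    is given by generators and relations, its dimension has to be proved; the inclusion of L in
    ['End(V)] provides coordinate forms for that. Modules are not assumed finite-dimensional, so
    arguments run modulo a submodule given as a predicate, without composition series. *)

Section LinearSpan.
Variables (F : fieldType) (M : lmodType F).
Implicit Types (G : M -> Prop).

(** A span for arbitrary families in arbitrary modules: u(L) carries no [vectType] structure, and
    membership in a filtration step is proved by induction on combinations. *)
Inductive lspan G : M -> Prop :=
  | lspan0 : lspan G 0
  | lspan_cons k g m : G g -> lspan G m -> lspan G (k *: g + m).

Lemma lspan_gen G g : G g -> lspan G g.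
Proof.
by move=> Gg; rewrite -[g]addr0 -[g]scale1r; apply: lspan_cons => //; apply: lspan0.
Qed.

Lemma lspanD G x y : lspan G x -> lspan G y -> lspan G (x + y).
Proof.
move=> hx hy; elim: hx => [|k g m Gg _ IH]; first by rewrite add0r.
by rewrite -addrA; apply: lspan_cons.
Qed.

Lemma lspanZ G k x : lspan G x -> lspan G (k *: x).
Proof.
elim=> [|l g m Gg _ IH]; first by rewrite scaler0; apply: lspan0.
by rewrite scalerDr scalerA; apply: lspan_cons.
Qed.

Lemma lspanN G x : lspan G x -> lspan G (- x).
Proof. by move=> /(lspanZ (-1)); rewrite scaleN1r. Qed.

Lemma lspanB G x y : lspan G x -> lspan G y -> lspan G (x - y).
Proof. by move=> hx /lspanN; apply: lspanD. Qed.

Lemma lspan_sum G I (r : seq I) (P : pred I) (f : I -> M) :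
  (forall i, P i -> lspan G (f i)) -> lspan G (\sum_(i <- r | P i) f i).
Proof. by move=> h; apply: big_ind => //; [exact: lspan0|exact: lspanD]. Qed.

Lemma lspan_min G (A : M -> Prop) : A 0 ->
  (forall k g m, G g -> A m -> A (k *: g + m)) -> forall x, lspan G x -> A x.
Proof. by move=> A0 AP x; elim=> // k g m Gg _; apply: AP. Qed.

Lemma lspan_sub G G' : (forall g, G g -> lspan G' g) ->
  forall x, lspan G x -> lspan G' x.
Proof.
move=> h; apply: lspan_min => [|k g m /h hg hm]; first exact: lspan0.
by apply: lspanD => //; apply: lspanZ.
Qed.

Lemma lspan_mono G G' : (forall g, G g -> G' g) ->
  forall x, lspan G x -> lspan G' x.
Proof. by move=> h; apply: lspan_sub => g /h; apply: lspan_gen. Qed.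

End LinearSpan.

Lemma lspan_fin (F : fieldType) (M : lmodType F) (I : finType) (b : I -> M) x :
  lspan (fun g => exists i, g = b i) x -> exists c : I -> F, x = \sum_i c i *: b i.
Proof.
elim=> [|k _ m [i ->] _ [c ->]].
  by exists (fun _ => 0); rewrite big1 // => i _; rewrite scale0r.
exists (fun j => (if j == i then k else 0) + c j).
under [RHS]eq_bigr do rewrite scalerDl.
rewrite big_split /=; congr (_ + _).
rewrite (bigD1 i) //= eqxx big1 ?addr0 // => j /negPf->.
by rewrite scale0r.
Qed.

Lemma mask_inj (T : eqType) (s : seq T) b b' : uniq s ->
  size b = size s -> size b' = size s -> mask b s = mask b' s -> b = b'.
Proof.
have no_head x m r (l : seq T) : x \notin l -> x :: mask m l <> mask r l.
  move=> xl e; have : x \in mask r l by rewrite -e mem_head.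
  by move/mem_mask; rewrite (negPf xl).
elim: s b b' => [|x s IHs] [|y b] [|y' b'] //= /andP[xs us] [sb] [sb'].
case: y; case: y' => /= e.
- by case: e => /(IHs _ _ us sb sb')->.
- by case: (no_head _ _ _ _ xs e).
- by case: (no_head _ _ _ _ xs (esym e)).
- by rewrite (IHs _ _ us sb sb' e).
Qed.

(** * Restricted PBW theorem in characteristic 2 *)

(* Ordered square-free monomials in a family whose commutators and squares are
   affine combinations of the family. *)
Section SquareFreeMonomials.
Variables (F : fieldType) (A : algType F) (d : nat) (a : nat -> A).

Definition mon (s : seq nat) : A := \prod_(i <- s) a i.

Lemma mon_cons i s : mon (i :: s) = a i * mon s.
Proof. exact: big_cons. Qed.

Lemma mon_cat s s' : mon (s ++ s') = mon s * mon s'.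
Proof. exact: big_cat. Qed.

Definition smon k (u : A) :=
  exists s, [/\ sorted ltn s, all (gtn d) s, (size s < k)%N & u = mon s].

Definition affine (u : A) := lspan (fun g => g = 1 \/ exists2 i, (i < d)%N & g = a i) u.

Hypothesis a_comm : forall i j, (i < d)%N -> (j < d)%N ->
  affine (a i * a j - a j * a i).
Hypothesis a_sqr : forall i, (i < d)%N -> affine (a i * a i).

Let insert i s := sort leq (i :: s).

Let insertE i s : sorted ltn (i :: s) -> insert i s = i :: s.
Proof.
move=> h; apply: (sorted_sort leq_trans).
by move: h; rewrite ltn_sorted_uniq_leq => /andP[].
Qed.

Let insert_cons i j s : sorted ltn (j :: s) -> (j < i)%N ->
  insert i (j :: s) = j :: insert i s.
Proof.
move=> js ji; apply: (sorted_eq leq_trans anti_leq).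
- exact: sort_sorted leq_total _.
- rewrite /= path_min_sorted; first exact: sort_sorted leq_total _.
  rewrite /insert all_sort /= (ltnW ji) /=.
  by move: js => /= /(order_path_min ltn_trans); apply: sub_all => x /ltnW.
- rewrite perm_sort (perm_catCA [:: i] [:: j] s) perm_cons.
  by rewrite perm_sym perm_sort.
Qed.

(** Straightening, by strong induction on the length: [a i] moves right to its place in [s]. Each
    exchange costs an affine commutator times a shorter monomial, and meeting another [a i] produces
    a square, again affine. *)
Let step k : forall s, sorted ltn s -> all (gtn d) s -> size s = k ->
  forall i, (i < d)%N ->
  (i \in s -> lspan (smon k.+1) (a i * mon s)) /\
  (i \notin s -> lspan (smon k.+1) (a i * mon s - mon (insert i s))).
Proof.
have [m] := ubnP k; elim: m k => // m IHm k km.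
have smonW j l x : (j <= l)%N -> lspan (smon j) x -> lspan (smon l) x.
  move=> jl; apply: lspan_mono => _ [s [? ? sj ->]]; exists s; split=> //.
  exact: leq_trans jl.
have mulS l i x : (l < m)%N -> (i < d)%N -> lspan (smon l.+1) x ->
    lspan (smon l.+2) (a i * x).
  move=> lm id; elim=> [|c _ y [s [ss sd sl ->]] _ IHy].
    by rewrite mulr0; exact: lspan0.
  rewrite mulrDr -scalerAr; apply: lspanD => //; apply: lspanZ.
  have [in_s nin_s] := IHm (size s) (@leq_ltn_trans l _ _ sl lm) s ss sd erefl i id.
  have [/in_s|is_] := boolP (i \in s); first by apply: smonW; rewrite ltnW.
  have {nin_s} h := nin_s is_.
  rewrite -(subrK (mon (insert i s)) (a i * _)); apply: lspanD.
    by apply: smonW h; rewrite (leq_trans sl).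
  apply: lspan_gen; exists (insert i s); split=> //.
  - rewrite ltn_sorted_uniq_leq sort_uniq /= is_ sort_sorted ?andbT //; last exact: leq_total.
    by move: ss; rewrite ltn_sorted_uniq_leq => /andP[].
  - by rewrite all_sort /= id.
  - by rewrite size_sort.
have affS u s : affine u -> sorted ltn s -> all (gtn d) s -> (size s < m)%N ->
    lspan (smon (size s).+2) (u * mon s).
  move=> hu ss sd sm; elim: hu => [|c g y gP _ IHy].
    by rewrite mul0r; exact: lspan0.
  rewrite mulrDl -scalerAl; apply: lspanD => //; apply: lspanZ.
  case: gP => [->|[i id ->]].
    by rewrite mul1r; apply: lspan_gen; exists s; split.
  by apply: mulS => //; apply: lspan_gen; exists s; split.
move=> [|j s] ss sd sk i id.
  by rewrite in_nil; split=> // _; rewrite insertE // mon_cons subrr; apply: lspan0.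
move: sd => /= /andP[jd sd].
have ss' : sorted ltn s := path_sorted ss.
have sm : (size s < m)%N by move: km; rewrite -sk /= ltnS.
case: (ltngtP i j) => ij.
- split=> [|_].
    rewrite in_cons ltn_eqF //= => is_.
    move: ss => /= /(order_path_min ltn_trans)/allP/(_ _ is_) /= /(ltn_trans ij).
    by rewrite ltnn.
  by rewrite insertE /= ?ij // !mon_cons subrr; apply: lspan0.
- have swap : a i * mon (j :: s) = a j * (a i * mon s) + (a i * a j - a j * a i) * mon s.
    by rewrite mon_cons mulrBl !mulrA addrCA subrr addr0.
  have hc := affS _ _ (a_comm id jd) ss' sd sm.
  have [in_s nin_s] := IHm (size s) sm s ss' sd erefl i id.
  rewrite in_cons gtn_eqF //= -sk /= insert_cons // mon_cons -mon_cons swap.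
  split=> [is_|is_].
    by apply: lspanD => //; apply: mulS (in_s is_).
  rewrite addrAC mon_cons -mulrBr; apply: lspanD => //.
  by apply: mulS (nin_s is_).
- subst j; rewrite inE eqxx; split=> // _.
  rewrite mon_cons mulrA -sk.
  exact: affS (a_sqr id) _ _ _.
Qed.

Lemma smon_mul i k x : (i < d)%N -> lspan (smon k) x -> exists l, lspan (smon l) (a i * x).
Proof.
move=> id; elim=> [|c _ y [s [ss sd sk ->]] _ [l hl]].
  by exists 0%N; rewrite mulr0; exact: lspan0.
have smonW j m z : (j <= m)%N -> lspan (smon j) z -> lspan (smon m) z.
  move=> jm; apply: lspan_mono => _ [r [? ? rj ->]]; exists r; split=> //.
  exact: leq_trans jm.
suff [q hq] : exists q, lspan (smon q) (a i * mon s).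
  exists (maxn q l); rewrite mulrDr -scalerAr; apply: lspanD.
    by apply/lspanZ/(smonW q); rewrite ?leq_maxl.
  by apply: (smonW l); rewrite ?leq_maxr.
have [in_s nin_s] := step ss sd erefl id.
have [/in_s|is_] := boolP (i \in s); first by exists (size s).+1.
exists (size s).+2; rewrite -(subrK (mon (insert i s)) (a i * _)); apply: lspanD.
  by apply: smonW (nin_s is_).
apply: lspan_gen; exists (insert i s); split=> //.
- rewrite ltn_sorted_uniq_leq sort_uniq /= is_ sort_sorted ?andbT //; last exact: leq_total.
  by move: ss; rewrite ltn_sorted_uniq_leq => /andP[].
- by rewrite all_sort /= id.
- by rewrite size_sort.
Qed.

Lemma smon_mask k x : lspan (smon k) x ->
  lspan (fun g => exists b : d.-tuple bool, g = mon (mask b (iota 0 d))) x.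
Proof.
apply: lspan_mono => _ [s [ss sd _ ->]].
have /subseqP[b sb ->] : subseq s (iota 0 d).
  have -> : s = filter (mem s) (iota 0 d).
    apply: (irr_sorted_eq ltn_trans ltnn) => //.
      by apply: sorted_filter; [exact: ltn_trans|exact: iota_ltn_sorted].
    move=> i; rewrite mem_filter mem_iota /= add0n.
    by case: (boolP (i \in s)) => // /(allP sd) /= ->.
  exact: filter_subseq.
by rewrite size_iota in sb; exists (Tuple (introT eqP sb)).
Qed.

End SquareFreeMonomials.

Section EndomorphismMatrix.
Variables (F : fieldType) (V : vectType F) (N : nat) (e : N.+1.-tuple V).
Hypothesis eb : basis_of {:V} e.

(** Columns hold the images of the basis vectors, so that composition becomes the matrix product in
    the same order. *)
Definition endmx (x : 'End(V)) : 'M[F]_N.+1 := \matrix_(i, j) coord e i (x e`_j).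

Lemma endmx_linear : linear endmx.
Proof. by move=> k x y; apply/matrixP => i j; rewrite !mxE !lfunE /= lfunE /= linearP. Qed.

HB.instance Definition _ :=
  GRing.isLinear.Build F 'End(V) 'M[F]_N.+1 _ endmx endmx_linear.

Lemma coordE v : v = \sum_i coord e i v *: e`_i.
Proof. by apply: coord_basis eb _; rewrite memvf. Qed.

Lemma endmxM x y : endmx (x \o y)%VF = endmx x * endmx y.
Proof.
apply/matrixP => i j; rewrite !mxE lfunE /= {1}[y _]coordE linear_sum linear_sum.
by apply: eq_bigr => k _; rewrite !linearZ !mxE /= mulrC.
Qed.

Lemma endmx1 : endmx \1%VF = 1.
Proof.
apply/matrixP => i j; rewrite !mxE lfunE /= coord_free ?(basis_free eb) //.
by rewrite eq_sym.
Qed.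

Lemma endmx_exp x m : endmx (lfun_exp x m) = endmx x ^+ m.
Proof.
by elim: m => [|m IHm]; rewrite ?expr0 ?endmx1 // exprS -IHm -endmxM.
Qed.

(** The coefficients are the values of [f] on the matrix units. This is how a coordinate form of L
    is contracted with the matrix entries of the comultiplication. *)
Lemma endmx_form (f : {linear 'End(V) -> F^o}) :
  exists psi : 'I_N.+1 -> 'I_N.+1 -> F,
    forall x, f x = \sum_i \sum_j endmx x i j * psi i j.
Proof.
have unit_lin i j : linear (fun v => coord e j v *: e`_i).
  by move=> k u v; rewrite linearP scalerDl scalerA.
pose E i j : 'End(V) := linfun (HB.pack_for {linear V -> V} (fun v => coord e j v *: e`_i)
  (GRing.isLinear.Build _ _ _ _ (fun v => coord e j v *: e`_i) (unit_lin i j))).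
have EE x : x = \sum_i \sum_j endmx x i j *: E i j.
  apply/lfunP => v; rewrite sum_lfunE [x v]coordE; apply: eq_bigr => i _.
  rewrite sum_lfunE {1}[v]coordE !linear_sum scaler_suml.
  apply: eq_bigr => j _; rewrite lfunE /= lfunE /= !linearZ mxE /= scalerA.
  by rewrite mulrC.
exists (fun i j => f (E i j)) => x.
rewrite {1}(EE x) linear_sum; apply: eq_bigr => i _; rewrite linear_sum.
by apply: eq_bigr => j _; rewrite linearZ.
Qed.

End EndomorphismMatrix.

Section MatricesOverAlgebra.
Variables (F : fieldType) (A : algType F) (N : nat).

(* An alias, because 'M[A]_N.+1 already carries a scaling by A instead of F. *)
Definition algmx := 'M[A]_N.+1.

HB.instance Definition _ := GRing.NzRing.on algmx.

Definition algmx_scale (k : F) (M : algmx) : algmx := map_mx ( *:%R k) M.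

Fact algmx_scaleA k l M : algmx_scale k (algmx_scale l M) = algmx_scale (k * l) M.
Proof. by apply/matrixP => i j; rewrite !mxE scalerA. Qed.

Fact algmx_scale1 : left_id 1 algmx_scale.
Proof. by move=> M; apply/matrixP => i j; rewrite !mxE scale1r. Qed.

Fact algmx_scaleDr : right_distributive algmx_scale +%R.
Proof. by move=> k M M'; apply/matrixP => i j; rewrite !mxE scalerDr. Qed.

Fact algmx_scaleDl M : {morph algmx_scale^~ M : k l / k + l}.
Proof. by move=> k l; apply/matrixP => i j; rewrite !mxE scalerDl. Qed.

HB.instance Definition _ := GRing.Zmodule_isLmodule.Build F algmx
  algmx_scaleA algmx_scale1 algmx_scaleDr algmx_scaleDl.

Fact algmx_scaleAl k (M M' : algmx) : k *: (M * M') = (k *: M) * M'.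
Proof.
apply/matrixP => i j; rewrite !mxE scaler_sumr; apply: eq_bigr => l _.
by rewrite !mxE scalerAl.
Qed.

HB.instance Definition _ := GRing.Lmodule_isLalgebra.Build F algmx algmx_scaleAl.

Fact algmx_scaleAr k (M M' : algmx) : k *: (M * M') = M * (k *: M').
Proof.
apply/matrixP => i j; rewrite !mxE scaler_sumr; apply: eq_bigr => l _.
by rewrite !mxE scalerAr.
Qed.

HB.instance Definition _ := GRing.Lalgebra_isAlgebra.Build F algmx algmx_scaleAr.

(** [algmx] plays the role of the tensor product of A with a matrix algebra over F; [smx] and [cmx]
    embed its two factors, which commute. *)
Definition cmx (M : 'M[F]_N.+1) : algmx := map_mx (in_alg A) M.

Lemma cmxM M M' : cmx (M * M') = cmx M * cmx M'.
Proof. exact: map_mxM. Qed.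

Lemma cmxD M M' : cmx (M + M') = cmx M + cmx M'.
Proof. exact: map_mxD. Qed.

Lemma cmxB M M' : cmx (M - M') = cmx M - cmx M'.
Proof. exact: map_mxB. Qed.

Lemma cmxZ k M : cmx (k *: M) = k *: cmx M.
Proof. by apply/matrixP => i j; rewrite !mxE /= scalerA. Qed.

Definition smx (x : A) : algmx := x%:M.

Lemma smx_cmx x M : smx x * cmx M = cmx M * smx x.
Proof.
rewrite [LHS]mul_scalar_mx; apply/matrixP => i j; rewrite !mxE (bigD1 j) //= big1.
  by rewrite !mxE eqxx mulr1n addr0 -scalerAl -scalerAr mul1r mulr1.
by move=> k /negPf kj; rewrite !mxE kj mulr0n mulr0.
Qed.

Lemma smxM x y : smx (x * y) = smx x * smx y.
Proof. by rewrite [RHS]mul_scalar_mx scale_scalar_mx. Qed.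

End MatricesOverAlgebra.

Lemma commutatorD (R : pzRingType) (a b a' b' : R) : a * b' = b' * a -> a' * b = b * a' ->
  (a + b) * (a' + b') - (a' + b') * (a + b) = (a * a' - a' * a) + (b * b' - b' * b).
Proof.
move=> h h'; rewrite !mulrDl !mulrDr h h' [b * a' + b * b']addrC.
rewrite [b' * a + b' * b]addrC [X in X - _]addrACA [X in _ - X]addrACA [b * a' + b' * a]addrC.
by rewrite opprD [LHS]addrACA subrr addr0 opprD addrACA.
Qed.

Lemma addxx2 (F : fieldType) (M : lmodType F) (x : M) : 2%N \in [pchar F] -> x + x = 0.
Proof. by move=> pF; rewrite -mulr2n -scaler_nat pcharf0 // scale0r. Qed.

Lemma u_gen_coord (F : fieldType) (p : nat) (pF : p \in [pchar F]) (V : vectType F)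
    (L : {vspace 'End(V)}) (d : nat) (X : d.-tuple 'End(V)) (x : subvs_of L) : basis_of L X ->
  u_gen pF x = \sum_k coord X k (vsval x) *: u_gen pF (vsproj L X`_k).
Proof.
move=> Xb.
have xE : x = \sum_k coord X k (vsval x) *: vsproj L X`_k.
  apply: val_inj; rewrite /= {1}(coord_basis Xb (subvsP x)) linear_sum /=.
  apply: eq_bigr => k _; rewrite vsprojK // (basis_mem Xb) //.
  by apply: mem_nth; rewrite size_tuple.
rewrite {1}xE; elim/big_ind2: _ => [|u v u' v' <- <-|k _]; last exact: u_genZr.
  by rewrite -(scale0r (0 : subvs_of L)) u_genZr scale0r.
exact: u_genDr.
Qed.

(** Induction on formal expressions, with [v] kept general: a product acts on [v] one factor at a
    time, so [S] need not contain 1. *)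
Lemma u_alg_closed (F : fieldType) (p : nat) (pF : p \in [pchar F]) (V : vectType F)
    (L : {vspace 'End(V)}) (S : u_alg L pF -> Prop) :
  (forall u v, S u -> S v -> S (u + v)) -> (forall k u, S u -> S (k *: u)) ->
  (forall x u, S u -> S (u_gen pF x * u)) -> forall u v, S v -> S (u * v).
Proof.
move=> SD SZ SG; elim/u_ind; elim=> [x|k|a IHa b IHb|a IHa b IHb] v Sv.
- exact: SG.
- have -> : u_pi pF (UConst L k) = k%:A by rewrite -[RHS]/(u_const pF L k * 1) mulr1.
  by rewrite mulr_algl; apply: SZ.
- by rewrite u_piD [X in S X]mulrDl; apply: SD; [apply: IHa|apply: IHb].
- by rewrite u_piM -[X in S X]mulrA; apply: IHa; apply: IHb.
Qed.

Section Coproduct.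
Variables (F : fieldType) (pF : 2%N \in [pchar F]) (V : vectType F).
Variables (L : {vspace 'End(V)}) (N : nat) (e : N.+1.-tuple V).
Hypothesis eb : basis_of {:V} e.
Local Notation U := (u_alg L pF).
Local Notation M := (algmx U N).

(* The comultiplication of u(L), followed by the representation of L on V in the
   second factor. *)
Fact coprod_subproof :
  let f (x : subvs_of L) : M := smx _ (u_gen pF x) + cmx U (endmx e (vsval x)) in
  [/\ {morph f : x y / x + y}, forall k x, f (k *: x) = k *: f x,
   forall x y z, vsval z = lie_br (vsval x) (vsval y) ->
     f z = f x * f y - f y * f x
   & forall x z, vsval z = p_map 2 (vsval x) -> f z = f x ^+ 2].
Proof.
move=> f; split=> [x y|k x|x y z h|x z h]; rewrite /f.
- rewrite u_genDr !linearD /= cmxD /smx.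
  by rewrite [scalar_mx _]raddfD addrACA.
- rewrite u_genZr scalerDr -cmxZ !linearZ /=; congr (_ + _).
  by apply/matrixP => i j; rewrite !mxE scalerMnr.
- rewrite (u_genBr pF h) h commutatorD ?smx_cmx // /lie_br linearB cmxB.
  rewrite /= !endmxM // !cmxM -!smxM; congr (_ + _).
  exact: (raddfB (@scalar_mx U N.+1)).
- rewrite (u_genPr pF h) h [RHS]expr2 mulrDl !mulrDr smx_cmx.
  rewrite -addrA [X in _ = _ + X]addrA addxx2 // add0r.
  by rewrite -smxM -expr2 -cmxM -expr2 /p_map endmx_exp.
Qed.

Definition coprod : {lrmorphism U -> M} :=
  let: And4 fD fZ fB fP := coprod_subproof in u_lift pF fD fZ fB fP.

Lemma coprod_gen x : coprod (u_gen pF x) = smx _ (u_gen pF x) + cmx U (endmx e (vsval x)).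
Proof. by rewrite /coprod; case: coprod_subproof => *; exact: u_liftE. Qed.

Section Independence.
Variables (d : nat) (X : d.-tuple 'End(V)) (c : nat -> F).
Hypothesis Xb : basis_of L X.

(* The shifts c i are what makes the same basis theorem yield bases adapted to
   a module on which some of the X`_i act as scalars. *)
Definition pbw_gen (i : nat) : U := u_gen pF (vsproj L X`_i) + (c i)%:A.

Let a := pbw_gen.

Lemma vsproj_basis i : vsval (vsproj L X`_i) = X`_i.
Proof.
apply: vsprojK; have [id|di] := ltnP i (size X); last by rewrite nth_default // mem0v.
by apply: (basis_mem Xb); apply: mem_nth.
Qed.

Lemma coprod_pbw_gen i : coprod (a i) = smx N (a i) + cmx U (endmx e X`_i).
Proof.
rewrite /a /pbw_gen rmorphD /= coprod_gen vsproj_basis.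
rewrite addrAC linearZ rmorph1; congr (_ + _).
rewrite /smx; apply/matrixP => r q; rewrite !mxE.
by case: eqP => _; rewrite ?mulr1n ?mulr0n ?scaler0 ?addr0.
Qed.

(** The degree filtration; unlike in [smon], the words may be unordered and have repetitions. *)
Definition short k (u : U) :=
  lspan (fun g => exists s, [/\ all (gtn d) s, (size s < k)%N & g = mon a s]) u.

Let short_mono k l u : (k <= l)%N -> short k u -> short l u.
Proof.
move=> kl; apply: lspan_mono => _ [s [sd sk ->]]; exists s; split=> //.
exact: leq_trans sk kl.
Qed.

Let short_mon s k : all (gtn d) s -> (size s < k)%N -> short k (mon a s).
Proof. by move=> sd sk; apply: lspan_gen; exists s. Qed.

Let short0 u : short 0 u -> u = 0.
Proof. by elim=> // k g m [s []]; rewrite ltn0. Qed.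

Let short_mul i k u : (i < d)%N -> short k.-1 u -> short k (a i * u).
Proof.
move=> id; case: k => [|k] /=; first by move/short0->; rewrite mulr0; apply: lspan0.
elim=> [|l _ m [s [sd sk ->]] _ hm]; first by rewrite mulr0; apply: lspan0.
rewrite mulrDr -scalerAr; apply: lspan_cons => //; exists (i :: s).
by rewrite mon_cons; split=> //=; rewrite id.
Qed.

Let coprod_step i u r q : coprod (a i * u) r q =
  a i * coprod u r q + \sum_l endmx e X`_i r l *: coprod u l q.
Proof.
rewrite rmorphM /= coprod_pbw_gen mulrDl mxE; congr (_ + _).
  by rewrite [X in fun_of_matrix X _ _]mul_scalar_mx mxE.
by rewrite mxE; apply: eq_bigr => l _; rewrite !mxE /= -scalerAl mul1r.
Qed.

(** In the expanded product of the [coprod (a i)], every term other than the monomial tensored with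
    1 has lost at least one generator to the second factor. *)
Let coprod_mon s r q : all (gtn d) s -> short (size s) (coprod (mon a s) r q - (mon a s)%:M r q).
Proof.
elim: s r q => [|i s IHs] r q /=.
  by rewrite /mon big_nil rmorph1 subrr => _; apply: lspan0.
move=> /andP[id sd].
rewrite mon_cons coprod_step.
have -> : (a i * mon a s)%:M r q = a i * (mon a s)%:M r q :> U.
  by rewrite !mxE mulrnAr.
rewrite addrAC -mulrBr; apply: lspanD; first exact: (@short_mul i (size s).+1 _ id (IHs _ _ sd)).
apply: lspan_sum => l _; apply: lspanZ.
rewrite -[coprod _ _ _](subrK ((mon a s)%:M l q)); apply: lspanD.
  exact: short_mono (IHs _ _ sd).
by rewrite mxE; case: eqP => _; [apply: short_mon|apply: lspan0].
Qed.

Let psi_ex (i : 'I_d) : exists psi : 'I_N.+1 -> 'I_N.+1 -> F,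
  forall x : 'End(V), coord X i x = \sum_r \sum_q endmx e x r q * psi r q.
Proof. exact: (endmx_form eb (coord X i : {linear 'End(V) -> F^o})). Qed.

Let psi i := projT1 (cid (psi_ex i)).
Let psiP i : forall x, coord X i x = \sum_r \sum_q endmx e x r q * psi i r q.
Proof. exact: projT2 (cid (psi_ex i)). Qed.

(* Contracting the second factor of the comultiplication with the i-th coordinate
   form gives an operator that, up to terms of smaller length, differentiates
   ordered monomials with respect to the i-th generator. *)
Let D i (u : U) : U :=
  \sum_r \sum_q psi i r q *: coprod u r q - coord X i \1%VF *: u.

Let D_linear i : linear (D i).
Proof.
move=> k u v; rewrite /D scalerBr [_ *: (k *: u + v)]scalerDr opprD addrACA.
congr (_ + _); last by rewrite !scalerA mulrC.
rewrite scaler_sumr -big_split; apply: eq_bigr => r _ /=.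
rewrite scaler_sumr -big_split; apply: eq_bigr => q _ /=.
by rewrite linearP !mxE scalerDr !scalerA mulrC.
Qed.

HB.instance Definition _ i := GRing.isLinear.Build F U U _ (D i) (D_linear i).

(** The coordinate form is extended from L to all of ['End(V)], so its value at the identity need
    not vanish; the term subtracted in [D] compensates for that. *)
Let D1 i : D i 1 = 0.
Proof.
rewrite /D rmorph1 psiP endmx1 // scaler_suml; apply/eqP; rewrite subr_eq0.
apply/eqP/eq_bigr => r _; rewrite scaler_suml; apply: eq_bigr => q _.
by rewrite !mxE; case: eqP => _; rewrite ?mul1r // mul0r scaler0 scale0r.
Qed.

(** Leibniz rule up to shorter terms: the part of [coprod (a j)] in the second factor contributes
    the i-th coordinate of the j-th basis vector, a Kronecker delta. *)
Let D_step i j s : (j < d)%N -> all (gtn d) s ->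
  short (size s) (D i (mon a (j :: s)) - a j * D i (mon a s) - (i == j :> nat)%:R *: mon a s).
Proof.
move=> jd sd.
have -> : D i (mon a (j :: s)) - a j * D i (mon a s) =
    \sum_r \sum_q psi i r q *: \sum_l endmx e X`_j r l *: coprod (mon a s) l q.
  rewrite mon_cons /D mulrBr -scalerAr opprB addrA.
  rewrite subrK mulr_sumr -sumrB; apply: eq_bigr => r _.
  rewrite mulr_sumr -sumrB; apply: eq_bigr => q _.
  by rewrite coprod_step scalerDr -scalerAr addrAC subrr add0r.
have -> : (i == j :> nat)%:R *: mon a s =
    \sum_r \sum_q psi i r q *: \sum_l endmx e X`_j r l *: ((mon a s)%:M l q : U).
  have := psiP i X`_j; rewrite (coord_free (Ordinal jd) i (basis_free Xb)).
  rewrite eq_sym -val_eqE /= => ->; rewrite scaler_suml; apply: eq_bigr => r _.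
  rewrite scaler_suml; apply: eq_bigr => q _.
  rewrite (bigD1 q) //= big1 => [|l /negPf lq].
    by rewrite [scalar_mx _ _ _]mxE eqxx mulr1n addr0 scalerA mulrC.
  by rewrite [scalar_mx _ _ _]mxE lq mulr0n scaler0.
rewrite -sumrB; apply: lspan_sum => r _; rewrite -sumrB; apply: lspan_sum => q _.
rewrite -scalerBr -sumrB; apply: lspanZ; apply: lspan_sum => l _.
by rewrite -scalerBr; apply/lspanZ/coprod_mon.
Qed.

Let D_mon i s : uniq s -> all (gtn d) s ->
  short (size s).-1 (D i (mon a s) - ((i : nat) \in s)%:R *: mon a (rem (i : nat) s)).
Proof.
elim: s => [|j s IHs] /=.
  by rewrite scale0r subr0 /mon big_nil D1 => _ _; apply: lspan0.
move=> /andP[js us] /andP[jd sd].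
have := lspanD (D_step i jd sd) (@short_mul j (size s) _ jd (IHs us sd)).
rewrite (mulrBr (a j) (D i (mon a s))) -scalerAr -mon_cons.
have cancel_mid (x y z w : U) : x - y - z + (y - w) = x - z - w.
  by rewrite [x - y - z]addrAC addrA subrK.
rewrite cancel_mid in_cons.
case: eqP => [->|ij] /=.
  by rewrite eqxx (negPf js) scale0r scale1r subr0.
rewrite scale0r subr0; case: (j =P i :> nat) => [/esym//|_].
by case: ((i : nat) \in s); rewrite ?scale0r.
Qed.

Let D_short i k u : short k u -> short k.-1 (D i u).
Proof.
elim=> [|l g m [s [sd sk ->]] _ IH]; first by rewrite linear0; apply: lspan0.
rewrite D_linear; apply: lspanD => //; apply/lspanZ/(short_mono (k := size s)).
  by case: k sk {IH}.
elim: s sd {sk} => [|j s IHs] /=; first by rewrite /mon big_nil D1 => _; apply: lspan0.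
move=> /andP[jd sd].
rewrite -[D i _](subrK (a j * D i (mon a s))); apply: lspanD.
  rewrite -[_ - _](subrK ((i == j :> nat)%:R *: mon a s)); apply: lspanD.
    exact: short_mono (D_step i jd sd).
  by apply: lspanZ; apply: short_mon.
exact: (@short_mul j (size s).+1 _ jd (IHs sd)).
Qed.

Let DD (t : seq 'I_d) (u : U) := foldl (fun v i => D i v) u t.

Let DD_linear t : linear (DD t).
Proof. by elim: t => // i t IHt k u v; rewrite /DD /= D_linear -IHt. Qed.

HB.instance Definition _ t := GRing.isLinear.Build F U U _ (DD t) (DD_linear t).

Let DD_short t u : short (size t) u -> DD t u = 0.
Proof. by elim: t u => [|i t IHt] u; [exact: short0|move=> /(D_short i)/IHt]. Qed.

(** Square-freeness is essential here: a repeated generator would be differentiated with coefficient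
    2 = 0. *)
Let DD_mon t s : uniq s -> all (gtn d) s -> size s = size t ->
  DD t (mon a s) = (perm_eq s (map val t))%:R.
Proof.
elim: t s => [|i t IHt] s us sd.
  by move=> /size0nil->; rewrite /mon big_nil.
move=> /= st; have := D_mon i us sd; rewrite st /= => /DD_short.
rewrite linearB linearZ /= => /eqP; rewrite subr_eq0 => /eqP.
rewrite -[LHS]/(DD t (D i (mon a s))) => ->.
have [is_|is_] := boolP ((i : nat) \in s); last first.
  rewrite scale0r; case: (boolP (perm_eq _ _)) => // /perm_mem/(_ (i : nat)).
  by rewrite in_cons eqxx (negPf is_).
rewrite scale1r IHt ?rem_uniq ?size_rem ?st //; last first.
  by apply/allP => j /mem_rem/(allP sd).
congr (_ : bool)%:R.
by rewrite (permPl (perm_to_rem is_)) perm_cons.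
Qed.

(** Among the monomials occurring in a relation choose a longest one and differentiate with respect
    to all of its generators. Shorter monomials vanish, other monomials of the same length have a
    different set of generators and vanish too, and the chosen one becomes 1. *)
Theorem pbw_independent (f : d.-tuple bool -> F) :
  \sum_b f b *: mon a (mask b (iota 0 d)) = 0 -> forall b, f b = 0.
Proof.
move=> f0 b1; apply/eqP/negPn/negP => fb1.
pose sz (b : d.-tuple bool) := size (mask b (iota 0 d)).
case: (@arg_maxnP _ b1 (fun b => f b != 0) sz fb1) => b fb bmax.
pose t := mask b (enum 'I_d).
have tE : map val t = mask b (iota 0 d) by rewrite map_mask val_enum_ord.
have st : size t = sz b by rewrite /sz -tE size_map.
have maskd (b' : d.-tuple bool) : all (gtn d) (mask b' (iota 0 d)).
  by apply/allP => i /mem_mask; rewrite mem_iota.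
have := congr1 (DD t) f0; rewrite linear0 linear_sum (bigD1 b) //= big1 => [|b' b'b].
  rewrite addr0 linearZ /= DD_mon ?mask_uniq ?iota_uniq // tE perm_refl.
  by move/eqP; rewrite scaler_eq0 oner_eq0 orbF (negPf fb).
rewrite linearZ /=; have [->|fb'] := eqVneq (f b') 0; first by rewrite scale0r.
have /= := bmax _ fb'; rewrite leq_eqVlt => /orP[/eqP sb'|sb']; last first.
  by rewrite DD_short ?scaler0 // st; apply: short_mon.
rewrite DD_mon ?mask_uniq ?iota_uniq //; last by rewrite st.
case: (boolP (perm_eq _ _)) => [|_]; last by rewrite scaler0.
rewrite tE => /(sorted_eq leq_trans anti_leq) h.
have sm (b'' : d.-tuple bool) : sorted leq (mask b'' (iota 0 d)).
  by apply: sorted_mask; [exact: leq_trans|exact: iota_sorted].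
have bb : b' = b.
  apply/val_inj/(@mask_inj _ (iota 0 d)); rewrite ?iota_uniq ?size_tuple ?size_iota //.
  exact: h (sm _) (sm _).
by rewrite bb eqxx in b'b.
Qed.

Theorem pbw_span : restricted_subalgebra 2 L ->
  forall u : U, exists f : d.-tuple bool -> F, u = \sum_b f b *: mon a (mask b (iota 0 d)).
Proof.
move=> [LB LP].
have genE (x : subvs_of L) : u_gen pF x = \sum_k coord X k (vsval x) *: (a k - (c k)%:A).
  by rewrite (u_gen_coord pF _ Xb); apply: eq_bigr => k _; rewrite /a /pbw_gen addrK.
have aff1 : affine d a 1 by apply: lspan_gen; left.
have affG x : affine d a (u_gen pF x).
  rewrite genE; apply: lspan_sum => k _; apply/lspanZ/lspanB; last exact: lspanZ.
  by apply: lspan_gen; right; exists k.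
have XL i : X`_i \in L by rewrite -vsproj_basis subvsP.
have a_comm i j : (i < d)%N -> (j < d)%N -> affine d a (a i * a j - a j * a i).
  move=> _ _; rewrite /a /pbw_gen commutatorD ?mulr_algl ?mulr_algr //.
  rewrite -[_ *: _ - _]/(_ - _) scalerA [in X in _ - X]scalerA [X in _ - (X)%:A]mulrC subrr addr0.
  rewrite -(@u_genBr _ _ pF _ _ _ _ (vsproj L (lie_br X`_i X`_j))).
    exact: affG.
  by rewrite !vsproj_basis vsprojK // LB.
(* The cross terms of the square of a shifted generator cancel in characteristic 2, leaving the
   [2]-power in L plus a constant. *)
have a_sqr i : (i < d)%N -> affine d a (a i * a i).
  move=> _; rewrite /a /pbw_gen mulrDl !mulrDr !mulr_algl !mulr_algr.
  rewrite -addrA [X in _ + X]addrA addxx2 // add0r scalerA; apply: lspanD; last exact: lspanZ.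
  rewrite -expr2 -(@u_genPr _ _ pF _ _ _ (vsproj L (p_map 2 X`_i))).
    exact: affG.
  by rewrite vsproj_basis vsprojK // LP.
pose S (u : U) := exists k, lspan (smon d a k) u.
have smonW j l (x : U) : (j <= l)%N -> lspan (smon d a j) x -> lspan (smon d a l) x.
  move=> jl; apply: lspan_mono => _ [s [? ? sj ->]]; exists s; split=> //.
  exact: leq_trans jl.
have SD u v : S u -> S v -> S (u + v).
  move=> [k hk] [l hl]; exists (maxn k l); apply: lspanD.
    by apply: (smonW k); rewrite ?leq_maxl.
  by apply: (smonW l); rewrite ?leq_maxr.
have SZ k u : S u -> S (k *: u) by case=> l hl; exists l; apply: lspanZ.
have Sa i u : (i < d)%N -> S u -> S (a i * u).
  by move=> id [k]; apply: (smon_mul a_comm a_sqr).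
have SG x u : S u -> S (u_gen pF x * u).
  move=> Su; rewrite genE mulr_suml; elim/big_ind: _ => [||k _]; last 1 first.
  - rewrite -scalerAl mulrBl mulr_algl; apply/SZ/SD; first exact: Sa.
    by rewrite -scaleNr; apply: SZ.
  - by exists 0%N; apply: lspan0.
  - exact: SD.
move=> u; suff [k /smon_mask h] : S u by apply: lspan_fin.
rewrite -[u]mulr1; apply: u_alg_closed SD SZ SG _ _ _.
by exists 1%N; apply: lspan_gen; exists [::]; rewrite /mon big_nil.
Qed.

End Independence.
End Coproduct.

(** * Left ideals generated by idempotents *)

Section LeftIdeal.
Variables (R : nzRingType) (e : R).

(** For an idempotent [e] the left ideal R e consists of the fixed points of right multiplication by
    [e], which is the boolean condition that a subtype needs. *)
Definition lideal_pred : {pred R^o} := [pred x : R^o | (x : R) * e == x].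

Fact lideal_closed : GRing.submod_closed lideal_pred.
Proof.
split=> [|k x y]; rewrite !inE; first by rewrite mul0r.
by move=> /eqP xe /eqP ye; rewrite mulrDl -[k *: x]/(k * (x : R)) -mulrA xe ye.
Qed.

HB.instance Definition _ := GRing.isSubmodClosed.Build R R^o lideal_pred lideal_closed.

Record lideal := LIdeal { lideal_val : R^o; _ : lideal_val \in lideal_pred }.

HB.instance Definition _ := [isSub for lideal_val].
HB.instance Definition _ := [Choice of lideal by <:].
HB.instance Definition _ := [SubChoice_isSubLmodule of lideal by <:].

Definition lval (x : lideal) : R := lideal_val x.

Lemma lidealE x : lval x * e = lval x.
Proof. by case: x => x /= /eqP. Qed.

Lemma lval_inj : injective lval.
Proof. exact: val_inj. Qed.

Lemma lval_linear : linear_for *%R lval.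
Proof. by []. Qed.

HB.instance Definition _ := GRing.isLinear.Build R lideal R *%R lval lval_linear.

Definition lideal_hom (M : lmodType R) (m : M) (x : lideal) : M := lval x *: m.

Fact lideal_hom_linear (M : lmodType R) (m : M) : linear (lideal_hom m).
Proof. by move=> k x y; rewrite /lideal_hom linearP scalerDl scalerA. Qed.

HB.instance Definition _ (M : lmodType R) (m : M) :=
  GRing.isLinear.Build R lideal M _ (lideal_hom m) (lideal_hom_linear m).

Hypothesis ee : e * e = e.

Fact lideal_of_subproof x : (x * e : R^o) \in lideal_pred.
Proof. by rewrite inE -mulrA ee. Qed.

Definition lideal_of (x : R) : lideal := LIdeal (lideal_of_subproof x).

Lemma lideal_ofE x : lval (lideal_of x) = x * e.
Proof. by []. Qed.

Definition lideal_gen : lideal := lideal_of 1.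

Lemma lideal_genE : lval lideal_gen = e.
Proof. exact: mul1r. Qed.

Lemma lideal_genP (x : lideal) : x = lval x *: lideal_gen.
Proof. by apply: lval_inj; rewrite -[RHS]/(lval x * (1 * e)) mul1r lidealE. Qed.

(** A preimage m of the image of the generator need not satisfy e m = m; the map x -> x m lifts
    nevertheless, because x = x e. *)
Lemma lideal_projective : projective lideal.
Proof.
move=> M N f g fs; have [m mE] := fs (g lideal_gen).
by exists (lideal_hom m) => x; rewrite linearZ /= mE -linearZ -lideal_genP.
Qed.

End LeftIdeal.

Section SubmoduleClosed.
Variables (R : nzRingType) (M : lmodType R) (A : {pred M}).
Hypothesis AP : GRing.submod_closed A.

Lemma submodZ k x : x \in A -> k *: x \in A.
Proof. by case: AP => A0 AZ xA; rewrite -[k *: x]addr0 AZ. Qed.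

Lemma submodD x y : x \in A -> y \in A -> x + y \in A.
Proof. by case: AP => A0 AZ xA yA; rewrite -[x]scale1r AZ. Qed.

Lemma submodB x y : x \in A -> y \in A -> x - y \in A.
Proof. by move=> xA yA; rewrite submodD // -scaleN1r submodZ. Qed.

(* Nakayama's lemma for one nilpotent element. *)
Lemma submod_nilp (r : R) k x : r ^+ k = 0 -> x - r *: x \in A -> x \in A.
Proof.
move=> rk xA; rewrite -[x]subr0 -(scale0r x) -rk.
elim: k {rk} => [|k IHk]; first by rewrite expr0 scale1r subrr; case: AP.
rewrite exprS -scalerA.
have -> : x - r *: (r ^+ k *: x) = x - r *: x + r *: (x - r ^+ k *: x).
  by rewrite scalerBr addrA subrK.
by rewrite submodD ?submodZ.
Qed.

End SubmoduleClosed.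

Lemma indecomposable_iso (R : nzRingType) (M N : lmodType R) (f : {linear M -> N}) :
  bijective f -> indecomposable N -> indecomposable M.
Proof.
move=> [g fK gK] [[y0 y0_neq0] Nind].
have gL k x y : g (k *: x + y) = k *: g x + g y.
  by apply: (can_inj fK); rewrite linearP !gK.
split; first by exists (g y0); apply: contra_neq y0_neq0 => g0; rewrite -[y0]gK g0 linear0.
move=> A B AP BP AB ABI.
have preim_closed (C : {pred M}) : GRing.submod_closed C ->
    GRing.submod_closed ([pred y | g y \in C] : {pred N}).
  move=> [C0 CP]; split=> [|k x y]; rewrite !inE; last by rewrite gL; apply: CP.
  by rewrite -[0](subrr 0) -scaleN1r addrC gL scaleN1r addNr.
have [||A0|B0] := Nind _ _ (preim_closed A AP) (preim_closed B BP).
- move=> y; have [a [b [aA bB yE]]] := AB (g y); exists (f a), (f b).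
  by rewrite !inE !fK -linearD -yE gK.
- by move=> y; rewrite !inE => yA yB; rewrite -[y]gK (ABI _ yA yB) linear0.
- by left=> a aA; apply: (can_inj fK); rewrite linear0; apply: A0; rewrite inE fK.
- by right=> b bB; apply: (can_inj fK); rewrite linear0; apply: B0; rewrite inE fK.
Qed.

(** * Dimension over F of modules over an F-algebra *)

Section Dimension.
Variables (F : fieldType) (U : algType F).

Lemma has_dim_iso (M N : lmodType U) (f : {linear M -> N}) d :
  bijective f -> has_dim N d -> has_dim M d.
Proof.
move=> [g fK gK] [b bP]; exists (g \o b) => m.
have [c [cE cU]] := bP (f m).
have fS (c' : {ffun 'I_d -> F}) :
    f (\sum_i (c' i)%:A *: (g \o b) i) = \sum_i (c' i)%:A *: b i.
  by rewrite linear_sum; apply: eq_bigr => i _; rewrite linearZ /= gK.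
exists c; split; first by apply: (can_inj fK); rewrite fS.
by move=> c' /(congr1 f); rewrite fS; exact: cU.
Qed.

Lemma has_dim_fin (M : lmodType U) (I : finType) (b : I -> M) :
  (forall m, exists f : I -> F, m = \sum_i (f i)%:A *: b i) ->
  (forall f : I -> F, \sum_i (f i)%:A *: b i = 0 -> forall i, f i = 0) ->
  has_dim M #|I|.
Proof.
move=> span indep; exists (b \o enum_val) => m; have [f fE] := span m.
have sumE (g : 'I_#|I| -> F) :
    \sum_i (g i)%:A *: (b \o enum_val) i = \sum_j (g (enum_rank j))%:A *: b j.
  rewrite [RHS](reindex (enum_val : 'I_#|I| -> I)) /=; last exact: onW_bij (enum_val_bij I).
  by apply: eq_bigr => i _; rewrite enum_valK.
exists [ffun i => f (enum_val i)]; split.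
  rewrite (sumE [ffun i => f (enum_val i)]) {1}fE.
  by apply: eq_bigr => j _; rewrite ffunE enum_rankK.
move=> c cE; apply/ffunP => i; rewrite ffunE; apply/eqP; rewrite -subr_eq0.
rewrite -[i]enum_valK enum_rankK; apply/eqP.
apply: (indep (fun j => f j - c (enum_rank j))).
under eq_bigr do rewrite 2!scalerBl.
by rewrite sumrB -fE cE -sumE subrr.
Qed.

Lemma has_dim_neq0 (M : lmodType U) d : (0 < d)%N -> has_dim M d -> exists m : M, m != 0.
Proof.
move=> d0 [b bP]; exists (b (Ordinal d0)); apply/eqP => b0.
have [c [_ cU]] := bP 0.
have c0 : c = 0 by apply: cU; rewrite big1 // => i _; rewrite ffunE !scale0r.
have c1 : c = [ffun i => (i == Ordinal d0)%:R].
  apply: cU; rewrite big1 // => i _; rewrite ffunE.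
  by case: eqP => [->|_]; rewrite ?b0 ?scaler0 // !scale0r.
by move/ffunP/(_ (Ordinal d0)): c1; rewrite c0 !ffunE eqxx => /eqP; rewrite eq_sym oner_eq0.
Qed.

Section Coordinates.
Variables (M : lmodType U) (d : nat).
Hypothesis Md : has_dim M d.

Lemma has_dim_coord : exists (v : M -> 'rV[F]_d) (w : 'rV[F]_d -> M),
  [/\ cancel v w, cancel w v, forall k x y, v (k%:A *: x + y) = k *: v x + v y
    & forall k x y, w (k *: x + y) = k%:A *: w x + w y].
Proof.
have [b bP] := Md; pose w (r : 'rV[F]_d) := \sum_i (r 0 i)%:A *: b i.
pose v m := \row_i (projT1 (cid (bP m))) i.
have vK : cancel v w.
  move=> m; rewrite /v /w; case: (cid _) => c [/= cE _].
  by rewrite [RHS]cE; apply: eq_bigr => i _; rewrite mxE.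
have wL k x y : w (k *: x + y) = k%:A *: w x + w y.
  rewrite /w scaler_sumr -big_split; apply: eq_bigr => i _ /=.
  by rewrite !mxE !scalerDl -(scalerA k (x 0 i) (1 : U)) -(mulr_algl k (x 0 i)%:A) scalerA.
have wI r r' : w r = w r' -> r = r'.
  move=> ww; have [c [_ cU]] := bP (w r).
  have rE (q : 'rV[F]_d) : w r = w q -> c = [ffun i => q 0 i].
    by move=> e; apply: cU; rewrite e; apply: eq_bigr => i _; rewrite ffunE.
  have := rE _ ww; rewrite (rE r erefl) => /ffunP h.
  by apply/rowP => i; have := h i; rewrite !ffunE.
have wK : cancel w v by move=> r; apply: wI; rewrite vK.
exists v, w; split=> // k x y.
by apply: wI; rewrite wL !vK.
Qed.

End Coordinates.

Lemma has_dim_surj (M N : lmodType U) (f : {linear M -> N}) d d' :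
  has_dim M d -> has_dim N d' -> (forall y, exists x, f x = y) ->
  (d' <= d)%N /\ (d = d' -> injective f).
Proof.
move=> /has_dim_coord[v [w [vK wK vL wL]]] /has_dim_coord[v' [w' [vK' wK' vL' wL']]] fs.
pose h r := v' (f (w r)).
have hL : linear h by move=> k x y; rewrite /h wL linearP /= vL'.
pose H : {linear 'rV[F]_d -> 'rV[F]_d'} := HB.pack h (GRing.isLinear.Build _ _ _ _ h hL).
have hE r : h r = r *m lin1_mx H by rewrite mul_rV_lin1.
have full : row_full (lin1_mx H).
  rewrite -sub1mx; apply/row_subP => i; apply/submxP.
  have [x xE] := fs (w' (row i 1%:M)); exists (v x).
  by rewrite -hE /h vK xE wK'.
split; first by move: full => /eqP <-; exact: rank_leq_row.
move=> dd; subst d'; have /row_free_inj inj : row_free (lin1_mx H).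
  by rewrite row_free_unit -row_full_unit.
move=> x y e; rewrite -[x]vK -[y]vK; congr w; apply: (inj 1%N); rewrite /= -!hE.
by rewrite /h !vK e.
Qed.

End Dimension.

(** * Dual bases of projective modules *)

Section FreeModule.
Import finmap monalg.
Local Open Scope fset_scope.
Variables (R : nzRingType) (M : lmodType R).

Definition free_eval (g : {malg R[M]}) : M := \sum_(k <- msupp g) mcoeff k g *: k.

Lemma free_evalEw (g : {malg R[M]}) (d : {fset M}) : msupp g `<=` d ->
  free_eval g = \sum_(k <- d) mcoeff k g *: k.
Proof.
move=> gd; rewrite /free_eval; apply: big_fset_incl => // k _ kg.
by rewrite mcoeff_outdom // scale0r.
Qed.

Lemma free_eval_linear : linear free_eval.
Proof.
move=> k g h; pose d := msupp g `|` msupp h `|` msupp (k *: g + h).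
rewrite (@free_evalEw _ d) ?fsubsetUr // (@free_evalEw g d); last first.
  by rewrite /d -fsetUA fsubsetUl.
rewrite (@free_evalEw h d); last by rewrite /d fsetUAC fsubsetUr.
rewrite scaler_sumr -big_split; apply: eq_bigr => m _ /=.
by rewrite mcoeffD mcoeffZ scalerDl scalerA.
Qed.

HB.instance Definition _ :=
  GRing.isLinear.Build R {malg R[M]} M _ free_eval free_eval_linear.

Lemma free_eval_surj m : exists g, free_eval g = m.
Proof.
exists << (1 : R) *g m >>; rewrite (@free_evalEw _ [fset m]) ?msuppU_le //.
by rewrite big_seq_fset1 mcoeffUU scale1r.
Qed.

(* A projective module is a summand of the free module on its elements; the
   coefficients of a section give a dual basis. *)
Lemma projective_dual_basis : projective M -> forall m : M,
  exists s : seq (M * {linear M -> R^o}), m = \sum_(x <- s) (x.2 m : R) *: x.1.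
Proof.
move=> MP.
have [h hE] := MP _ _ (free_eval : {linear {malg R[M]} -> M}) (idfun : {linear M -> M})
  free_eval_surj.
have cL k : linear (fun m => mcoeff k (h m) : R^o).
  by move=> a x y; rewrite linearP mcoeffD mcoeffZ.
pose c k : {linear M -> R^o} := HB.pack_for {linear M -> R^o}
  (fun m => mcoeff k (h m) : R^o) (GRing.isLinear.Build _ _ _ _ _ (cL k)).
move=> m; exists [seq (k, c k) | k <- msupp (h m)].
by rewrite big_map /= -[LHS]hE.
Qed.
End FreeModule.

(** * Nilpotent ideals and local idempotents *)

Section Nilpotence.
Variables (F : fieldType) (U : algType F) (R : U -> Prop).
Hypothesis Rr : forall u v, R u -> R (u * v).

Fixpoint rad_ann k (u : U) : Prop :=
  if k is k'.+1 then forall r, R r -> rad_ann k' (r * u) else u = 0.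

Lemma rad_annD k u v : rad_ann k u -> rad_ann k v -> rad_ann k (u + v).
Proof.
elim: k u v => [|k IHk] u v /=; first by move=> -> ->; rewrite addr0.
by move=> hu hv r Rr'; rewrite mulrDr; apply: IHk; [apply: hu|apply: hv].
Qed.

Lemma rad_ann0 k : rad_ann k 0.
Proof. by elim: k => //= k IHk r _; rewrite mulr0. Qed.

Lemma rad_annZ k (c : F) u : rad_ann k u -> rad_ann k (c *: u).
Proof.
elim: k u => [|k IHk] u /=; first by move=> ->; rewrite scaler0.
by move=> hu r Rr'; rewrite -scalerAr; apply/IHk/hu.
Qed.

(** The annihilator of R^k is a left ideal because R is stable under right multiplication. *)
Lemma rad_annM k u v : rad_ann k v -> rad_ann k (u * v).
Proof.
case: k => [|k] /=; first by move=> ->; rewrite mulr0.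
by move=> hv r Rr'; rewrite mulrA; apply/hv/Rr.
Qed.

Lemma rad_annS k u : rad_ann k u -> rad_ann k.+1 u.
Proof. by move=> hu r _; apply: rad_annM. Qed.

Lemma rad_ann_le k l u : (k <= l)%N -> rad_ann k u -> rad_ann l u.
Proof. by move=> /subnK <- hu; elim: (l - k)%N => // m IHm; apply: rad_annS. Qed.

(* The subspaces {u | R^k u = 0} increase strictly until they reach U, which is
   finite-dimensional. *)
Lemma rad_nilpotent (I : finType) (b : I -> U) :
  (forall u, exists f : I -> F, u = \sum_i f i *: b i) ->
  (forall S : U -> Prop, S 0 -> (forall x y, S x -> S y -> S (x + y)) ->
     (forall u x, S x -> S (u * x)) -> forall m, ~ S m ->
     exists v, ~ S v /\ forall r, R r -> S (r * v)) ->
  forall s : seq U, size s = #|I| -> (forall u, u \in s -> R u) -> \prod_(u <- s) u = 0.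
Proof.
move=> span radv.
suff A1 : rad_ann #|I| 1.
  have prodA k : forall (s : seq U) u, size s = k -> (forall r, r \in s -> R r) ->
      rad_ann k u -> \prod_(r <- s) r * u = 0.
    elim: k => [|k IHk] s u.
      by move=> /size0nil-> _ ->; rewrite mulr0.
    case/lastP: s => // s r; rewrite size_rcons => -[sk] sR hu.
    rewrite -cats1 big_cat big_seq1 -mulrA; apply: IHk => // [x xs|].
      by apply: sR; rewrite mem_rcons inE xs orbT.
    by apply: hu; apply: sR; rewrite mem_rcons inE eqxx.
  by move=> s sI sR; rewrite -[LHS]mulr1; apply: prodA sI sR A1.
apply: contrapT => nA1.
(* If the layers never exhaust U, each of [#|I|.+1] successive layers contains a new vector. These
   are linearly dependent, and the last vector with nonzero coefficient falls back into its own
   lower layer. *)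
have /choice[v vP] (k : 'I_#|I|.+1) : exists v, ~ rad_ann k v /\ rad_ann k.+1 v.
  have [|v [nv vR]] := radv (rad_ann k) (rad_ann0 k) (@rad_annD k) (@rad_annM k) 1.
    by move=> hk; apply/nA1/(rad_ann_le _ hk); rewrite -ltnS.
  by exists v.
have /choice[f fE] k := span (v k).
pose A : 'M[F]_(#|I|.+1, #|I|) := \matrix_(k, i) f k (enum_val i).
have : kermx A != 0.
  rewrite -mxrank_eq0 mxrank_ker subn_eq0 -ltnNge ltnS.
  exact: rank_leq_col.
move=> /rowV0Pn[x /sub_kermxP xA x0].
have xv : \sum_k x 0 k *: v k = 0.
  under eq_bigr do rewrite fE scaler_sumr.
  rewrite exchange_big big1 // => i _ /=; under eq_bigr do rewrite scalerA.
  rewrite -scaler_suml; have /rowP/(_ (enum_rank i)) := xA.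
  rewrite !mxE => h; rewrite (_ : \sum_k _ = 0) ?scale0r // -[RHS]h.
  by apply: eq_bigr => k _; rewrite mxE enum_rankK.
have [k0 xk0] : exists k, x 0 k != 0.
  by apply/existsP; apply: contra_neqT x0 => /existsPn h; apply/rowP => k; rewrite mxE; apply/eqP/negPn/h.
case: (@arg_maxnP _ k0 (fun k => x 0 k != 0) val xk0) => k xk kmax.
have [nv _] := vP k; apply: nv.
have -> : v k = - (x 0 k)^-1 *: \sum_(j | j != k) x 0 j *: v j.
  move: xv; rewrite (bigD1 k) //= => /eqP; rewrite addr_eq0 => /eqP xvk.
  by rewrite -[in RHS](opprK (\sum_(j | _) _)) -xvk scalerN scaleNr opprK scalerA mulVf // scale1r.
apply: rad_annZ; apply: big_ind => [||j jk]; [exact: rad_ann0|exact: rad_annD|].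
have [->|xj] := eqVneq (x 0 j) 0; first by rewrite scale0r; apply: rad_ann0.
apply: rad_annZ; apply: (@rad_ann_le j.+1); last by case: (vP j).
have /= := kmax _ xj; rewrite leq_eqVlt => /orP[/eqP/val_inj jk'|//].
by rewrite jk' eqxx in jk.
Qed.

End Nilpotence.

Section LocalIdempotents.
(* R stands for the radical of U and J for an ideal contained in it; for u(L),
   J is the annihilator of the natural module. *)
Variables (F : fieldType) (U : algType F) (J R : U -> Prop).
Hypothesis JR : forall u, J u -> R u.
Hypothesis RD : forall u v, R u -> R v -> R (u + v).
Hypothesis Rl : forall u v, R v -> R (u * v).
Hypothesis Rr : forall u v, R u -> R (u * v).
Variable K : nat.
Hypothesis RK : forall s : seq U, size s = K -> (forall u, u \in s -> R u) ->
  \prod_(u <- s) u = 0.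

Definition local_idem (e : U) :=
  [/\ e * e = e, e != 0 & forall u, exists c : F, J (e * u * e - c *: e)].

Lemma rad_nilp r : R r -> r ^+ K = 0.
Proof.
move=> Rr'; rewrite -(RK (s := nseq K r)) ?size_nseq //; last by move=> u /nseqP[->].
by elim: K => [|k IHk]; rewrite ?expr0 ?big_nil //= big_cons exprS IHk.
Qed.

Let radZ k u : R u -> R (k *: u).
Proof. by rewrite -mulr_algl; apply: Rl. Qed.

Lemma rad_fix_eq0 (M : lmodType U) r (x : M) : R r -> x = r *: x -> x = 0.
Proof.
move=> /rad_nilp rK xr; rewrite -(scale0r x) -rK.
by elim: K => [|k IHk]; rewrite ?expr0 ?scale1r // exprS -scalerA -IHk.
Qed.

(** Write the generator as a + b along the decomposition. Locality gives a = c e + r with r in R;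
    comparing components, a = c a + r a and 0 = c b + r b. If c = 0 the nilpotent r fixes a,
    otherwise - c^-1 r fixes b, so one of the two vanishes. *)
Lemma local_indecomposable e : local_idem e -> indecomposable (lideal e).
Proof.
move=> [ee e0 eP]; pose g := lideal_gen ee; have gE := lideal_genE ee.
have gP (x : lideal e) : x = lval x *: g := lideal_genP ee x.
split; first by exists g; apply: contra_neq e0 => g0; rewrite -gE -/g g0.
move=> A B AP BP AB ABI.
have [a [b [aA bB gab]]] := AB g.
have eg : e *: g = g by rewrite [RHS]gP gE.
have ea : e *: a = a.
  apply/eqP; rewrite -subr_eq0; apply/eqP/ABI.
    by rewrite submodB ?submodZ.
  have -> : e *: a - a = b - e *: b.
    apply/eqP; rewrite subr_eq addrAC eq_sym subr_eq -scalerDr -gab eg.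
    by rewrite gab addrC.
  by rewrite submodB ?submodZ.
have [c /JR] := eP (lval a); set r := _ - _ => Rr'.
have rE : r = lval a - c *: e.
  by rewrite /r -mulrA lidealE; congr (_ - _); exact: (congr1 (@lval U e) ea).
have : a = c%:A *: (a + b) + r *: (a + b).
  rewrite -gab; apply: lval_inj; rewrite -[RHS]/(c%:A * (1 * e) + r * (1 * e)).
  rewrite !mul1r mulr_algl rE mulrBl lidealE -scalerAl ee.
  by rewrite addrC subrK.
rewrite !scalerDr addrACA => aE.
have bE : c%:A *: b + r *: b = 0.
  apply: ABI; last by rewrite submodD ?submodZ.
  rewrite -[X in X \in A](addKr (c%:A *: a + r *: a)) -aE.
  by rewrite submodD // ?submodD ?submodZ // -scaleN1r submodZ // submodD ?submodZ.
move: aE; rewrite bE addr0 => aE.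
have [c0|c0] := eqVneq c 0.
  left=> x xA; move: aE; rewrite c0 !scale0r add0r => /(rad_fix_eq0 Rr') a0.
  apply: ABI => //; rewrite (gP x) gab a0 add0r.
  exact: submodZ.
right=> x xB; have b0 : b = 0.
  apply: (@rad_fix_eq0 _ (- c^-1 *: r)); first exact: radZ.
  have -> : r = - (c *: 1) + (c *: 1 + r) by rewrite addKr.
  rewrite scalerDr scalerN !scaleNr opprK scalerA mulVf // scale1r.
  by rewrite scalerBl scale1r -(mulr_algl c^-1) -scalerA scalerDl bE scaler0 subr0.
apply: ABI => //; rewrite (gP x) gab b0 addr0.
exact: submodZ.
Qed.

Inductive rad_power (k : nat) (M : lmodType U) : M -> Prop :=
  | rad_power0 : rad_power k 0
  | rad_power_cons l x m : size l = k -> (forall u, u \in l -> R u) ->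
      rad_power k m -> rad_power k (\prod_(u <- l) u *: x + m).

Lemma rad_powerD k (M : lmodType U) (x y : M) :
  rad_power k x -> rad_power k y -> rad_power k (x + y).
Proof.
move=> hx hy; elim: hx => [|l z m lk lR _ IH]; first by rewrite add0r.
by rewrite -addrA; apply: rad_power_cons.
Qed.

Lemma rad_powerS k (M : lmodType U) r (x : M) :
  R r -> rad_power k x -> rad_power k.+1 (r *: x).
Proof.
move=> rR; elim=> [|l z m lk lR _ IH]; first by rewrite scaler0; apply: rad_power0.
have e : r * \prod_(u <- l) u = \prod_(u <- r :: l) u by rewrite big_cons.
rewrite scalerDr scalerA e; apply: rad_power_cons IH; first by rewrite /= lk.
by move=> u; rewrite inE => /orP[/eqP->//|/lR].
Qed.

(* If all coordinates in a dual basis lie in R then P = R P. *)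
Lemma projective_rad_eq0 (P : lmodType U) : projective P ->
  (forall (f : {linear P -> U^o}) m, R (f m)) -> forall m : P, m = 0.
Proof.
move=> PP fR m; have : rad_power K m.
  elim: K m => [|k IHk] m.
    have := @rad_power_cons 0 P [::] m 0 erefl _ (rad_power0 _ _).
    by rewrite big_nil scale1r addr0; apply.
  have [s ->] := projective_dual_basis PP m.
  elim: s => [|x s IHs]; first by rewrite big_nil; apply: rad_power0.
  by rewrite big_cons; apply: rad_powerD IHs; apply: rad_powerS.
elim=> // l x y lk lR _ ->; rewrite addr0 RK ?scale0r //.
Qed.

Variable E : U -> Prop.
Hypothesis E_local : forall e, E e -> local_idem e.
Hypothesis E_one : forall u, (forall e, E e -> R (u * e)) -> R u.
(** Nondegeneracy: modulo R, an element of U e is detected by its left multiples from e U, read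
    modulo J. *)
Hypothesis E_rad : forall e b, E e -> b * e = b -> (forall u, J (e * u * b)) -> R b.

(** If a linear form f on P takes a value with e u f(m) e = c e modulo J and c nonzero, then x ->
    f(x) e reaches the generator of U e up to a nilpotent factor, hence is onto. If this never
    happens, all forms take values in R and P vanishes. *)
Lemma projective_onto_local (P : lmodType U) : projective P -> (exists m : P, m != 0) ->
  exists2 e, E e & exists f : {linear P -> lideal e}, forall y, exists x, f x = y.
Proof.
move=> PP [m0 m0_neq0]; apply: contrapT => nE; case/eqP: m0_neq0.
apply: projective_rad_eq0 => // f m; apply: E_one => e Ee.
have [ee e0 eP] := E_local Ee.
apply: (E_rad Ee) => [|u]; first by rewrite -mulrA ee.
have gL : linear (fun x => lideal_of ee (f x)).
  move=> k x y; apply: lval_inj; rewrite linearP.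
  rewrite -[LHS]/((k * f x + f y) * e) -[RHS]/(k * (f x * e) + f y * e).
  by rewrite mulrDl mulrA.
pose g : {linear P -> lideal e} := HB.pack_for {linear P -> lideal e}
  (fun x => lideal_of ee (f x)) (GRing.isLinear.Build _ _ _ _ _ gL).
have [c hJ] := eP (u * f m); move: (hJ); set j := _ - _ => /JR jR.
have [c0|c0] := eqVneq c 0.
  by move: hJ; rewrite c0 scale0r subr0 !mulrA.
case: nE; exists e => //; exists g => y.
pose A : {pred lideal e} := [pred y | `[< exists x, g x = y >]].
have Acl : GRing.submod_closed A.
  split=> [|k z z']; rewrite !inE; first by apply/asboolP; exists 0; rewrite linear0.
  move=> /asboolP[x <-] /asboolP[x' <-]; apply/asboolP; exists (k *: x + x').
  exact: linearP.
suff : lideal_gen ee \in A.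
  rewrite inE => /asboolP[x xE]; exists (lval y *: x).
  by rewrite linearZ /= -[lideal_of _ _]/(g x) xE -lideal_genP.
have rR : R (- c^-1 *: j) by exact: radZ.
apply: (submod_nilp Acl (rad_nilp rR)).
rewrite inE; apply/asboolP; exists ((c^-1)%:A *: ((e * u) *: m)).
have gZ k x : g (k *: x) = k *: g x by rewrite linearZ.
rewrite 2!gZ; apply: lval_inj.
rewrite -[LHS]/((c^-1)%:A * ((e * u) * (f m * e))).
rewrite -[RHS]/(1 * e - (- c^-1 *: j) * (1 * e)) !mul1r scaleNr mulNr opprK.
have -> : e * u * (f m * e) = j + c *: e by rewrite subrK !mulrA.
rewrite mulr_algl scalerDr scalerA mulVf // scale1r addrC; congr (_ + _).
rewrite -scalerAl /j mulrBl -!mulrA ee -scalerAl ee //.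
Qed.

(** The surjection onto the projective module [lideal e] splits, and indecomposability of P leaves
    no room for its kernel. *)
Lemma projective_indecomposable_local (P : lmodType U) : projective P -> indecomposable P ->
  exists2 e, E e & exists f : {linear P -> lideal e}, bijective f.
Proof.
move=> PP [Pn0 Pind]; have [e Ee [f fs]] := projective_onto_local PP Pn0.
exists e => //; exists f; have [ee e0 _] := E_local Ee.
have [h hE] := @lideal_projective U e ee _ _ f (idfun : {linear lideal e -> lideal e}) fs.
have finj : injective f.
  pose A : {pred P} := [pred x | `[< exists y, x = h y >]].
  pose B : {pred P} := [pred x | f x == 0].
  have Acl : GRing.submod_closed A.
    split=> [|k z z']; rewrite !inE; first by apply/asboolP; exists 0; rewrite linear0.
    move=> /asboolP[x ->] /asboolP[x' ->]; apply/asboolP; exists (k *: x + x').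
    exact/esym/linearP.
  have Bcl : GRing.submod_closed B.
    split=> [|k z z']; rewrite !inE; first by rewrite linear0.
    by move=> /eqP z0 /eqP z'0; rewrite linearP z0 z'0 scaler0 addr0.
  have AB m : exists a b, [/\ a \in A, b \in B & m = a + b].
    exists (h (f m)), (m - h (f m)); split; last by rewrite addrC subrK.
      by rewrite inE; apply/asboolP; exists (f m).
    by rewrite inE linearB /= hE subrr.
  have [|A0|B0] := Pind A B Acl Bcl AB.
  - move=> m; rewrite !inE => /asboolP[y ->]; rewrite hE => /eqP /= ->.
    exact: linear0.
  - case/eqP: e0; have g0 : lideal_gen ee = 0.
      transitivity (f (h (lideal_gen ee))); first exact/esym/hE.
      rewrite (A0 (h (lideal_gen ee))) ?linear0 // inE.
      by apply/asboolP; exists (lideal_gen ee).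
    by rewrite -[LHS](lideal_genE ee) g0.
  - move=> x y xy; apply/eqP; rewrite -subr_eq0; apply/eqP/B0.
    by rewrite inE linearB /= xy subrr.
by exists h => x; [apply: finj|]; rewrite hE.
Qed.

(** Elements of R are nilpotent, so [eps] kills them. A submodule complementing the kernel contains
    some a with [eps] a = [eps] e, hence e a e = c e modulo J with c nonzero, and a generates up to
    a nilpotent factor. *)
Lemma local_cover (eps : {lrmorphism U -> F^o}) e : local_idem e -> eps e != 0 ->
  projective_cover (lideal e) (pullback eps (F^o)^o).
Proof.
move=> [ee e0 eP] epse; split; first exact: lideal_projective.
pose T : lmodType U := pullback eps (F^o)^o.
pose f (x : lideal e) : T := eps (lval x).
have fL : linear f.
  move=> k x y; rewrite /f linearP rmorphD; congr (_ + _).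
  exact: rmorphM.
exists (HB.pack_for {linear lideal e -> T} f (GRing.isLinear.Build _ _ _ _ f fL)) => /=.
  move=> y; exists ((y / eps e : F)%:A *: lideal_gen ee).
  rewrite /f -[lval _]/((y / eps e : F)%:A * (1 * e)) mul1r mulr_algl linearZ /=.
  by rewrite -[LHS]/(_ * _) mulfVK.
move=> A AP Aker x.
have [a [b [aA fb gab]]] := Aker (lideal_gen ee).
have [c /JR] := eP (lval a); set j := _ - _ => jR.
have eps_rad r : R r -> eps r = 0.
  move=> /rad_nilp /(congr1 eps); rewrite rmorphXn rmorph0 => /eqP.
  by rewrite expf_eq0 => /andP[_ /eqP].
have fa : eps (lval a) = eps e.
  have : f (lideal_gen ee) = f a + f b by rewrite gab -[a]scale1r fL !scale1r.
  by rewrite /f lideal_genE => ->; rewrite -/(f b) fb addr0.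
have c0 : c != 0.
  apply: contra_neq epse => c0; have := eps_rad _ jR.
  rewrite /j c0 scale0r subr0 -mulrA lidealE rmorphM /= fa => /eqP.
  by rewrite mulf_eq0 orbb => /eqP.
have rR : R (- c^-1 *: j) by exact: radZ.
have gA : lideal_gen ee \in A.
  apply: (submod_nilp AP (rad_nilp rR)).
  suff -> : lideal_gen ee - (- c^-1 *: j) *: lideal_gen ee = (c^-1)%:A *: (e *: a).
    by rewrite !submodZ.
  apply: lval_inj; rewrite -[LHS]/(1 * e - (- c^-1 *: j) * (1 * e)).
  rewrite -[RHS]/((c^-1)%:A * (e * lval a)) !mul1r scaleNr mulNr opprK.
  have -> : e * lval a = j + c *: e by rewrite subrK -mulrA lidealE.
  rewrite mulr_algl [RHS]scalerDr scalerA mulVf // scale1r addrC; congr (_ + _).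
  by rewrite -scalerAl /j mulrBl -!mulrA ee -scalerAl ee.
by rewrite [x](lideal_genP ee) submodZ.
Qed.

End LocalIdempotents.

(** * Zassenhaus algebras in characteristic 2 *)

Section Binomials.
Local Open Scope nat_scope.

(** From i C(2^n, i) = 2^n C(2^n - 1, i - 1): if C(2^n, i) were odd, 2^n would divide i. *)
Lemma dvd2_bin_exp n i : 0 < i < 2 ^ n -> 2 %| 'C(2 ^ n, i).
Proof.
case: i => // i /= iN; case: (boolP (2 %| _)) => // h.
have := mul_bin_diag (2 ^ n) i; set b := 'C(_, _) => e.
have : 2 ^ n %| i.+1 * 'C(2 ^ n, i.+1) by rewrite -mul_bin_diag dvdn_mulr.
rewrite Gauss_dvdl; first by move=> /dvdn_leq -/(_ isT); rewrite leqNgt iN.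
by rewrite coprimeXl // prime_coprime.
Qed.

(** A case of Kummer's theorem: the addition of i and j carries out of the n-th digit. Pascal's rule
    descends to i + j = 2^n. *)
Lemma dvd2_bin_carry n i j : i < 2 ^ n -> j < 2 ^ n -> 2 ^ n <= i + j ->
  2 %| 'C(i + j, i).
Proof.
move=> iN jN; move: {-1}(i + j) (erefl (i + j)) => m.
elim: m i j iN jN => [|m IHm] i j iN jN e mN; first by move: mN; rewrite leqNgt expn_gt0.
have [mN'|mN'] := leqP (2 ^ n) m; last first.
  have <- : 2 ^ n = m.+1 by apply/eqP; rewrite eqn_leq mN mN'.
  by apply: dvd2_bin_exp; rewrite iN andbT; lia.
case: i e iN => [|i] e iN; first by lia.
case: j e jN => [|j] e jN; first by lia.
rewrite binS dvdn_add //; first by apply: (IHm i.+1 j) => //; lia.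
by apply: (IHm i j.+1) => //; lia.
Qed.

Definition trinomial k a m := 'C(k + (a + m), k) * 'C(a + m, a).

Lemma trinomial_fact k a m : trinomial k a m * (k`! * (a`! * m`!)) = (k + (a + m))`!.
Proof.
rewrite /trinomial -(bin_fact (leq_addr (a + m) k)) addKn.
rewrite -(bin_fact (leq_addr m a)) addKn; lia.
Qed.

Lemma trinomialC k a m : trinomial k a m = trinomial a k m.
Proof.
apply/eqP; rewrite -(eqn_pmul2r (m := k`! * (a`! * m`!))) ?muln_gt0 ?fact_gt0 //.
by rewrite trinomial_fact [k`! * _]mulnCA trinomial_fact addnCA.
Qed.

(* The coefficient of the composite of x^(k) d and x^(a) d at x^(m+1). *)
Definition comp_coef k a m :=
  (0 < a + m) * ('C(a + m, a) * 'C(k + (a + m).-1, k)).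

(** The summands come from x^(k) d x^(a) d = x^(k) x^(a) d^2 + x^(k) x^(a-1) d. The first is
    symmetric in k and a, so it drops out of commutators; for k = a > 0 it is even. *)
Lemma comp_coef_pascal k a m : comp_coef k a m =
  (if m is m'.+1 then trinomial k a m' else 0) +
  (if a is a'.+1 then trinomial k a' m else 0).
Proof.
rewrite /comp_coef /trinomial; case: a m => [|a] [|m].
- by [].
- by rewrite !add0n !bin0 /=; lia.
- by rewrite !addn0 !binn /=; lia.
rewrite mul1n addSn binS addSn /= !addnS; lia.
Qed.

Lemma trinomialE k a m : 'C(k + a, k) * 'C(k + a + m, k + a) = trinomial k a m.
Proof.
apply/eqP; rewrite -(eqn_pmul2r (m := k`! * (a`! * m`!))) ?muln_gt0 ?fact_gt0 //.
rewrite trinomial_fact addnA -(bin_fact (leq_addr m (k + a))) addKn.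
by rewrite -(bin_fact (leq_addr a k)) addKn; apply/eqP; lia.
Qed.

Lemma comp_coef_bracket k a m :
  comp_coef k a m + comp_coef a k m =
    (0 < k + a) * ('C(k + a, k) * 'C((k + a).-1 + m, (k + a).-1)) %[mod 2].
Proof.
pose tm := if m is m'.+1 then trinomial k a m' else 0.
pose ta := if a is a'.+1 then trinomial k a' m else 0.
pose tk := if k is k'.+1 then trinomial k' a m else 0.
have -> : comp_coef k a m + comp_coef a k m = tk + ta + tm * 2.
  have -> : comp_coef a k m = tm + tk.
    rewrite comp_coef_pascal; congr (_ + _); rewrite /tm /tk.
      by case: (m) => // m'; rewrite trinomialC.
    by case: (k) => // k'; rewrite trinomialC.
  rewrite comp_coef_pascal -/tm -/ta; lia.
suff -> : (0 < k + a) * ('C(k + a, k) * 'C((k + a).-1 + m, (k + a).-1)) = tk + ta.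
  by rewrite addnC modnMDl.
rewrite /tk /ta; case: (k) (a) => [|k'] [|a'] //.
- by rewrite -trinomialE !add0n !bin0 /=; lia.
- by rewrite -trinomialE !addn0 !binn /=; lia.
rewrite -!trinomialE addSn /= mul1n binS addnS -addSn; lia.
Qed.

Lemma comp_coef_sqr k m :
  comp_coef k.+1 k.+1 m = 'C(k.+1 + k, k.+1) * 'C(k.+1 + k + m, k.+1 + k) %[mod 2].
Proof.
rewrite trinomialE comp_coef_pascal addnC.
case: m => [|m]; first by rewrite addn0.
rewrite -(trinomialE k.+1 k.+1) addnS binS -[in X in _ + (X + _) * _]bin_sub; last by rewrite leq_addr.
rewrite addKn addnn -muln2 mulnAC addnC modnMDl //.
Qed.
End Binomials.

(** * The Witt algebra and its adjoint module *)

Section WittAlgebra.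
Variables (F : fieldType) (n : nat).
Hypothesis pF : 2%N \in [pchar F].
Hypothesis n_gt0 : (0 < n)%N.
Local Notation N := (2 ^ n)%N.
Local Notation dp := (dp F 2 n).
Local Notation witt_e := (witt_e F 2 n).
Local Notation W := (witt F 2 n).
Local Notation V := (subvs_of W).

Lemma natr_mod2 k l : k = l %[mod 2] -> k%:R = l%:R :> F.
Proof. by move=> e; rewrite -(GRing.natr_mod_pchar pF k) e (GRing.natr_mod_pchar pF). Qed.

Lemma natr_dvd2 k : (2 %| k)%N -> k%:R = 0 :> F.
Proof. by rewrite (dvdn_pcharf pF) => /eqP. Qed.

Lemma dp_out k : (N <= k)%N -> dp k = 0.
Proof.
move=> Nk; apply/rowP => i; rewrite !mxE; case: eqP => // ik.
by move: (ltn_ord i); rewrite ik ltnNge Nk.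
Qed.

Lemma dp_basis (f : divpow F 2 n) : f = \sum_(i < N) f 0 i *: dp i.
Proof.
rewrite {1}[f]row_sum_delta; apply: eq_bigr => i _; congr (_ *: _).
by apply/rowP => j; rewrite !mxE eqxx.
Qed.

Lemma dp_mul_dp k a : (k < N)%N -> (a < N)%N -> dp_mul (dp k) (dp a) = 'C(k + a, k)%:R *: dp (k + a).
Proof.
move=> kN aN; rewrite /dp_mul (bigD1 (Ordinal kN)) //= (bigD1 (Ordinal aN)) //=.
rewrite !mxE /= !eqxx !mul1r !big1 ?addr0 // => i.
  by rewrite -val_eqE /= => /negPf ik; apply: big1 => j _; rewrite mxE ik !mul0r scale0r.
by rewrite -val_eqE /= => /negPf ia; rewrite mxE ia ?mulr0 mul0r scale0r.
Qed.

Lemma dp_der_dp a : (a < N)%N -> dp_der F 2 n (dp a) = if a is a'.+1 then dp a' else 0.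
Proof.
move=> aN; rewrite dp_derE; case: a aN => [|a] aN.
  by apply: big1 => i i0; rewrite mxE; case: eqP i0 => [->//|_ _]; rewrite scale0r.
rewrite (bigD1 (Ordinal aN)) //= mxE eqxx scale1r big1 ?addr0 // => i /andP[_].
by rewrite -val_eqE /= => /negPf ia; rewrite mxE ia scale0r.
Qed.

Lemma witt_e_dpS k m : (m.+1 < N)%N -> witt_e k (dp m.+1) = 'C(k + m, k)%:R *: dp (k + m).
Proof.
move=> mN; rewrite witt_eE dp_der_dp //.
have [kN|Nk] := ltnP k N; first by rewrite dp_mul_dp // ltnW.
rewrite dp_out // [dp (k + m)]dp_out ?(leq_trans Nk) ?leq_addr // scaler0.
apply: big1 => i _; apply: big1 => j _.
by rewrite mxE !mul0r scale0r.
Qed.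

Lemma witt_e_dp0 k : witt_e k (dp 0) = 0.
Proof.
rewrite witt_eE dp_der_dp ?expn_gt0 //.
apply: big1 => i _; apply: big1 => j _.
by rewrite [X in _ * X * _]mxE mulr0 mul0r scale0r.
Qed.

Lemma witt_eP (x y : 'End(divpow F 2 n)) : (forall c, (c < N)%N -> x (dp c) = y (dp c)) -> x = y.
Proof.
move=> h; apply/lfunP => f; rewrite (dp_basis f) !linear_sum.
by apply: eq_bigr => i _; rewrite !linearZ /= h.
Qed.

Lemma witt_e_out k : (N <= k)%N -> witt_e k = 0.
Proof.
move=> Nk; apply: witt_eP => -[|c] cN; rewrite lfunE /=; first exact: witt_e_dp0.
by rewrite witt_e_dpS // dp_out ?scaler0 // (leq_trans Nk) ?leq_addr.
Qed.

Lemma witt_e0 : witt_e 0 = dp_der F 2 n.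
Proof.
apply: witt_eP => -[|c] cN; first by rewrite witt_e_dp0 dp_der_dp.
by rewrite witt_e_dpS // dp_der_dp // add0n bin0 scale1r.
Qed.

Lemma witt_e_comp k a m : (k < N)%N -> (a < N)%N -> (m.+1 < N)%N ->
  witt_e k (witt_e a (dp m.+1)) = (comp_coef k a m)%:R *: dp (k + a + m).-1.
Proof.
move=> kN aN mN; rewrite witt_e_dpS // linearZ /= /comp_coef.
case am: (a + m)%N => [|t] /=; first by rewrite witt_e_dp0 mul0n scaler0 scale0r.
have [tN|Nt] := ltnP t.+1 N.
  rewrite witt_e_dpS // scalerA mul1n natrM; congr (_ *: dp _).
  by rewrite -addnA am addnS.
(* The inner application was truncated to zero, so the claimed coefficient must vanish; its factor
   C(a + m, a) is even by the carry. *)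
rewrite dp_out // linear0 scaler0.
rewrite mul1n natr_dvd2 ?scale0r // dvdn_mulr // -am.
by rewrite (@dvd2_bin_carry n) ?am // ltnW.
Qed.

(* The truncation k + a >= 2^n needs no separate treatment: the coefficient is
   then even. *)
Definition bcoef k a : F := ((0 < k + a) * 'C(k + a, k))%N%:R.

Lemma bcoef_out k a : (k < N)%N -> (a < N)%N -> (N <= k + a)%N -> bcoef k a = 0.
Proof. by move=> kN aN ka; rewrite /bcoef natr_dvd2 // dvdn_mull // (@dvd2_bin_carry n). Qed.

(** The usual coefficient C(k + a - 1, k) - C(k + a - 1, a) becomes C(k + a, k) modulo 2 by Pascal's
    rule; the guard in [bcoef] accounts for [d, d] = 0. *)
Lemma witt_bracket k a : (k < N)%N -> (a < N)%N ->
  lie_br (witt_e k) (witt_e a) = bcoef k a *: witt_e (k + a).-1.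
Proof.
move=> kN aN; apply: witt_eP => -[|m] mN.
  by rewrite /lie_br add_lfunE opp_lfunE !comp_lfunE scale_lfunE !witt_e_dp0 ?linear0 ?subrr ?oppr0 ?addr0.
rewrite /lie_br add_lfunE opp_lfunE !comp_lfunE scale_lfunE !witt_e_comp // [(a + k)%N]addnC.
rewrite -scaleNr oppr_pchar2 // -scalerDl -natrD (natr_mod2 (comp_coef_bracket k a m)).
rewrite natrM; case ka: (k + a)%N => [|t]; first by rewrite /bcoef ka !mul0r !scale0r.
by rewrite witt_e_dpS // scalerA /bcoef ka /= ?mul1n ?mul1r natrM.
Qed.

Definition witt_vec k : V := vsproj W (witt_e k).
Local Notation w := witt_vec.

Lemma vsval_w k : vsval (w k) = witt_e k.
Proof.
apply: vsprojK; have [kN|Nk] := ltnP k N; last by rewrite witt_e_out ?mem0v.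
by apply/memv_span/mapP; exists k => //; rewrite mem_iota.
Qed.

Definition ad_e k : 'End(V) := witt_ad (witt_e k).
Local Notation E := ad_e.

Lemma E_w k a : (k < N)%N -> (a < N)%N -> E k (w a) = bcoef k a *: w (k + a).-1.
Proof.
move=> kN aN; apply: val_inj; rewrite witt_adE /= vsprojK.
  by rewrite vsval_w witt_bracket // vsval_w.
by rewrite vsval_w witt_bracket // memvZ // -vsval_w subvsP.
Qed.

Lemma E_w_out k a : (k < N)%N -> (a < N)%N -> (N <= k + a)%N -> E k (w a) = 0.
Proof. by move=> kN aN ka; rewrite E_w // bcoef_out // scale0r. Qed.

Lemma E0_w a : (a < N)%N -> E 0 (w a) = if a is a'.+1 then w a' else 0.
Proof.
move=> aN; rewrite E_w ?expn_gt0 // /bcoef add0n bin0.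
by case: a aN => [|a] aN; rewrite ?scale0r // scale1r.
Qed.

Lemma w_span v : exists c : 'I_N -> F, v = \sum_i c i *: w i.
Proof.
have vW := subvsP v; have sz : size (mkseq witt_e N) == N by rewrite size_mkseq.
exists (fun i => coord (Tuple sz) i (vsval v)); apply: val_inj.
rewrite /= linear_sum [LHS](@coord_span _ _ _ (Tuple sz) _ vW).
by apply: eq_bigr => i _; rewrite linearZ /= vsval_w nth_mkseq.
Qed.

Lemma w_indep (c : nat -> F) : \sum_(i < N) c i *: w i = 0 -> forall i, (i < N)%N -> c i = 0.
Proof.
move=> /(congr1 val) /=; rewrite linear_sum /= => h i iN.
have n1 : (1 < N)%N by rewrite -{1}(expn0 2) ltn_exp2l.
(* Evaluation at x^(1) sends [witt_e k] to x^(k). *)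
have /lfunP/(_ (dp 1)) := h; rewrite sum_lfunE lfunE /= => /rowP/(_ (Ordinal iN)).
rewrite summxE (bigD1 (Ordinal iN)) //= big1 => [|j].
  rewrite vsval_w lfunE /= witt_e_dpS // addn0 binn scale1r !mxE eqxx mulr1 addr0 //.
rewrite -val_eqE /= => /negPf ij.
by rewrite vsval_w lfunE /= witt_e_dpS // addn0 binn scale1r !mxE eq_sym ij mulr0.
Qed.

Lemma endV_eq (x y : 'End(V)) : (forall a, (a < N)%N -> x (w a) = y (w a)) -> x = y.
Proof.
move=> h; apply/lfunP => v; have [c ->] := w_span v; rewrite !linear_sum.
by apply: eq_bigr => i _; rewrite !linearZ /= h.
Qed.

End WittAlgebra.

Section CommutatorsPchar2.
Variables (F : fieldType) (V : vectType F).
Implicit Types x y z : 'End(V).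

Lemma lie_brE x y v : lie_br x y v = x (y v) - y (x v).
Proof. by rewrite /lie_br add_lfunE opp_lfunE !comp_lfunE. Qed.

Lemma p_map2E x v : p_map 2 x v = x (x v).
Proof. by rewrite /p_map /lfun_exp /= !comp_lfunE id_lfunE. Qed.

Lemma lie_brC x y : lie_br x y = - lie_br y x.
Proof. by rewrite /lie_br opprB. Qed.

Lemma lie_brPl k x y z : lie_br (k *: x + y) z = k *: lie_br x z + lie_br y z.
Proof.
apply/lfunP => v; rewrite !(lie_brE, add_lfunE, scale_lfunE).
by rewrite linearP opprD scalerBr addrACA.
Qed.

Lemma lie_brPr k x y z : lie_br z (k *: x + y) = k *: lie_br z x + lie_br z y.
Proof. by rewrite lie_brC lie_brPl [lie_br x z]lie_brC [lie_br y z]lie_brC scalerN -opprD opprK. Qed.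

Lemma iter_p_map2 x i : iter i (p_map 2) x = lfun_exp x (2 ^ i).
Proof.
have D k l : lfun_exp x (k + l) = (lfun_exp x k \o lfun_exp x l)%VF.
  by elim: k => [|k IHk] /=; rewrite ?comp_lfun1l // IHk comp_lfunA.
elim: i => [|i IHi] /=; first by rewrite /lfun_exp /= comp_lfun1r.
by rewrite IHi expnS mul2n -addnn D; apply/lfunP => v; rewrite p_map2E comp_lfunE.
Qed.

Hypothesis pF : 2%N \in [pchar F].

(** Jacobson's formula for p = 2: the mixed terms xy + yx form the bracket. *)
Lemma p_map2_lin k x y :
  p_map 2 (k *: x + y) = k ^+ 2 *: p_map 2 x + p_map 2 y + k *: lie_br x y.
Proof.
apply/lfunP => v; rewrite !(lie_brE, p_map2E, add_lfunE, scale_lfunE).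
have lin z u u' : z (k *: u + u') = k *: z u + z u' by exact: linearP.
rewrite !lin scalerDr scalerA -expr2 scalerBr -!addrA; congr (_ + _).
rewrite addrA addrC; congr (_ + (_ + _)).
by rewrite -scaleNr oppr_pchar2.
Qed.

Lemma lie_br_p_map2 x y : lie_br (p_map 2 x) y = lie_br x (lie_br x y).
Proof.
apply/lfunP => v; rewrite !(lie_brE, p_map2E) linearB /= opprB.
by rewrite addrACA -opprD addxx2 // oppr0 addr0 -scaleN1r oppr_pchar2 // scale1r.
Qed.

(** By Jacobson's formula, closure under the bracket reduces closure under the [2]-map to a spanning
    family. *)
Lemma restricted_span (d : nat) (X : d.-tuple 'End(V)) :
  (forall i j : 'I_d, lie_br X`_i X`_j \in <<X>>%VS) ->
  (forall i : 'I_d, p_map 2 X`_i \in <<X>>%VS) -> restricted_subalgebra 2 <<X>>%VS.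
Proof.
move=> XB XP.
have LB x y : x \in <<X>>%VS -> y \in <<X>>%VS -> lie_br x y \in <<X>>%VS.
  have br0l z : lie_br 0 z = 0 by apply/lfunP => v; rewrite lie_brE !zero_lfunE linear0 subrr.
  have br0r z : lie_br z 0 = 0 by rewrite lie_brC br0l oppr0.
  move=> /coord_span -> /coord_span ->; elim/big_rec: _ => [|i x' _ IH]; first by rewrite br0l mem0v.
  rewrite lie_brPl memvD // memvZ //; elim/big_rec: _ {IH} => [|j y' _ IH]; first by rewrite br0r mem0v.
  by rewrite lie_brPr memvD // memvZ.
split=> // x /coord_span ->.
suff h (s : seq 'I_d) (c : 'I_d -> F) : p_map 2 (\sum_(i <- s) c i *: X`_i) \in <<X>>%VS by apply: h.
have mX i : X`_i \in <<X>>%VS.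
  have [id|di] := ltnP i (size X); first by rewrite memv_span // mem_nth.
  by rewrite nth_default ?mem0v.
elim: s => [|i s IHs].
  by rewrite big_nil (_ : p_map 2 0 = 0) ?mem0v //; apply/lfunP => v; rewrite p_map2E !zero_lfunE.
rewrite big_cons p_map2_lin memvD ?memvD ?memvZ //.
by apply: LB => //; apply: memv_suml => j _; rewrite memvZ.
Qed.

End CommutatorsPchar2.

Lemma sumv_nat_sup (F : fieldType) (V : vectType F) (f : nat -> {vspace V}) n i :
  (0 < i)%N -> (i < n)%N -> (f i <= \sum_(1 <= k < n) f k)%VS.
Proof.
move=> i0 i_n; rewrite (bigD1_seq i) ?iota_uniq //; first exact: addvSl.
by rewrite mem_index_iota i0.
Qed.

(** * Basis and restricted structure of the Zassenhaus algebra *)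

Section ZassenhausAlgebra.
Variables (F : fieldType) (n : nat).
Hypothesis pF : 2%N \in [pchar F].
Hypothesis n_gt0 : (0 < n)%N.
Local Notation N := (2 ^ n)%N.
Local Notation W := (witt F 2 n).
Local Notation V := (subvs_of W).
Local Notation L := (zassenhaus F 2 n).
Local Notation E := (ad_e F n).
Local Notation w := (witt_vec F n).
Local Notation coef := (bcoef F).

Let N_gt0 : (0 < N)%N. Proof. by rewrite expn_gt0. Qed.
Let N_gt1 : (1 < N)%N. Proof. by rewrite -{1}(expn0 2) ltn_exp2l. Qed.

Let predN k : (k < N.-1)%N -> (k.+1 < N)%N. Proof. by lia. Qed.

(** Operators are tested on a single w_a, which they move along index maps such as i -> 2^n - 1 -
    2^i; injectivity of the map isolates their coefficients. *)
Lemma w_indep_inj m (f : nat -> nat) (c : nat -> F) :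
  (forall i, (i < m)%N -> (f i < N)%N) ->
  (forall i j, (i < m)%N -> (j < m)%N -> f i = f j -> i = j) ->
  \sum_(i < m) c i *: w (f i) = 0 -> forall i, (i < m)%N -> c i = 0.
Proof.
move=> fN finj c0 i im.
pose g k := \sum_(j < m | f j == k) c j.
have : \sum_(k < N) g k *: w k = 0.
  rewrite -[RHS]c0 (eq_bigr (fun k : 'I_N => \sum_(j < m | f j == k) c j *: w (f j))).
    rewrite (exchange_big_dep predT) //=; apply: eq_bigr => j _.
    by rewrite (big_pred1 (Ordinal (fN j (ltn_ord j)))) // => k; rewrite -val_eqE eq_sym.
  by move=> k _; rewrite scaler_suml; apply: eq_bigr => j /eqP->.
move=> /(w_indep n_gt0)/(_ _ (fN i im)); rewrite /g.
by rewrite (big_pred1 (Ordinal im)) // => j; apply/eqP/eqP => [/finj h|->//]; apply/val_inj/h.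
Qed.

Definition der_pow j : 'End(V) := iter j (p_map 2) (E 0).
Local Notation D := der_pow.

Lemma expE0_w m a : (a < N)%N -> lfun_exp (E 0) m (w a) = if (m <= a)%N then w (a - m) else 0.
Proof.
move=> aN; elim: m => [|m IHm]; first by rewrite /lfun_exp /= id_lfunE subn0.
rewrite -[lfun_exp _ _]/(E 0 \o lfun_exp (E 0) m)%VF comp_lfunE IHm.
have [ma|am] := leqP m a; last by rewrite linear0 leqNgt ltnW.
rewrite E0_w //; last exact: leq_ltn_trans (leq_subr _ _) aN.
rewrite subnS; case am: (a - m)%N => [|t]; first by rewrite ltnNge -subn_eq0 am.
by rewrite /= ltnNge -subn_eq0 am.
Qed.

Lemma D_w j a : (a < N)%N -> D j (w a) = if (2 ^ j <= a)%N then w (a - 2 ^ j) else 0.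
Proof. by move=> aN; rewrite /der_pow iter_p_map2 expE0_w. Qed.

Lemma D_out j : (n <= j)%N -> D j = 0.
Proof.
move=> nj; apply: endV_eq => a aN; rewrite D_w // zero_lfunE leqNgt.
by rewrite (leq_trans aN) // leq_exp2l.
Qed.

Lemma E_out k : (N <= k)%N -> E k = 0.
Proof.
move=> Nk; apply/lfunP => v; rewrite /ad_e witt_e_out // witt_adE zero_lfunE.
rewrite (_ : lie_br 0 _ = 0) ?linear0 //.
by apply/lfunP => u; rewrite lie_brE !zero_lfunE linear0 subrr.
Qed.

(** Under x^(a + 1) -> w_a the adjoint action formally has the coefficients of the action on O(1;n)
    modulo constants, so [comp_coef] governs it as well. *)
Lemma EE_w k l a : (k < N)%N -> (l < N)%N -> (a < N)%N -> (1 < k + l + a)%N ->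
  E k (E l (w a)) = (comp_coef k l a)%:R *: w (k + l + a).-2.
Proof.
move=> kN lN aN kla; rewrite E_w // linearZ /=.
have [la|la] := leqP N (l + a).
  rewrite (bcoef_out pF lN aN la) scale0r /comp_coef natr_dvd2 ?scale0r //.
  by rewrite dvdn_mull // dvdn_mulr // (dvd2_bin_carry lN aN la).
rewrite E_w //; last by rewrite (leq_ltn_trans (leq_pred _)).
rewrite scalerA /bcoef -natrM /comp_coef -addnA; case lal: (l + a)%N => [|t].
  by rewrite !mul0n !scale0r.
rewrite /= !mul1n [X in _ = _ *: w X](_ : _ = (k + t).-1); last by lia.
by rewrite (_ : (0 < k + t)%N) ?mul1n //; lia.
Qed.

Lemma E_bracket k l : (k < N)%N -> (l < N)%N -> lie_br (E k) (E l) = coef k l *: E (k + l).-1.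
Proof.
move=> kN lN; apply: endV_eq => a aN; rewrite lie_brE scale_lfunE.
have [kla|kla] := ltnP 1 (k + l + a); last first.
  have small i j b : (i < N)%N -> (j < N)%N -> (b < N)%N -> (i + j + b <= 1)%N -> E i (E j (w b)) = 0.
    move=> iN jN bN ijb; have jb : ((j + b).-1 < N)%N by apply: leq_ltn_trans N_gt1; lia.
    rewrite E_w // linearZ /= E_w //.
    rewrite scalerA /bcoef -natrM; case jbE: (j + b)%N => [|t]; first by rewrite !mul0n scale0r.
    by rewrite (_ : (0 < i + t.+1.-1)%N = false) ?mul0n ?muln0 ?scale0r //; lia.
  rewrite !small //; last by rewrite [(l + k)%N]addnC.
  rewrite subrr; case kl: (k + l)%N => [|t]; first by rewrite /bcoef kl mul0n scale0r.
  have [-> ->] : t = 0%N /\ a = 0%N by lia.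
  by rewrite E_w // /bcoef mul0n scale0r scaler0.
rewrite !EE_w //; last by rewrite [(l + k)%N]addnC.
rewrite [(l + k)%N]addnC -scalerBl -[- _%:R]oppr_pchar2 // opprK -natrD.
rewrite (natr_mod2 pF (comp_coef_bracket k l a)).
have [Nkl|klN] := leqP N (k + l).
  rewrite (bcoef_out pF kN lN Nkl) scale0r natr_dvd2 ?scale0r // dvdn_mull //.
  by rewrite dvdn_mulr // (dvd2_bin_carry kN lN).
rewrite E_w //; last by rewrite (leq_ltn_trans (leq_pred _)).
rewrite scalerA /bcoef -natrM; case kl: (k + l)%N => [|t]; first by rewrite !mul0n !scale0r.
rewrite /= !mul1n (_ : (0 < t + a)%N) ?mul1n ?addSn //; last by lia.
Qed.

Lemma E_sqr k : (k.+1 < N)%N -> p_map 2 (E k.+1) = 'C(k.+1 + k, k.+1)%:R *: E (k.+1 + k).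
Proof.
move=> kN; apply: endV_eq => a aN; rewrite p_map2E scale_lfunE EE_w //; last by lia.
rewrite (natr_mod2 pF (comp_coef_sqr k a)).
have [Nkl|klN] := leqP N (k.+1 + k).
  rewrite E_out // zero_lfunE scaler0 natr_dvd2 ?scale0r //.
  by rewrite dvdn_mulr // (@dvd2_bin_carry n) // ltnW.
rewrite E_w // scalerA /bcoef mul1n -natrM; congr (_ *: w _); lia.
Qed.

Lemma E1_sqr : p_map 2 (E 1) = E 1.
Proof. by rewrite E_sqr // addn0 binn scale1r. Qed.

Let d := (n + N.-1)%N.

(** d itself is counted once, as [D 0]; the second block therefore starts at x^(1) d, whence the
    successor in the index of [E]. *)
Definition zbasis : d.-tuple 'End(V) :=
  [tuple (if i < n then D i else E (i - n).+1)%N | i < d].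

Lemma zbasisE i : (i < d)%N -> zbasis`_i = (if i < n then D i else E (i - n).+1)%N.
Proof. by move=> id; rewrite -[i]/(val (Ordinal id)) -tnth_nth tnth_mktuple. Qed.

Lemma D_zbasis j : D j \in <<zbasis>>%VS.
Proof.
have [jn|nj] := ltnP j n; last by rewrite D_out ?mem0v.
have jd : (j < d)%N by rewrite ltn_addr.
have -> : D j = zbasis`_j by rewrite zbasisE // jn.
by apply/memv_span/mem_nth; rewrite size_tuple.
Qed.

Lemma E_zbasis k : E k \in <<zbasis>>%VS.
Proof.
case: k => [|k]; first exact: (D_zbasis 0).
have [kN|Nk] := ltnP k.+1 N; last by rewrite E_out ?mem0v.
have kd : (n + k < d)%N by rewrite ltn_add2l -ltnS prednK.
have -> : E k.+1 = zbasis`_(n + k) by rewrite zbasisE // ltnNge leq_addr /= addKn.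
by apply/memv_span/mem_nth; rewrite size_tuple.
Qed.

Lemma zbasis_span : <<zbasis>>%VS = L.
Proof.
have DE j : iter j (p_map 2) (witt_ad (dp_der F 2 n)) = D j by rewrite -witt_e0.
apply: subv_anti; apply/andP; split.
  apply/span_subvP => x /(nthP 0)[i]; rewrite size_tuple => id <-.
  rewrite zbasisE //.
  have EL k : (k < N)%N -> E k \in L.
    move=> kN; apply: (subvP (addvSr _ _)); apply/memv_span/map_f/mapP.
    by exists k => //; rewrite mem_iota.
  case: ltnP => [i_n|ni].
    case: i i_n {id} => [|i] i_n; first exact: (EL 0%N N_gt0).
    have DS : (<[D i.+1]> <= \sum_(1 <= k < n) <[D k]>)%VS.
      exact: (@sumv_nat_sup _ _ (fun k => <[D k]>%VS)).
    rewrite memvE; apply: subv_trans DS (subv_trans _ (addvSl _ _)).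
    by rewrite (eq_big_nat _ _ (fun k _ => congr1 (@vline _ _) (esym (DE k)))).
  by apply: EL; rewrite -[N]prednK // ltnS -(ltn_add2l n) subnKC // ltn_subRL // addnC.
rewrite subv_add; apply/andP; split.
  elim/big_ind: _ => [|x y hx hy|k _]; [exact: sub0v|by rewrite subv_add hx hy|].
  by rewrite -memvE DE D_zbasis.
apply/span_subvP => x /mapP[y /mapP[k _ ->] ->]; exact: E_zbasis.
Qed.

(** Evaluation at w_0 kills every [D j] and sends [E i.+1] to w_i, which isolates the second block.
    Evaluation at w_(2^n - 1) then separates the [D j] by the distinct indices 2^n - 1 - 2^j. *)
Lemma zbasis_free : free zbasis.
Proof.
apply/freeP => c c0; have cnat i (id : (i < d)%N) : c (Ordinal id) = c (Ordinal id) by [].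
pose c' i := if insub i is Some k then c k else 0.
have c'E (i : 'I_d) : c' i = c i by rewrite /c' valK.
have {}c0 : \sum_(i < n) c' i *: D i + \sum_(i < N.-1) c' (n + i)%N *: E i.+1 = 0.
  rewrite -[RHS]c0 big_split_ord /=; congr (_ + _); apply: eq_bigr => i _.
    by rewrite -c'E zbasisE ?ltn_addr //= ltn_ord.
  by rewrite -c'E zbasisE ?ltn_add2l //= ltnNge leq_addr /= addKn.
have cE i : (i < N.-1)%N -> c' (n + i)%N = 0.
  move=> iN; have /lfunP/(_ (w 0)) := c0.
  rewrite add_lfunE zero_lfunE !sum_lfunE big1 ?add0r => [h|j _]; last first.
    by rewrite scale_lfunE D_w // leqNgt expn_gt0 scaler0.
  apply: (@w_indep_inj N.-1 id (fun j => c' (n + j)%N)) iN => // [j jN|].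
    by apply: ltn_trans (predN jN).
  rewrite -[RHS]h; apply: eq_bigr => j _.
  rewrite scale_lfunE E_w //; last by apply: predN.
  by rewrite addn0 /bcoef /= addn0 binn scale1r.
have cD j : (j < n)%N -> c' j = 0.
  move=> jn; have /lfunP/(_ (w N.-1)) := c0.
  have N1 : (N.-1 < N)%N by rewrite ltn_predL.
  have jN i : (i < n)%N -> (2 ^ i <= N.-1)%N.
    by move=> i_n; rewrite -ltnS prednK // ltn_exp2l.
  rewrite add_lfunE zero_lfunE !sum_lfunE addrC big1 ?add0r => [h|i _]; last first.
    by rewrite cE // scale0r zero_lfunE.
  apply: (@w_indep_inj n (fun i => N.-1 - 2 ^ i)%N c') jn => [i _|i k iN kN e|].
  - exact: leq_ltn_trans (leq_subr _ _) N1.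
  - have := jN _ iN; have := jN _ kN => h1 h2.
    by apply/eqP; rewrite -(eqn_exp2l (m := 2)) //; apply/eqP; lia.
  - rewrite -[RHS]h; apply: eq_bigr => i _.
    by rewrite scale_lfunE D_w // jN.
move=> i; rewrite -c'E; have [i_n|ni] := ltnP i n; first exact: cD.
by rewrite -(subnKC ni) cE // ltn_subLR // -addSn ltn_ord.
Qed.

Lemma zbasisP : basis_of L zbasis.
Proof. by rewrite /basis_of zbasis_span eqxx zbasis_free. Qed.

Lemma dim_zassenhaus : \dim L = (n + N.-1)%N.
Proof. by rewrite -zbasis_span (eqP zbasis_free) size_tuple. Qed.

Lemma E_mem k : E k \in L. Proof. by rewrite -zbasis_span E_zbasis. Qed.
Lemma D_mem j : D j \in L. Proof. by rewrite -zbasis_span D_zbasis. Qed.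

Lemma E_sqr_ex k : (0 < k)%N -> exists c, p_map 2 (E k) = c *: E (k + k).-1.
Proof.
case: k => // k _; have [kN|Nk] := ltnP k.+1 N.
  by exists 'C(k.+1 + k, k.+1)%:R; rewrite E_sqr // addnS.
exists 0; rewrite E_out // scale0r.
by apply/lfunP => v; rewrite p_map2E !zero_lfunE.
Qed.

Lemma E_bracket_ex k l : exists c, lie_br (E k) (E l) = c *: E (k + l).-1.
Proof.
have br0 x : lie_br 0 x = 0 by apply/lfunP => v; rewrite lie_brE !zero_lfunE linear0 subrr.
have [kN|Nk] := ltnP k N; last by exists 0; rewrite (E_out Nk) br0 scale0r.
have [lN|Nl] := ltnP l N; last by exists 0; rewrite (E_out Nl) lie_brC br0 oppr0 scale0r.
by exists (coef k l); rewrite E_bracket.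
Qed.

Lemma zassenhaus_restricted : restricted_subalgebra 2 L.
Proof.
rewrite -zbasis_span.
(* The bracket with a [2]-power is a double bracket, so induction on j leaves only the bracket with
   d. *)
have DS j y : y \in <<zbasis>>%VS -> lie_br (D j) y \in <<zbasis>>%VS.
  elim: j y => [|j IHj] y yS; last by rewrite /der_pow /= -/(D j) lie_br_p_map2 ?IHj.
  rewrite (coord_span yS); elim/big_rec: _ => [|i z _ IH].
    rewrite (_ : lie_br _ 0 = 0) ?mem0v //.
    by apply/lfunP => v; rewrite lie_brE !zero_lfunE linear0 subrr.
  rewrite lie_brPr memvD ?memvZ // zbasisE //; case: ifP => _; last first.
    by have [c ->] := E_bracket_ex 0 (i - n).+1; rewrite memvZ // E_zbasis.
  rewrite (_ : lie_br _ _ = 0) ?mem0v //.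
  apply/lfunP => v; rewrite zero_lfunE -[D 0]/(E 0) /lie_br /der_pow iter_p_map2.
  have comm m : (E 0 \o lfun_exp (E 0) m = lfun_exp (E 0) m \o E 0)%VF.
    elim: m => [|m IHm]; first by rewrite /lfun_exp /= comp_lfun1l comp_lfun1r.
    by rewrite /= -comp_lfunA -IHm.
  by rewrite comm subrr zero_lfunE.
apply: restricted_span => // [i j|i]; last first.
  rewrite zbasisE //; case: ifP => _; first exact: (D_zbasis i.+1).
  by have [c ->] := @E_sqr_ex (i - n).+1 isT; rewrite memvZ // E_zbasis.
have Zj : zbasis`_j \in <<zbasis>>%VS by apply/memv_span/mem_nth; rewrite size_tuple.
rewrite (zbasisE (ltn_ord i)); case: ifP => _; first exact: DS.
rewrite zbasisE //; case: ifP => _; first by rewrite lie_brC memvN DS // E_zbasis.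
by have [c ->] := E_bracket_ex (i - n).+1 (j - n).+1; rewrite memvZ // E_zbasis.
Qed.

End ZassenhausAlgebra.

(** * Radical of the restricted enveloping algebra *)

Section NaturalModule.
Variables (F : fieldType) (p : nat) (pF : p \in [pchar F]) (V : vectType F).
Variables (L : {vspace 'End(V)}) (N : nat) (e : N.+1.-tuple V).
Hypothesis eb : basis_of {:V} e.
Local Notation U := (u_alg L pF).

Fact u_rep_subproof :
  let f (x : subvs_of L) : 'M[F]_N.+1 := endmx e (vsval x) in
  [/\ {morph f : x y / x + y}, forall k x, f (k *: x) = k *: f x,
   forall x y z, vsval z = lie_br (vsval x) (vsval y) ->
     f z = f x * f y - f y * f x
   & forall x z, vsval z = p_map p (vsval x) -> f z = f x ^+ p].
Proof.
move=> f; split=> [x y|k x|x y z h|x z h]; rewrite /f.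
- by rewrite !linearD.
- by rewrite !linearZ.
- by rewrite h /lie_br linearB /= !endmxM.
- by rewrite h /p_map endmx_exp.
Qed.

Definition u_rep : {lrmorphism U -> 'M[F]_N.+1} :=
  let: And4 fD fZ fB fP := u_rep_subproof in u_lift pF fD fZ fB fP.

Lemma u_rep_gen x : u_rep (u_gen pF x) = endmx e (vsval x).
Proof. by rewrite /u_rep; case: u_rep_subproof => *; exact: u_liftE. Qed.

Definition act (u : U) (v : V) : V := \sum_i \sum_j (u_rep u i j * coord e j v) *: e`_i.

Lemma act_linear u : linear (act u).
Proof.
move=> k x y; rewrite /act scaler_sumr -big_split; apply: eq_bigr => i _ /=.
rewrite scaler_sumr -big_split; apply: eq_bigr => j _ /=.
by rewrite linearP scalerA -scalerDl mulrDr [X in X + _]mulrCA.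
Qed.

HB.instance Definition _ u := GRing.isLinear.Build F V V _ (act u) (act_linear u).

Lemma act_linear_l k u u' v : act (k *: u + u') v = k *: act u v + act u' v.
Proof.
rewrite /act scaler_sumr -big_split; apply: eq_bigr => i _ /=.
rewrite scaler_sumr -big_split; apply: eq_bigr => j _ /=.
by rewrite linearP !mxE scalerA -scalerDl mulrDl mulrA.
Qed.

Lemma act_coord u v i : coord e i (act u v) = \sum_j u_rep u i j * coord e j v.
Proof.
rewrite /act linear_sum (bigD1 i) //= [X in _ + X]big1 ?addr0 => [|k ki].
  rewrite linear_sum; apply: eq_bigr => j _.
  by rewrite linearZ /= coord_free ?(basis_free eb) // eqxx mulr1.
rewrite linear_sum; apply: big1 => j _.
by rewrite linearZ /= coord_free ?(basis_free eb) // (negPf ki) mulr0.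
Qed.

Lemma coord_eq (x y : V) : (forall i, coord e i x = coord e i y) -> x = y.
Proof. by move=> h; rewrite (coordE eb x) (coordE eb y); apply: eq_bigr => i _; rewrite h. Qed.

Lemma act_mul u u' v : act (u * u') v = act u (act u' v).
Proof.
apply: coord_eq => i; rewrite !act_coord; under [RHS]eq_bigr do rewrite act_coord mulr_sumr.
rewrite exchange_big /=; apply: eq_bigr => j _; rewrite rmorphM mxE mulr_suml.
by apply: eq_bigr => k _; rewrite mulrA.
Qed.

Lemma act1 v : act 1 v = v.
Proof.
apply: coord_eq => i; rewrite act_coord rmorph1 (bigD1 i) //= big1 => [|j /negPf ji].
  by rewrite mxE eqxx mul1r addr0.
by rewrite mxE eq_sym ji mul0r.
Qed.

Lemma act_gen x v : act (u_gen pF x) v = vsval x v.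
Proof.
apply: coord_eq => i; rewrite act_coord u_rep_gen [in RHS](coordE eb v) !linear_sum.
by apply: eq_bigr => j _; rewrite !linearZ mxE mulrC.
Qed.

Lemma actZ k u v : act (k *: u) v = k *: act u v.
Proof. 
have act0 : act 0 v = 0 by apply: coord_eq => i; rewrite act_coord [RHS]linear0 big1 // => j _; rewrite raddf0 mxE mul0r.
by rewrite -[k *: u]addr0 act_linear_l act0 addr0.
Qed.

Lemma actD u u' v : act (u + u') v = act u v + act u' v.
Proof. by have := act_linear_l 1 u u' v; rewrite !scale1r. Qed.

Lemma actB u u' v : act (u - u') v = act u v - act u' v.
Proof. by rewrite actD -scaleN1r actZ scaleN1r. Qed.

Lemma act_sum I (r : seq I) (P : pred I) (f : I -> U) v :
  act (\sum_(i <- r | P i) f i) v = \sum_(i <- r | P i) act (f i) v.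
Proof.
elim/big_rec2: _ => [|i x y _ <-]; last by rewrite actD.
by rewrite -(scale0r (1 : U)) actZ scale0r.
Qed.

End NaturalModule.

(** * Primitive vectors of restricted modules *)

Section ZassenhausEnveloping.
Variables (F : fieldType) (pF : 2%N \in [pchar F]) (n : nat).
Hypothesis n_gt0 : (0 < n)%N.
Local Notation N := (2 ^ n)%N.
Local Notation W := (witt F 2 n).
Local Notation V := (subvs_of W).
Local Notation L := (zassenhaus F 2 n).
Local Notation E := (ad_e F n).
Local Notation D := (der_pow F n).
Local Notation w := (witt_vec F n).
Local Notation U := (u_alg L pF).

Let N_gt0 : (0 < N)%N. Proof. by rewrite expn_gt0. Qed.
Let N_gt1 : (1 < N)%N. Proof. by rewrite -{1}(expn0 2) ltn_exp2l. Qed.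

Definition wbasis : (N.-1.+1).-tuple V := [tuple w i | i < N.-1.+1].

Lemma wbasisE i : (i < N)%N -> wbasis`_i = w i.
Proof.
move=> iN; have iN' : (i < N.-1.+1)%N by rewrite prednK.
by rewrite -[i]/(val (Ordinal iN')) -tnth_nth tnth_mktuple.
Qed.

Lemma wbasisP : basis_of {:V} wbasis.
Proof.
have N1 : N.-1.+1 = N by rewrite prednK.
rewrite /basis_of; apply/andP; split.
  rewrite eqEsubv subvf; apply/subvP => v _; have [c ->] := w_span v.
  apply: memv_suml => i _; rewrite memvZ // -wbasisE //.
  by apply/memv_span/mem_nth; rewrite size_tuple prednK.
have ordN (i : 'I_N.-1.+1) : (i < N)%N := leq_trans (ltn_ord i) (eq_leq N1).
apply/freeP => c c0 i.
pose c' k := if insub k is Some j then c j else 0.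
have c'E (k : 'I_N.-1.+1) : c' k = c k by rewrite /c' valK.
rewrite -c'E; apply: (w_indep_inj n_gt0 (f := id)) (ltn_ord i) => // [k|].
  by rewrite N1.
by rewrite -[RHS]c0; apply: eq_bigr => k _; rewrite c'E wbasisE.
Qed.

Definition zgen k : U := u_gen pF (vsproj L (E k)).
Local Notation eps := zgen.

Lemma u_gen0 : u_gen pF (0 : subvs_of L) = 0.
Proof. by rewrite -(scale0r (0 : subvs_of L)) u_genZr; exact: scale0r. Qed.

Lemma eps_out k : (N <= k)%N -> eps k = 0.
Proof.
by move=> Nk; rewrite /zgen E_out // linear0 u_gen0.
Qed.

Let vsprojE k : vsval (vsproj L (E k)) = E k. Proof. by rewrite vsprojK ?E_mem. Qed.
Let vsprojD j : vsval (vsproj L (D j)) = D j. Proof. by rewrite vsprojK ?D_mem. Qed.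

Lemma eps_bracket k l : exists c : F, eps k * eps l - eps l * eps k = c *: eps (k + l).-1.
Proof.
have [c cE] := E_bracket_ex pF n_gt0 k l; exists c.
rewrite /zgen -u_genZr -linearZ -cE; apply/esym/u_genBr.
by rewrite !vsprojE vsprojK // cE memvZ // E_mem.
Qed.

Lemma eps_sqr k : (0 < k)%N -> exists c : F, eps k * eps k = c *: eps (k + k).-1.
Proof.
move=> k0; have [c cE] := E_sqr_ex pF n_gt0 k0; exists c.
rewrite /zgen -u_genZr -linearZ -cE -expr2; apply/esym/u_genPr.
by rewrite !vsprojE vsprojK // cE memvZ // E_mem.
Qed.

Lemma eps1_sqr : eps 1 * eps 1 = eps 1.
Proof. by rewrite -expr2; apply/esym/u_genPr; rewrite !vsprojE E1_sqr. Qed.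

Lemma gen_D j : u_gen pF (vsproj L (D j)) = eps 0 ^+ (2 ^ j).
Proof.
elim: j => [|j IHj]; first by rewrite expr1.
by rewrite expnSr exprM -IHj; apply: u_genPr; rewrite !vsprojD.
Qed.

Lemma eps0_nilp m : (N <= m)%N -> eps 0 ^+ m = 0.
Proof.
move=> /subnK <-; by rewrite exprD -gen_D D_out // linear0 u_gen0 mulr0.
Qed.

(** In u(L) the iterates of d under the [2]-map are powers of [eps 0], so only the generators
    [eps k] need to be tested. *)
Lemma gen_eps (S : U -> Prop) : (forall u v, S u -> S v -> S (u + v)) ->
  (forall k u, S u -> S (k *: u)) -> (forall k u, S u -> S (eps k * u)) ->
  forall u v, S v -> S (u * v).
Proof.
move=> SD SZ SE; apply: u_alg_closed => // x u Su.
have S0 : S 0 by rewrite -(scale0r u); apply: SZ.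
rewrite (u_gen_coord pF _ (zbasisP pF n_gt0)) mulr_suml.
elim/big_ind: _ => [||i _]; [exact: S0|exact: SD|].
rewrite -scalerAl; apply: SZ; rewrite zbasisE //; case: ifP => _; last exact: SE.
rewrite gen_D; elim: (2 ^ i)%N => [|m IHm]; first by rewrite expr0 mul1r.
by rewrite exprS -mulrA; apply: SE.
Qed.

(** For j > 0 this is [eps j] minus the value of the character taking x d to lam and the higher
    x^(j) d to 0; the sign is immaterial in characteristic 2. *)
Definition eps_shift (lam : F) j : U := eps j + (if j == 1%N then lam else 0)%:A.

(* u(L) is spanned, modulo the left ideal of the one-dimensional module of
   weight lam of the standard filtration subalgebra, by the powers of d. *)
Lemma eps_decomp lam (u : U) : exists (c : 'I_N -> F) (f : 'I_N -> U),
  u = \sum_(a < N) c a *: eps 0 ^+ a + \sum_(j < N | (0 < j)%N) f j * eps_shift lam j.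
Proof.
pose S (u : U) := exists (c : 'I_N -> F) (f : 'I_N -> U),
  u = \sum_(a < N) c a *: eps 0 ^+ a + \sum_(j < N | (0 < j)%N) f j * eps_shift lam j.
have SD x y : S x -> S y -> S (x + y).
  move=> [c [f ->]] [c' [f' ->]]; exists (fun a => c a + c' a), (fun j => f j + f' j).
  rewrite addrACA -!big_split; congr (_ + _); apply: eq_bigr => i _ /=.
    by rewrite scalerDl.
  by rewrite mulrDl.
have SZ k x : S x -> S (k *: x).
  move=> [c [f ->]]; exists (fun a => k * c a), (fun j => k *: f j).
  rewrite scalerDr !scaler_sumr; congr (_ + _); apply: eq_bigr => i _ /=.
    by rewrite scalerA.
  by rewrite scalerAl.
have SF j v : (0 < j < N)%N -> S (v * eps_shift lam j).
  move=> /andP[j0 jN]; exists (fun=> 0), (fun i => if i == Ordinal jN then v else 0).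
  rewrite big1 ?add0r => [|a _]; last by rewrite scale0r.
  rewrite (bigD1 (Ordinal jN)) //= eqxx big1 ?addr0 // => i /andP[_ /negPf->].
  by rewrite mul0r.
have Sd m : S (eps 0 ^+ m).
  have [mN|Nm] := ltnP m N; last first.
    rewrite eps0_nilp //; exists (fun=> 0), (fun=> 0).
    by rewrite !big1 ?addr0 // => i _; rewrite ?scale0r ?mul0r.
  exists (fun a => if a == Ordinal mN then 1 else 0), (fun=> 0).
  rewrite [X in _ + X]big1 ?addr0 => [|i _]; last by rewrite mul0r.
  rewrite (bigD1 (Ordinal mN)) //= eqxx scale1r big1 ?addr0 // => i /negPf->.
  by rewrite scale0r.
have S0 : S 0 by rewrite -(scale0r (1 : U)); apply/SZ/(Sd 0%N).
have Ssum I (r : seq I) (P : pred I) (g : I -> U) : (forall i, P i -> S (g i)) -> S (\sum_(i <- r | P i) g i).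
  by move=> h; apply: big_ind.
have Sl x : S x -> forall y, (forall a, S (y * eps 0 ^+ a)) -> S (y * x).
  move=> [c [f ->]] y hy; rewrite mulrDr !mulr_sumr; apply: SD; apply: Ssum => i.
    by rewrite -scalerAr => _; apply: SZ.
  by move=> i0; rewrite mulrA; apply: SF; rewrite i0 ltn_ord.
have Sdl x : S x -> S (eps 0 * x).
  by move=> /Sl; apply => a; rewrite -exprS.
(* Moving [eps k] right past one factor d costs a multiple of [eps k.-1] times a lower power of
   d. *)
have Se a k : S (eps k * eps 0 ^+ a).
  elim: a k => [|a IHa] k.
    rewrite mulr1; case: k => [|k]; first by rewrite -[eps 0]expr1.
    have [kN|Nk] := ltnP k.+1 N; last by rewrite eps_out.
    rewrite -[eps _](addrK (if k.+1 == 1%N then lam else 0)%:A) -/(eps_shift lam k.+1).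
    by apply: SD; [rewrite -[eps_shift _ _]mul1r; apply: SF|rewrite -scaleNr; apply/SZ/(Sd 0%N)].
  have [c cE] := eps_bracket k 0.
  rewrite exprS mulrA -(subrK (eps 0 * eps k) (eps k * eps 0)) cE mulrDl -mulrA.
  by apply: SD; [rewrite -scalerAl; apply: SZ|apply: Sdl].
rewrite -[u]mulr1; apply: (gen_eps SD SZ) => [k x Sx|]; last exact: (Sd 0%N).
exact: Sl.
Qed.

Local Notation zact := (act (pF := pF) (L := L) wbasisP).

Lemma zact_eps k x : zact (eps k) x = E k x.
Proof. by rewrite /zgen act_gen vsprojE. Qed.

Lemma zact_eps0X m a : (a < N)%N -> zact (eps 0 ^+ m) (w a) = if (m <= a)%N then w (a - m) else 0.
Proof.
move=> aN; rewrite -expE0_w //; elim: m => [|m IHm].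
  by rewrite expr0 act1 /lfun_exp /= id_lfunE.
by rewrite exprS act_mul IHm zact_eps /lfun_exp /= comp_lfunE.
Qed.

Definition ann (u : U) := forall x, zact u x = 0.

Section PrimitiveVectors.
Variables (M : lmodType U) (S : M -> Prop).
Hypothesis S0 : S 0.
Hypothesis SD : forall x y, S x -> S y -> S (x + y).
Hypothesis SZ : forall u x, S x -> S (u *: x).

Let SB x y : S x -> S y -> S (x - y).
Proof. by move=> Sx Sy; rewrite -scaleN1r; apply: SD => //; apply: SZ. Qed.

Let SBr x y : S (x - y) -> S y -> S x.
Proof. by move=> h Sy; rewrite -[x](subrK y); apply: SD. Qed.

Let swap k l (x : M) : exists c : F, eps k *: (eps l *: x) = eps l *: (eps k *: x) + (c *: eps (k + l).-1) *: x.
Proof.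
have [c cE] := eps_bracket k l; exists c.
by rewrite -cE !scalerA -scalerDl addrC subrK.
Qed.

Let SeZ (c : F) u (x : M) : S (u *: x) -> S ((c *: u) *: x).
Proof. by rewrite -mulr_algl -scalerA; apply: SZ. Qed.

(** A nonzero vector of M / S with character lam, phrased without forming the quotient. *)
Definition primitive lam v := ~ S v /\ forall j, (0 < j < N)%N -> S (eps_shift lam j *: v).

(** Descending induction produces v killed modulo S by all [eps j] with j > 1, a property preserved
    by [eps 1]. As [eps 1] is idempotent, either it kills v, giving weight 0, or [eps 1 *: v] has
    weight 1. *)
Lemma primitive_ex m : ~ S m -> exists lam v, (lam = 0 \/ lam = 1) /\ primitive lam v.
Proof.
move=> Sm.
have [v [Sv vP]] : exists v, ~ S v /\ forall j, (1 < j)%N -> S (eps j *: v).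
  suff /(_ N)[v [Sv vP]] : forall t, exists v, ~ S v /\
      forall j, (1 < j)%N -> (N - t <= j)%N -> S (eps j *: v).
    by exists v; split=> // j j1; apply: vP => //; rewrite subnn.
  elim=> [|t [v [Sv vP]]].
    exists m; split=> // j _; rewrite subn0 => Nj; rewrite eps_out // scale0r; exact: S0.
  (* When [eps k] does not kill v modulo S, it may be applied to v: its square is a multiple of
     [eps (k + k).-1], whose index exceeds k, so that it already acts by zero. *)
  pose k := (N - t.+1)%N; have [k1|k1] := leqP k 1.
    by exists v; split=> // j j1 _; apply: vP => //; lia.
  have [Skv|Skv] := pselect (S (eps k *: v)).
    exists v; split=> // j j1; rewrite -/k leq_eqVlt => /orP[/eqP<-//|kj].
    by apply: vP => //; lia.
  exists (eps k *: v); split=> // j j1; rewrite -/k leq_eqVlt => /orP[/eqP<-|kj].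
    rewrite scalerA; have [|c ->] := @eps_sqr k; first by rewrite ltnW.
    by apply: SeZ; apply: vP; lia.
  have [c ->] := swap j k v; apply: SD; first by apply: SZ; apply: vP => //; lia.
  by apply: SeZ; apply: vP; lia.
have shift_gt1 lam j (x : M) : (1 < j)%N -> eps_shift lam j *: x = eps j *: x.
  by move=> j1; rewrite /eps_shift gtn_eqF // scale0r addr0.
have prim lam (x : M) : ~ S x -> S (eps_shift lam 1 *: x) -> (forall j, (1 < j)%N -> S (eps j *: x)) ->
    primitive lam x.
  move=> Sx Sx1 xP; split=> // j /andP[]; rewrite leq_eqVlt => /orP[/eqP<-//|j1 _].
  by rewrite shift_gt1 //; apply: xP.
have e1P j : (1 < j)%N -> S (eps j *: (eps 1 *: v)).
  move=> j1; have [c ->] := swap j 1 v; apply: SD; first by apply/SZ/vP.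
  by rewrite addn1; apply: SeZ; apply: vP.
have [Sev|Sev] := pselect (S (eps 1 *: v)).
  exists 0, v; split; first by left.
  by apply: prim => //; rewrite /eps_shift eqxx scale0r addr0.
exists 1, (eps 1 *: v); split; first by right.
apply: prim => //; rewrite /eps_shift eqxx !scale1r scalerA mulrDl mul1r eps1_sqr.
by rewrite addxx2 // scale0r.
Qed.

(** The same coefficients describe u on v modulo S and on every vector of W(1;n) with the same
    character; information is transported from W(1;n) to M through them. *)
Let decomp_mod lam v u : primitive lam v -> exists c : 'I_N -> F,
  S (u *: v - (\sum_a c a *: eps 0 ^+ a) *: v) /\
  forall r, (forall j, (0 < j < N)%N -> zact (eps_shift lam j) r = 0) ->
    zact u r = \sum_a c a *: zact (eps 0 ^+ a) r.
Proof.
move=> [_ vP]; have [c [f uE]] := eps_decomp lam u; exists c; split=> [|r rP].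
  rewrite {1}uE scalerDl addrAC subrr add0r scaler_suml.
  apply: big_ind => // j j0; rewrite -scalerA; apply/SZ/vP; rewrite j0 ltn_ord //.
rewrite uE actD [X in _ + X](_ : _ = 0) ?addr0.
  by rewrite act_sum; apply: eq_bigr => a _; rewrite actZ.
rewrite act_sum big1 // => j j0.
by rewrite act_mul rP ?j0 ?ltn_ord // linear0.
Qed.

(** The vectors d^a w_(2^n - 1) = w_(2^n - 1 - a) are independent, so every coefficient vanishes. *)
Let primitive0_ann v u : primitive 0 v -> ann u -> S (u *: v).
Proof.
move=> vP uA; have [c [Sc cP]] := decomp_mod u vP; apply: SBr Sc _.
have topN : (N.-1 < N)%N by rewrite ltn_predL.
have h : \sum_(a < N) c a *: w (N.-1 - a)%N = 0.
  rewrite -[RHS](uA (w N.-1)) cP => [|j /andP[j0 jN]].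
    apply: eq_bigr => a _; rewrite zact_eps0X //.
    by rewrite (_ : (a <= N.-1)%N) // -ltnS prednK.
  rewrite /eps_shift actD actZ if_same scale0r addr0 zact_eps.
  by rewrite E_w_out //; lia.
pose c' k := if insub k is Some a then c a else 0.
have c'E (a : 'I_N) : c' a = c a by rewrite /c' valK.
have cz a : (a < N)%N -> c' a = 0.
  move=> aN; apply: (w_indep_inj n_gt0 (f := fun a => N.-1 - a)%N) aN => [i _|i j iN jN|].
  - exact: leq_ltn_trans (leq_subr _ _) topN.
  - lia.
  - by rewrite -[RHS]h; apply: eq_bigr => i _; rewrite c'E.
rewrite big1 ?scale0r // => a _; by rewrite -c'E cz // scale0r.
Qed.

Let primitive1_top v u : primitive 1 v -> zact u (w N.-2) = 0 ->
  exists c : F, S (u *: v - (c *: eps 0 ^+ N.-1) *: v).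
Proof.
move=> vP ur0; have [c [Sc cP]] := decomp_mod u vP.
have rN : (N.-2 < N)%N by lia.
have N2 : N.-2.+1 = N.-1 by lia.
pose c' k := if insub k is Some a then c a else 0.
have c'E (a : 'I_N) : c' a = c a by rewrite /c' valK.
have h : \sum_(a < N.-1) c' a *: w (N.-2 - a)%N = 0.
  rewrite -[RHS]ur0 cP => [|j /andP[j0 jN]].
    have sum_recr m (g : nat -> V) : m = N.-1.+1 -> \sum_(a < m) g a = \sum_(a < N.-1) g a + g N.-1.
      by move->; rewrite big_ord_recr.
    under [RHS]eq_bigr => a _ do rewrite zact_eps0X // -c'E.
    rewrite (sum_recr _ (fun a => c' a *: (if (a <= N.-2)%N then w (N.-2 - a) else 0))) ?prednK //.
    rewrite leqNgt -N2 ltnSn scaler0 addr0.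
    by apply: eq_bigr => a _; rewrite -ltnS ltn_ord.
  rewrite /eps_shift actD actZ act1 zact_eps.
  case: j j0 jN => [|[|j]] // _ jN; last by rewrite E_w_out ?scale0r ?addr0 //; lia.
  rewrite E_w // add1n N2 /bcoef /= mul1n bin1 -scalerDl.
  (* x d acts on w_(2^n - 2) by the odd number 2^n - 1, so this vector has weight 1. *)
  have -> : (1 + N.-2)%:R + 1 = 0 :> F.
    by rewrite add1n N2 natr1 prednK // natr_dvd2 // dvdn_exp.
  by rewrite scale0r.
have cz a : (a < N.-1)%N -> c' a = 0.
  move=> aN; apply: (w_indep_inj n_gt0 (f := fun a => N.-2 - a)%N) aN => [i _|i j iN jN|//].
    exact: leq_ltn_trans (leq_subr _ _) rN.
  lia.
exists (c' N.-1); move: Sc; congr (S (_ - _ *: _)).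
have topN : (N.-1 < N)%N by rewrite ltn_predL.
rewrite (bigD1 (Ordinal topN)) //= -c'E /= big1 ?addr0 // => a; rewrite -val_eqE /= => aN.
by rewrite -c'E cz ?scale0r //; have := ltn_ord a; lia.
Qed.

(* In weight 0 compare with w_(2^n - 1), a primitive vector of W(1;n).  In weight
   1 the vector w_(2^n - 2) determines u only up to d^(2^n - 1), so one may
   have to pass to d^(2^n - 1) v, which is again primitive. *)
Lemma ann_radical_vector m : ~ S m -> exists v, ~ S v /\ forall u, ann u -> S (u *: v).
Proof.
move=> /primitive_ex[lam [v [lamE vP]]].
have done0 x : primitive 0 x -> exists v, ~ S v /\ forall u, ann u -> S (u *: v).
  by move=> xP; exists x; split=> [|u]; [case: xP|exact: primitive0_ann].
case: lamE vP => -> vP; first exact: done0 vP.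
have done1 x : primitive 1 x -> S (eps 0 ^+ N.-1 *: x) -> exists v, ~ S v /\ forall u, ann u -> S (u *: v).
  move=> xP xtop; exists x; split=> [|u uA]; first by case: xP.
  have [c Sc] := primitive1_top xP (uA _).
  by apply: SBr Sc _; apply: SeZ.
have [Stop|Stop] := pselect (S (eps 0 ^+ N.-1 *: v)); first exact: done1 vP Stop.
set t := eps 0 ^+ N.-1 *: v in Stop.
have rtop : zact (eps 0 ^+ N.-1) (w N.-2) = 0.
  have rN : (N.-2 < N)%N by lia.
  by rewrite zact_eps0X //; case: ifP => //; lia.
(* The product of [eps j] with d^(2^n - 1) kills w_(2^n - 2), hence acts on v, modulo S, as a
   multiple of d^(2^n - 1): t is an eigenvector of every [eps j]. *)
have /choice[c cP] j : exists c : F, S (eps j *: t - c%:A *: t).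
  have [|c Sc] := @primitive1_top v (eps j * eps 0 ^+ N.-1) vP.
    by rewrite act_mul rtop linear0.
  by exists c; move: Sc; rewrite /t !scalerA mulr_algl.
have ttop : eps 0 ^+ N.-1 *: t = 0.
  by rewrite /t scalerA -exprD eps0_nilp ?scale0r //; lia.
clearbody t.
have St0 (k : F) : S (k%:A *: t) -> k = 0.
  move=> Sk; apply/eqP/negPn/negP => k0; apply: Stop.
  have -> : t = (k^-1)%:A *: (k%:A *: t).
    by rewrite scalerA mulr_algl scalerA mulVf // !scale1r.
  exact: SZ.
have cc j (k : F) : S (eps j *: (k%:A *: t) - (k * c j)%:A *: t).
  have -> : eps j *: (k%:A *: t) - (k * c j)%:A *: t = k%:A *: (eps j *: t - (c j)%:A *: t).
    rewrite scalerBr !scalerA; congr (_ *: t - _ *: t); first by rewrite mulr_algl mulr_algr.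
    by rewrite mulr_algl scalerA.
  exact: SZ.
have csqr j : S (eps j *: (eps j *: t) - (c j * c j)%:A *: t).
  rewrite -(subrKA (eps j *: ((c j)%:A *: t))) -scalerBr.
  by apply: SD; [apply: SZ|apply: cc].
(* The square of [eps j] is a multiple of [eps (j + j).-1], of larger index, so descending induction
   gives [c j] squared equal to 0. *)
have c_gt1 j : (1 < j)%N -> c j = 0.
  suff h : forall s i, (1 < i)%N -> (N - s <= i)%N -> c i = 0.
    by move=> j1; apply: (h N) => //; rewrite subnn.
  elim=> [|s IHs] i i1 si.
    apply: St0; have := cP i; rewrite eps_out; last by rewrite -[N]subn0.
    by rewrite scale0r sub0r => /(SZ (-1)); rewrite scaleN1r opprK.
  have := csqr i; rewrite scalerA; have [|b ->] := @eps_sqr i; first exact: ltnW.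
  move=> Sb; have : S ((c i * c i)%:A *: t).
    have -> : (c i * c i)%:A *: t = (b *: eps (i + i).-1) *: t - ((b *: eps (i + i).-1) *: t - (c i * c i)%:A *: t).
      by rewrite opprB addrC subrK.
    apply: SB => //; apply: SeZ; have := cP (i + i).-1; rewrite (IHs (i + i).-1); try lia.
    by rewrite !scale0r subr0.
  by move=> /St0/eqP; rewrite mulf_eq0 orbb => /eqP.
have c1 : c 1 = 0 \/ c 1 = 1.
  have := csqr 1; rewrite scalerA eps1_sqr => h.
  have : S ((c 1 * c 1 - c 1)%:A *: t).
    have -> : (c 1 * c 1 - c 1)%:A *: t = (eps 1 *: t - (c 1)%:A *: t) - (eps 1 *: t - (c 1 * c 1)%:A *: t).
      by rewrite opprB [RHS]addrC addrA subrK !scalerBl.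
    exact: SB.
  move=> /St0/eqP; rewrite -{3}[c 1%N]mulr1 -mulrBr mulf_eq0 subr_eq0.
  by case/orP => /eqP; [left|right].
have tP : primitive (c 1%N) t.
  split=> // j /andP[j0 _]; rewrite /eps_shift scalerDl.
  have -> : (if j == 1%N then c 1%N else 0) = c j.
    by case: j j0 => [|[|j]] //= _; rewrite c_gt1.
  have -> : (c j)%:A = - (c j)%:A :> U by apply/eqP; rewrite -addr_eq0 addxx2.
  by rewrite scaleNr; apply: cP.
(* If t again has weight 1, the uncontrolled power d^(2^n - 1) is now harmless, since it kills t. *)
case: c1 => c1; rewrite c1 in tP; first exact: done0 tP.
by apply: done1 tP _; rewrite ttop.
Qed.

End PrimitiveVectors.

End ZassenhausEnveloping.

(** * The radical, read off from W(1;n) *)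

Section ZassenhausRadical.
Variables (F : fieldType) (pF : 2%N \in [pchar F]) (n : nat).
Hypothesis n_gt0 : (0 < n)%N.
Local Notation N := (2 ^ n)%N.
Local Notation W := (witt F 2 n).
Local Notation V := (subvs_of W).
Local Notation L := (zassenhaus F 2 n).
Local Notation E := (ad_e F n).
Local Notation w := (witt_vec F n).
Local Notation U := (u_alg L pF).
Local Notation eps := (zgen pF n).
Local Notation wb := (wbasis F n).
Local Notation wbP := (wbasisP F n_gt0).
Local Notation zact := (act (pF := pF) (L := L) wbP).
Local Notation ann := (ann (pF := pF) n_gt0).

Let N_gt0 : (0 < N)%N. Proof. by rewrite expn_gt0. Qed.
Let N_gt1 : (1 < N)%N. Proof. by rewrite -{1}(expn0 2) ltn_exp2l. Qed.
Let topN : (N.-1 < N)%N. Proof. by rewrite ltn_predL. Qed.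

(* The hyperplane top = 0 is the derived algebra of W(1;n), a simple module of
   dimension 2^n - 1; the quotient of W(1;n) by it is the trivial module. *)
Definition top (x : V) : F := coord wb ord_max x.

Lemma wb_ord (i : 'I_N.-1.+1) : (i < N)%N.
Proof. by rewrite -[X in (_ < X)%N](prednK N_gt0). Qed.

Lemma wcoordE x : x = \sum_i coord wb i x *: w i.
Proof. by rewrite {1}(coordE wbP x); apply: eq_bigr => i _; rewrite wbasisE ?wb_ord. Qed.

Lemma top_w a : (a < N)%N -> top (w a) = (a == N.-1)%:R.
Proof.
move=> aN; have aN' : (a < N.-1.+1)%N by rewrite prednK.
rewrite /top -wbasisE // (coord_free (Ordinal aN')) ?(basis_free wbP) //.
Qed.

Lemma top_linear : linear (top : V -> F^o).
Proof. by move=> k x y; rewrite /top linearP. Qed.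

HB.instance Definition _ := GRing.isLinear.Build F V F^o _ (top : V -> F^o) top_linear.

(** Reaching w_(2^n - 1) would require k + a = 2^n, where the binomial coefficient is even. *)
Lemma top_E k x : top (E k x) = 0.
Proof.
have [kN|Nk] := ltnP k N; last by rewrite E_out // zero_lfunE linear0.
rewrite (wcoordE x) !linear_sum big1 // => a _; rewrite !linearZ /=.
have aN := wb_ord a; have [Nka|kaN] := leqP N (k + a).
  by rewrite E_w_out // linear0 scaler0.
rewrite E_w // linearZ /= top_w; last by rewrite (leq_ltn_trans (leq_pred _)).
by rewrite (_ : (_ == _) = false) ?scaler0 ?mulr0 ?scaler0 //; apply/eqP; lia.
Qed.

Lemma top_act u x : top x = 0 -> top (zact u x) = 0.
Proof.
move=> x0; rewrite -[u]mulr1.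
apply: (@gen_eps _ pF n n_gt0 (fun v => top (zact v x) = 0)).
- by move=> u' v hu hv; rewrite actD linearD /= hu hv addr0.
- by move=> k v hv; rewrite actZ linearZ /= hv scaler0.
- by move=> k v _; rewrite act_mul zact_eps top_E.
- by rewrite act1.
Qed.

(** With a the largest index occurring in x, d^a sends x to a nonzero multiple of w_0, and x^(k+1) d
    sends w_0 to w_k for k < 2^n - 1. Only the last coordinate, zero for y, is out of reach. *)
Lemma act_onto_derived x y : x != 0 -> top y = 0 -> exists u, zact u x = y.
Proof.
move=> x0 y0.
have [a xa amax] : exists2 a : 'I_N.-1.+1, coord wb a x != 0 &
    forall b : 'I_N.-1.+1, (a < b)%N -> coord wb b x = 0.
  have [a0 xa0] : exists a, coord wb a x != 0.
    apply/existsP; apply: contra_neqT x0 => /existsPn h.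
    by rewrite (wcoordE x) big1 // => i _; move/negPn/eqP: (h i) => ->; rewrite scale0r.
  case: (@arg_maxnP _ a0 (fun a => coord wb a x != 0) val xa0) => a xa amax.
  exists a => // b ab; apply/eqP/negPn/negP => /amax /=.
  by rewrite leqNgt ab.
have w0E : zact (eps 0 ^+ a) x = coord wb a x *: w 0.
  rewrite {1}(wcoordE x) linear_sum (bigD1 a) //= linearZ /= zact_eps0X ?wb_ord // leqnn subnn.
  rewrite big1 ?addr0 // => b; rewrite -val_eqE /= => ba; rewrite linearZ /= zact_eps0X ?wb_ord //.
  case: leqP => [ab|_]; last by rewrite scaler0.
  by rewrite amax ?scale0r // ltn_neqAle eq_sym ba.
exists (\sum_(k : 'I_N.-1.+1) (coord wb k y / coord wb a x) *: (eps k.+1 * eps 0 ^+ a)).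
rewrite act_sum [RHS](wcoordE y); apply: eq_bigr => k _.
rewrite actZ act_mul w0E linearZ /= zact_eps scalerA mulfVK //.
have [kN|kN] := ltnP k.+1 N.
  by rewrite E_w // addn0 /bcoef /= mul1n addn0 binn scale1r.
have -> : k = ord_max by apply/val_inj => /=; have := wb_ord k; lia.
by rewrite -/(top y) y0 !scale0r.
Qed.

Lemma act_onto x y : top x != 0 -> exists u, zact u x = y.
Proof.
move=> x0; have [||u uE] := @act_onto_derived x (y - (top y / top x) *: x).
- by apply: contra_neq x0 => ->; rewrite linear0.
- rewrite linearB linearZ /= -[X in _ - X]/(top y / top x * top x) mulfVK //.
  exact: subrr.
by exists (u + (top y / top x)%:A); rewrite actD actZ act1 uE subrK.
Qed.

Definition rad (u : U) :=
  (forall x, top (zact u x) = 0) /\ (forall x, top x = 0 -> zact u x = 0).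

Let act0 x : zact 0 x = 0.
Proof. by rewrite -(scale0r (1 : U)) actZ scale0r. Qed.

Lemma ann_rad u : ann u -> rad u.
Proof. by move=> uA; split=> x *; rewrite uA ?linear0. Qed.

Lemma radD u v : rad u -> rad v -> rad (u + v).
Proof.
move=> [u1 u2] [v1 v2]; split=> x *; rewrite actD; first by rewrite linearD /= u1 v1 addr0.
by rewrite u2 // v2 // addr0.
Qed.

Lemma rad_mull u v : rad v -> rad (u * v).
Proof.
move=> [v1 v2]; split=> x *; rewrite act_mul; first by rewrite top_act.
by rewrite v2 // linear0.
Qed.

Lemma rad_mulr u v : rad u -> rad (u * v).
Proof.
move=> [u1 u2]; split=> x *; rewrite act_mul //.
by rewrite u2 // top_act.
Qed.

Lemma rad_rad_ann u v : rad u -> rad v -> ann (u * v).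
Proof. by move=> [u1 u2] [v1 v2] x; rewrite act_mul u2. Qed.

Lemma radical_vector (M : lmodType U) (S : M -> Prop) : S 0 ->
  (forall x y, S x -> S y -> S (x + y)) -> (forall u x, S x -> S (u *: x)) ->
  forall m, ~ S m -> exists v, ~ S v /\ forall r, rad r -> S (r *: v).
Proof.
move=> S0 SD SZ m /(ann_radical_vector n_gt0 S0 SD SZ)[v [Sv vP]].
have [rv|/existsNP[r /not_implyP[rR Srv]]] := pselect (forall r, rad r -> S (r *: v)).
  by exists v.
exists (r *: v); split=> // r' r'R; rewrite scalerA; apply: vP.
exact: rad_rad_ann.
Qed.

Lemma rad_nilp_ex : exists K, forall s : seq U, size s = K -> (forall u, u \in s -> rad u) ->
  \prod_(u <- s) u = 0.
Proof.
pose d := (n + N.-1)%N.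
exists #|{: d.-tuple bool}|.
apply: (@rad_nilpotent _ U rad rad_mulr _
  (fun b : d.-tuple bool => mon (pbw_gen pF L (zbasis F n) (fun=> 0)) (mask b (iota 0 d)))).
  exact: (pbw_span (fun=> 0) (zbasisP pF n_gt0) (zassenhaus_restricted pF n_gt0)).
move=> S S0 SD SZ m Sm.
exact: (@radical_vector U^o S S0 SD SZ m Sm).
Qed.

(** If b x has nonzero top coordinate, it generates W(1;n), so e annihilates W(1;n) and is
    nilpotent, contrary to e being a nonzero idempotent. If x lies in the derived algebra and b x is
    nonzero, some u takes b x to e x, and e u b x = e x is nonzero because b e x = b x. *)
Lemma rad_local_test e b : e * e = e -> e != 0 -> b * e = b ->
  (forall u, ann (e * u * b)) -> rad b.
Proof.
move=> ee e0 be uA; split=> x.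
  apply/eqP/negPn/negP => bx; case/eqP: e0.
  have [K RK] := rad_nilp_ex.
  have eann : ann e.
    move=> y; have [u <-] := act_onto y bx.
    by have := uA u x; rewrite !act_mul.
  have <- : \prod_(u <- nseq K e) u * e = e.
    elim: K {RK} => [|K IHK] /=; first by rewrite big_nil mul1r.
    by rewrite big_cons -mulrA IHK.
  by rewrite RK ?size_nseq ?mul0r // => u /nseqP[-> _]; apply: ann_rad.
move=> x0; apply/eqP/negPn/negP => bx.
have bex : zact b (zact e x) = zact b x by rewrite -act_mul be.
have ex : zact e x != 0 by apply: contra_neq bx => ex0; rewrite -bex ex0 linear0.
have [u uE] := act_onto_derived bx (top_act e x0).
have := uA u x; rewrite !act_mul uE -act_mul ee => /eqP.
by rewrite (negPf ex).
Qed.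

End ZassenhausRadical.

(** * Idempotents of tori *)

(** The basis is dual to a maximal independent set of weights; its values 0 and 1 under them are
    fixed by Frobenius. *)
Lemma toral_basis (F : closedFieldType) (p : nat) (pF : p \in [pchar F]) (V : vectType F)
    (t : {vspace 'End(V)}) : torus p t ->
  exists T : (\dim t).-tuple 'End(V),
    basis_of t T /\ forall i : 'I_(\dim t), p_map p T`_i = T`_i.
Proof.
move=> tP; have [N [phi [phi0 phiP]]] := torus_weights pF tP.
have [[_ tp] _ _] := tP.
pose d := \dim t; pose b := vbasis t.
have bt (j : 'I_d) : b`_j \in t by rewrite vbasis_mem // mem_nth // size_tuple.
pose A : 'M[F]_(N, d) := \matrix_(i, j) phi b`_j 0 i.
have phi_sum (v : 'I_d -> F) i : phi (\sum_j v j *: b`_j) 0 i = \sum_j A i j * v j.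
  rewrite linear_sum summxE; apply: eq_bigr => j _.
  by rewrite linearZ !mxE mulrC.
have Afull : row_full A.
  rewrite /row_full -mxrank_tr -/(row_free _) -kermx_eq0; apply/rowV0P => v.
  move=> /sub_kermxP/rowP vA; have v0 : \sum_j v 0 j *: b`_j = 0.
    apply: phi0; first by apply: rpred_sum => j _; rewrite rpredZ.
    apply/rowP => i; rewrite phi_sum -[RHS](vA i) [RHS]mxE.
    by apply: eq_bigr => j _; rewrite [in RHS]mxE mulrC.
  by apply/rowP => j; rewrite mxE; move/freeP: (basis_free (vbasisP t)) => ->.
pose k := fullrankfun Afull; pose B := rowsub k A.
have Bu : B \in unitmx := fullrowsub_unit Afull.
pose c l := \sum_j invmx B j l *: b`_j.
have ct l : c l \in t by apply: rpred_sum => j _; rewrite rpredZ.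
have phic l i : phi (c l) 0 (k i) = (i == l)%:R.
  rewrite phi_sum; have := mulmxV Bu => /matrixP/(_ i l); rewrite !mxE => <-.
  by apply: eq_bigr => j _; rewrite !mxE.
have kinj x : x \in t -> (forall i, phi x 0 (k i) = 0) -> x = 0.
  move=> xt x0; rewrite (coord_vbasis xt); pose v := \col_j coord b j x.
  suff v0 : v = 0.
    by apply: big1 => j _; move/colP: v0 => /(_ j); rewrite !mxE => ->; rewrite scale0r.
  rewrite -[v](mulKmx Bu) (_ : B *m v = 0) ?mulmx0 //.
  apply/colP => i; rewrite !mxE -[RHS](x0 i) [in RHS](coord_vbasis xt) phi_sum.
  by apply: eq_bigr => j _; rewrite !mxE.
pose T := [tuple c i | i < d]; exists T.
have TE (i : 'I_d) : T`_i = c i by rewrite -tnth_nth tnth_mktuple.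
split=> [|i]; last first.
  rewrite TE; apply/eqP; rewrite -subr_eq0; apply/eqP/kinj.
    by rewrite rpredB // tp.
  move=> j; rewrite linearB /= !mxE phiP // phic -(pFrobenius_autE pF).
  by rewrite pFrobenius_aut_nat subrr.
rewrite basisEfree size_tuple leqnn andbT; apply/andP; split.
  apply/freeP => a a0 i; have : phi (\sum_j a j *: T`_j) 0 (k i) = 0.
    by rewrite a0 linear0 mxE.
  rewrite linear_sum summxE (bigD1 i) //= big1 => [|j ji].
    by rewrite linearZ mxE TE phic eqxx mulr1 addr0.
  by rewrite linearZ mxE TE phic eq_sym (negPf ji) mulr0.
by apply/span_subvP => x /(nthP 0)[i]; rewrite size_tuple => id <-; rewrite (TE (Ordinal id)).
Qed.

Section TorusIdempotents.
Variables (F : fieldType) (pF : 2%N \in [pchar F]) (V : vectType F).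
Variables (N : nat) (e : N.+1.-tuple V).
Hypothesis eb : basis_of {:V} e.
Variables (L t : {vspace 'End(V)}) (m : nat) (T : m.-tuple 'End(V)).
Hypothesis LP : restricted_subalgebra 2 L.
Hypothesis tL : (t <= L)%VS.
Hypothesis tC : forall x y, x \in t -> y \in t -> lie_br x y = 0.
Hypothesis Tb : basis_of t T.
Hypothesis Tp : forall i : 'I_m, p_map 2 T`_i = T`_i.
Local Notation U := (u_alg L pF).

Let k : nat := \dim (L :\: t).
(** The torus basis stands last, so that in ordered monomials its elements are adjacent to an
    idempotent multiplied on the right. *)
Let X : (k + m)%N.-tuple 'End(V) := [tuple of vbasis (L :\: t) ++ T].

Let Xb : basis_of L X.
Proof.
have -> : L = (L :\: t + t)%VS by rewrite addv_diff; apply/esym/addv_idPl.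
rewrite /= cat_basis // ?vbasisP //.
by rewrite directv_addE /= !directv_trivial /= capv_diff.
Qed.

Lemma dim_complement : (\dim (L :\: t) + m)%N = \dim L.
Proof. by rewrite (size_basis Xb). Qed.

Definition tor i : U := u_gen pF (vsproj L T`_i).

Let XT i : X`_(k + i)%N = T`_i.
Proof. by rewrite /= nth_cat size_tuple ltnNge leq_addr /= addKn. Qed.

Let Tt i : T`_i \in t.
Proof.
have [im|mi] := ltnP i (size T); last by rewrite nth_default ?mem0v.
by apply: (basis_mem Tb); apply: mem_nth.
Qed.

Let TL i : vsval (vsproj L T`_i) = T`_i.
Proof. by rewrite vsprojK // (subvP tL). Qed.

Lemma torC i j : tor i * tor j = tor j * tor i.
Proof.
apply/eqP; rewrite -subr_eq0 -(@u_genBr _ _ pF _ _ _ _ 0) ?linear0; last first.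
  by rewrite !TL tC.
by rewrite -(scale0r (0 : subvs_of L)) u_genZr; apply/eqP; exact: scale0r.
Qed.

Lemma tor_sqr i : (i < m)%N -> tor i * tor i = tor i.
Proof.
by move=> im; rewrite -expr2; apply/esym/u_genPr; rewrite TL (Tp (Ordinal im)).
Qed.

(* For a weight c : 'I_m -> F_2, the elements tor i + (1 - c i) are commuting
   idempotents whose product is the primitive idempotent of u(t) of weight c. *)
Definition tfac (c : nat -> bool) i : U := tor i + (~~ c i)%:R.
Definition idem (c : nat -> bool) : U := \prod_(i <- iota 0 m) tfac c i.

Lemma tor_facC c i j : tor i * tfac c j = tfac c j * tor i.
Proof. by rewrite /tfac mulrDr mulrDl torC mulr_natl mulr_natr. Qed.

Lemma tor_fac c i : (i < m)%N -> tor i * tfac c i = (c i)%:R * tfac c i.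
Proof.
move=> im; rewrite /tfac mulrDr tor_sqr //; case: (c i); rewrite ?mulr0 ?mul1r ?addr0 //.
by rewrite mulr1 addxx2 // mul0r.
Qed.

Lemma tor_idem c i : (i < m)%N -> tor i * idem c = (c i)%:R * idem c.
Proof.
move=> im; rewrite /idem; have : i \in iota 0 m by rewrite mem_iota.
elim: (iota 0 m) => // j s IHs; rewrite inE !big_cons => /orP[/eqP<-|/IHs h].
  by rewrite mulrA tor_fac // mulrA.
by rewrite mulrA tor_facC -mulrA h !mulrA mulr_natl mulr_natr.
Qed.

Lemma fac_idem c i : (i < m)%N -> tfac c i * idem c = idem c.
Proof.
by move=> im; rewrite /tfac mulrDl tor_idem // -mulrDl -natrD; case: (c i); rewrite /= ?addn0 mul1r.
Qed.

Lemma idemM c : idem c * idem c = idem c.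
Proof.
rewrite {1}/idem; have : {subset iota 0 m <= gtn m} by move=> i; rewrite mem_iota.
elim: (iota 0 m) => [|i s IHs] h; first by rewrite big_nil mul1r.
rewrite big_cons -mulrA IHs => [|j js]; last by apply: h; rewrite inE js orbT.
by apply: fac_idem; apply: h; rewrite inE eqxx.
Qed.

(** The idempotents of all weights add up to 1: each toral generator splits 1 as [tor i] plus
    [tor i + 1]. *)
Lemma idem_split (R : U -> Prop) : (forall u v, R u -> R v -> R (u + v)) ->
  forall u, (forall c, R (u * idem c)) -> R u.
Proof.
move=> RD u; rewrite /idem; elim: (iota 0 m) (iota_uniq 0 m) u => [|i s IHs] us u h.
  by have := h (fun=> true); rewrite big_nil mulr1.
move: us => /= /andP[is_ us].
have R' b : R (u * (tor i + (~~ b)%:R)).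
  apply: IHs => // c; pose c' j := if j == i then b else c j.
  have := h c'; rewrite big_cons mulrA {1}/tfac /c' eqxx; congr (R (_ * _)).
  apply: eq_big_seq => j js; rewrite /tfac (_ : (j == i) = false) //.
  by apply: contraNF is_ => /eqP <-.
have -> : u = u * (tor i + (~~ true)%:R) + u * (tor i + (~~ false)%:R).
  by rewrite -mulrDr /= addr0 addrA addxx2 // add0r mulr1.
exact: RD.
Qed.

(** Two PBW bases are used. With shifts c the torus generators become [tor i + c i] and kill
    [idem c], so the monomials without them, times [idem c], span the left ideal. With the
    complementary shifts their full product is [idem c], so the same products are members of a basis
    of u(L) and independent. *)
Let shift (c : nat -> bool) i : F := if (i < k)%N then 0 else (c (i - k)%N)%:R.
Let gen c i := pbw_gen pF L X (shift c) i.

Let gen_tor c i : gen c (k + i)%N = tor i + (c i)%:R.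
Proof.
by rewrite /gen /pbw_gen XT /shift ltnNge leq_addr /= addKn; case: (c i); rewrite ?scale1r ?scale0r.
Qed.

Let gen_lt c c' i : (i < k)%N -> gen c i = gen c' i.
Proof. by move=> ik; rewrite /gen /pbw_gen /shift ik. Qed.

Let y i := gen (fun=> false) i.

Let mon_y c b : mon (gen c) (mask b (iota 0 k)) = mon y (mask b (iota 0 k)).
Proof.
by apply: eq_big_seq => i /mem_mask; rewrite mem_iota /= add0n => /gen_lt; apply.
Qed.

Let idemE c : mon (gen (fun i => ~~ c i)) (iota k m) = idem c.
Proof.
rewrite /mon /idem -{1}[k]addn0 iotaDl big_map; apply: eq_bigr => i _.
exact: gen_tor.
Qed.

Let idem_span c u : exists f : k.-tuple bool -> F,
  u * idem c = \sum_b f b *: (mon y (mask b (iota 0 k)) * idem c).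
Proof.
have [f ->] := pbw_span (shift c) Xb LP u.
rewrite mulr_suml; apply: lspan_fin; apply: lspan_sum => b _.
rewrite -scalerAl; apply: lspanZ; rewrite iotaD.
have sb : size (take k b) = size (iota 0 k) by rewrite size_take size_tuple size_iota; case: ltnP => //; lia.
rewrite -(cat_take_drop k b) mask_cat // mon_cat -/(gen c) mon_y -mulrA.
have [->|b0] : mon (gen c) (mask (drop k b) (iota k m)) * idem c = idem c \/
    mon (gen c) (mask (drop k b) (iota k m)) * idem c = 0.
- have : {subset mask (drop k b) (iota k m) <= iota k m} by move=> i; apply: mem_mask.
  elim: (mask (drop k b) _) => [|i s IHs] h; first by left; rewrite /mon big_nil mul1r.
  rewrite mon_cons -mulrA.
  have [|->|->] := IHs; [by move=> j js; apply: h; rewrite inE js orbT| |by right; rewrite mulr0].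
  have := h i; rewrite inE eqxx mem_iota => /(_ isT)/andP[ki ikm]; right.
  rewrite -(subnKC ki) gen_tor mulrDl tor_idem ?ltn_subLR //.
  by rewrite -mulrDl addxx2 // mul0r.
- have sb' : size (take k b) == k by rewrite sb size_iota.
  by apply: lspan_gen; exists (Tuple sb').
by rewrite b0 mulr0; apply: lspan0.
Qed.

Let idem_indep c (f : k.-tuple bool -> F) :
  \sum_b f b *: (mon y (mask b (iota 0 k)) * idem c) = 0 -> forall b, f b = 0.
Proof.
move=> f0 b0; pose all1 : m.-tuple bool := [tuple of nseq m true].
pose g (b : (k + m)%N.-tuple bool) : F :=
  if drop k b == nseq m true then f (insubd b0 (take k b)) else 0.
have := @pbw_independent F pF V L N e eb _ X (shift (fun i => ~~ c i)) Xb g.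
have h1 (b : k.-tuple bool) : drop k (b ++ nseq m true) = nseq m true.
  by rewrite drop_size_cat ?size_tuple.
have h2 (b : k.-tuple bool) : take k (b ++ nseq m true) = b.
  by rewrite take_size_cat ?size_tuple.
move=> /(_ _ [tuple of b0 ++ all1]); rewrite /g /= h1 eqxx h2 valKd; apply.
rewrite (bigID (fun b : (k + m)%N.-tuple bool => drop k b == nseq m true)) /=.
rewrite [X in _ + X]big1 ?addr0 => [|b /negPf bd]; last by rewrite bd scale0r.
rewrite -[RHS]f0 (reindex_onto (fun b : k.-tuple bool => [tuple of b ++ all1])
  (fun b => insubd b0 (take k b))) /=; last first.
  move=> b /eqP bd; apply: val_inj; rewrite /= insubdK ?cat_take_drop //; last first.
    by rewrite unfold_in /= size_take size_tuple; case: ltnP => //; lia.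
  by rewrite -[in RHS](cat_take_drop k b) bd.
apply: eq_big => [b|b _]; first by rewrite h1 eqxx h2 valKd eqxx.
rewrite h1 eqxx h2 valKd iotaD mask_cat ?size_tuple ?size_iota // add0n.
rewrite mask_true ?size_iota // mon_cat -/(gen (fun i => ~~ c i)) mon_y.
by rewrite idemE.
Qed.

Lemma lideal_idem_dim c : has_dim (lideal (idem c)) (2 ^ (\dim L - m))%N.
Proof.
have := @has_dim_fin F U (lideal (idem c)) _
  (fun b : k.-tuple bool => lideal_of (idemM c) (mon y (mask b (iota 0 k)))).
rewrite card_tuple card_bool -dim_complement addnK; apply.
  move=> x; have [f fE] := idem_span c (lval x); exists f; apply: lval_inj.
  rewrite linear_sum /= -[LHS]lidealE fE; apply: eq_bigr => b _.
  exact/esym/mulr_algl.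
move=> f f0; apply: (@idem_indep c f); have := congr1 (@lval U (idem c)) f0.
rewrite linear_sum linear0 => h; rewrite -[RHS]h; apply: eq_bigr => b _.
by rewrite -[RHS]/((f b)%:A * (mon y (mask b (iota 0 k)) * idem c)) mulr_algl.
Qed.

Lemma lideal_idem_neq0 c : exists x : lideal (idem c), x != 0.
Proof. by apply: has_dim_neq0 (lideal_idem_dim c); rewrite expn_gt0. Qed.

Lemma idem_neq0 c : idem c != 0.
Proof.
have [x x0] := lideal_idem_neq0 c; apply: contra_neq x0 => c0.
apply: lval_inj; transitivity (lval x * 0); last by rewrite mulr0.
by rewrite -[LHS]lidealE; congr (_ * _).
Qed.

End TorusIdempotents.

(** * Induced modules as left ideals *)

Section InducedTorusModule.
Variables (F : closedFieldType) (pF : 2%N \in [pchar F]) (V : vectType F).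
Variables (L t : {vspace 'End(V)}) (tP : torus 2 t) (tL : (t <= L)%VS) (mu : torus_dual 2 t).
Variables (m : nat) (T : m.-tuple 'End(V)).
Hypothesis Tb : basis_of t T.
Hypothesis Tp : forall i : 'I_m, p_map 2 T`_i = T`_i.
Local Notation U := (u_alg L pF).
Local Notation M := (torus_module pF tP mu).
Local Notation phi := (u_incl pF tL).
Local Notation chi := (torus_char pF tP mu).

Definition torus_weight i := nat_of_ord (mu T`_i) == 1%N.
Local Notation c := torus_weight.
Local Notation eps := (idem pF L T c).

Let Tt i : T`_i \in t.
Proof.
have [im|mi] := ltnP i (size T); last by rewrite nth_default ?mem0v.
by apply: (basis_mem Tb); apply: mem_nth.
Qed.

Let chiT i : (i < m)%N -> chi (u_gen pF (vsproj t T`_i)) = (c i)%:R.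
Proof.
move=> im; rewrite torus_charE ?vsprojK // ?(Tp (Ordinal im)) // /torus_weight.
by case: (mu T`_i) => -[|[|k]] //.
Qed.

Let phi_gen x : phi (u_gen pF x) = u_gen pF (vsproj L (vsval x)).
Proof. by rewrite /u_incl; case: u_incl_subproof => *; exact: u_liftE. Qed.

Lemma incl_idem s : phi s * eps = chi s *: eps.
Proof.
have tC x y : x \in t -> y \in t -> lie_br x y = 0 by case: tP => _ h _; apply: h.
have geneps x : phi (u_gen pF x) * eps = chi (u_gen pF x) *: eps.
  rewrite (u_gen_coord pF _ Tb) !linear_sum mulr_suml scaler_suml /=.
  apply: eq_bigr => i _; rewrite !linearZ /= -scalerAl phi_gen vsprojK //.
  rewrite chiT // -[u_gen _ _]/(tor pF L T i) (tor_idem pF tL tC Tb Tp) // mulr_natl.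
  by rewrite -scaler_nat scalerA.
rewrite -[s]mulr1.
apply: (@u_alg_closed _ _ pF _ t (fun s => phi s * eps = chi s *: eps)).
- by move=> u v hu hv; rewrite !rmorphD /= mulrDl hu hv scalerDl.
- by move=> k u hu; rewrite !linearZ /= -scalerAl hu scalerA.
- move=> x u hu; rewrite !rmorphM /= -mulrA hu -scalerAr geneps scalerA; congr (_ *: _).
  exact: mulrC.
- by rewrite !rmorph1 mul1r scale1r.
Qed.

Let epsM : eps * eps = eps.
Proof. by apply: idemM; [exact: tL|by case: tP|exact: Tb|exact: Tp]. Qed.

Fixpoint ind_eval (a : ind_term U M) : lideal eps :=
  match a with
  | ITens r x => lideal_of epsM ((x : F) *: r)
  | IAdd a b => ind_eval a + ind_eval b
  | IOpp a => - ind_eval a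
  | IZero => 0
  end.

Lemma ind_eval_cong a b : ind_cong phi a b -> ind_eval a = ind_eval b.
Proof.
elim=> {a b} //=.
- by move=> b a c _ -> _ ->.
- by move=> a a' b b' _ -> _ ->.
- by move=> a a' _ ->.
- by move=> a b c; rewrite addrA.
- by move=> a b; rewrite addrC.
- by move=> a; rewrite add0r.
- by move=> a; rewrite addNr.
- move=> r r' x; apply: lval_inj.
  rewrite -[RHS]/(((x : F) *: r) * eps + ((x : F) *: r') * eps) lideal_ofE.
  by rewrite scalerDr mulrDl.
- move=> r x x'; apply: lval_inj.
  rewrite -[RHS]/(((x : F) *: r) * eps + ((x' : F) *: r) * eps) lideal_ofE.
  by rewrite -mulrDl -scalerDl.
- move=> r s x; apply: lval_inj; rewrite !lideal_ofE.
  rewrite -scalerAl -mulrA incl_idem -scalerAr scalerA -scalerAl; congr (_ *: _).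
  exact: mulrC.
Qed.

(* F(mu) becomes the line spanned by the idempotent of weight mu. *)
Definition ind_iso (u : ind_torus pF tP mu tL) : lideal eps := ind_eval (ind_repr u).

Lemma ind_isoE a : ind_iso (ind_pi phi a) = ind_eval a.
Proof. exact/ind_eval_cong/ind_reprP. Qed.

Lemma ind_iso_linear : linear ind_iso.
Proof.
move=> k; elim/ind_ind=> a; elim/ind_ind=> b.
have isoD u v : ind_iso (u + v) = ind_iso u + ind_iso v.
  elim/ind_ind: u => a'; elim/ind_ind: v => b'.
  have -> : ind_pi phi a' + ind_pi phi b' = ind_pi phi (IAdd a' b') by rewrite ind_piD.
  by rewrite !ind_isoE.
rewrite isoD; congr (_ + _); rewrite -[k *: _]/(ind_scale k _) ind_scaleE ind_isoE {b}.
elim: a => [r x|a IHa b IHb|a IHa|] /=.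
- rewrite ind_isoE; apply: lval_inj.
  rewrite -[LHS]/(((x : F) *: (k * r)) * eps) -[RHS]/(k * (((x : F) *: r) * eps)).
  rewrite (scalerAr (x : F) k r); exact: (esym (mulrA k ((x : F) *: r) eps)).
- by rewrite isoD IHa IHb scalerDr.
- have isoN u : ind_iso (- u) = - ind_iso u.
    elim/ind_ind: u => a'.
    have -> : - ind_pi phi a' = ind_pi phi (IOpp a') by rewrite ind_piN.
    by rewrite !ind_isoE.
  by rewrite isoN IHa scalerN.
- by rewrite -[0]/(ind_pi phi (@IZero _ U M)) ind_isoE scaler0.
Qed.

HB.instance Definition _ := GRing.isLinear.Build U (ind_torus pF tP mu tL) (lideal eps) _
  ind_iso ind_iso_linear.

Let one : M := (1 : F).
Local Notation tens1 r := (tens phi r one).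

Let tens0 : tens1 0 = 0.
Proof. by apply: (addrI (tens1 0)); rewrite addr0 -tensDl addr0. Qed.

Lemma ind_torus_tens (u : ind_torus pF tP mu tL) : exists r, u = tens1 r.
Proof.
elim/ind_ind: u; elim=> [r x|a [r ra] b [r' rb]|a [r ra]|].
- exists ((x : F) *: r).
  have -> : (x : F) *: r = r * phi ((x : F)%:A) by rewrite linearZ /= rmorph1 -scalerAr mulr1.
  rewrite tensZ; congr tens.
  by rewrite -[RHS]/(chi _ * 1) linearZ /= rmorph1 !mulr1 -[RHS]/(_ * 1) mulr1.
- by exists (r + r'); rewrite tensDl -ra -rb ind_piD.
- exists (- r).
  have -> : ind_pi phi (IOpp a) = - ind_pi phi a by exact: ind_piN.
  by rewrite ra; apply/eqP; rewrite eq_sym -subr_eq0 opprK -tensDl addNr tens0.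
- by exists 0; rewrite tens0.
Qed.

(** Each factor of the idempotent comes from u(t), passes through the tensor sign and acts on F(mu)
    by [c i + ~~ c i], which is 1. *)
Lemma tens1_eps r : tens1 (r * eps) = tens1 r.
Proof.
rewrite /idem; have : {subset iota 0 m <= gtn m} by move=> i; rewrite mem_iota.
elim: (iota 0 m) r => [|i s IHs] r h; first by rewrite big_nil mulr1.
rewrite big_cons mulrA IHs => [|j js]; last by apply: h; rewrite inE js orbT.
have im : (i < m)%N by apply: h; rewrite inE eqxx.
have -> : tfac pF L T c i = phi (u_gen pF (vsproj t T`_i) + (~~ c i)%:R).
  by rewrite rmorphD /= phi_gen vsprojK // rmorph_nat.
rewrite tensZ; congr tens.
rewrite -[LHS]/(chi _ * 1) mulr1 rmorphD /= chiT // rmorph_nat -natrD.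
by case: (c i).
Qed.

Lemma ind_iso_bij : bijective ind_iso.
Proof.
exists (fun x => tens1 (lval x)) => [u|x]; last first.
  rewrite ind_isoE; apply: lval_inj.
  by rewrite -[LHS]/(((1 : F) *: lval x) * eps) scale1r lidealE.
have [r ->] := ind_torus_tens u; rewrite ind_isoE.
by rewrite -[lval _]/(((1 : F) *: r) * eps) scale1r tens1_eps.
Qed.

End InducedTorusModule.

(** * The torus generated by d + x^(2^n - 1) d *)

Lemma closed_sqrt (F : closedFieldType) (a : F) : exists b, b ^+ 2 = a.
Proof.
have [b bE] := @GRing.solve_monicpoly F 2 (fun i => if i is 0%N then a else 0) isT.
by exists b; rewrite bE !big_ord_recl big_ord0 expr0 mulr1 mul0r !addr0.
Qed.

Section TorusCriterion.
Variables (F : closedFieldType) (pF : 2%N \in [pchar F]) (V : vectType F).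
Variable t : {vspace 'End(V)}.
Hypothesis tR : restricted_subalgebra 2 t.
Hypothesis tC : forall x y, x \in t -> y \in t -> lie_br x y = 0.
Hypothesis t_inj : forall x, x \in t -> p_map 2 x = 0 -> x = 0.

Let iter_mem x i : x \in t -> iter i (p_map 2) x \in t.
Proof. by move=> xt; elim: i => //= i IHi; case: tR => _; apply. Qed.

Lemma p_map_sum (s : seq nat) (c : nat -> F) (y : nat -> 'End(V)) : (forall i, y i \in t) ->
  p_map 2 (\sum_(i <- s) c i *: y i) = \sum_(i <- s) c i ^+ 2 *: p_map 2 (y i).
Proof.
move=> yt; elim: s => [|i s IHs].
  by rewrite !big_nil; apply/lfunP => v; rewrite p_map2E !zero_lfunE.
rewrite !big_cons p_map2_lin // IHs tC ?scaler0 ?addr0 //.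
by apply: rpred_sum => j _; rewrite rpredZ.
Qed.

(* A dependency between the iterates x^[2]^i can be divided by the [2]-map until
   x itself occurs in it. *)
Lemma injective_torus : torus 2 t.
Proof.
split=> // x xt; pose y i := iter i (p_map 2) x.
have yt i : y i \in t by apply: iter_mem.
have dep j : forall D (c : nat -> F), (j < D)%N -> c j != 0 -> (forall i, (i < j)%N -> c i = 0) ->
    \sum_(i < D) c i *: y i = 0 -> semisimple 2 x.
  elim: j => [|j IHj] [//|D] c jD cj ci.
    rewrite big_ord_recl => /eqP; rewrite addr_eq0 => /eqP c0; exists D.
    have xE : x = (c 0%N)^-1 *: (c 0%N *: y 0%N) by rewrite scalerA mulVf // scale1r.
    rewrite {1}xE c0 memvZ // memvN; apply: rpred_sum => i _.
    by rewrite rpredZ //; apply/memv_span/map_f; rewrite mem_iota /= add1n ltnS.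
  (* By commutativity the relation is the [2]-power of the one with square-root coefficients and
     indices lowered by one; injectivity of the [2]-map yields that relation. *)
  have /choice[r rE] i := closed_sqrt (c i).
  rewrite big_ord_recl ci // scale0r add0r => c0.
  apply: (IHj D (fun i => r i.+1)) => //.
  - by apply: contra_neq cj; rewrite -rE => ->; rewrite expr0n.
  - by move=> i ij; apply/eqP; rewrite -sqrf_eq0 rE ci.
  apply: t_inj; first by apply: rpred_sum => i _; rewrite rpredZ.
  rewrite -(big_mkord predT (fun i => r i.+1 *: y i)) p_map_sum // big_mkord -[RHS]c0.
  by apply: eq_bigr => i _; rewrite rE.
pose d := \dim t; pose Y : d.+1.-tuple 'End(V) := [tuple y i | i < d.+1].
have Yt : (<<Y>> <= t)%VS by apply/span_subvP => z /mapP[i _ ->].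
have : ~~ free Y.
  apply/negP => Yf; have := dimvS Yt; rewrite (eqP Yf) size_tuple ltnn //.
have YE (i : 'I_d.+1) : Y`_i = y i by rewrite -tnth_nth tnth_mktuple.
move=> nf; have /existsNP[c /not_implyP[c0 /existsNP[i0 ci0]]] :
    ~ (forall c : 'I_d.+1 -> F, \sum_i c i *: Y`_i = 0 -> forall i, c i = 0).
  by move=> h; case/negP: nf; apply/freeP.
case: (@arg_minnP _ i0 (fun i => c i != 0) val) => [|j cj jmin]; first exact/eqP.
pose c' k := if insub k is Some i then c i else 0.
have c'E (i : 'I_d.+1) : c' i = c i by rewrite /c' valK.
apply: (dep j d.+1 c') => [|||] //; first by rewrite c'E.
  move=> i ij; have id : (i < d.+1)%N by apply: ltn_trans ij _.
  rewrite -[i]/(val (Ordinal id)) c'E; apply/eqP/negPn/negP => /jmin /=.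
  by rewrite leqNgt ij.
by rewrite -[RHS]c0; apply: eq_bigr => i _; rewrite c'E YE.
Qed.

End TorusCriterion.

Section MT.
Variables (F : fieldType) (p : nat) (V : vectType F) (L : {vspace 'End(V)}).

Lemma MT_ge t : torus p t -> (t <= L)%VS -> (\dim t <= MT p L)%N.
Proof.
move=> tP tL; have dL : (\dim t < (\dim L).+1)%N by rewrite ltnS dimvS.
rewrite /MT (bigD1 (Ordinal dL)) /=; first exact: leq_maxl.
by apply/asboolP; exists t.
Qed.

Lemma MT_le m : (forall t, torus p t -> (t <= L)%VS -> (\dim t <= m)%N) -> (MT p L <= m)%N.
Proof. by move=> h; apply/bigmax_leqP => d /asboolP[t [tP tL <-]]; apply: h. Qed.

End MT.

Section StandardTorus.
Variables (F : closedFieldType) (pF : 2%N \in [pchar F]) (n : nat).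
Hypothesis n_gt0 : (0 < n)%N.
Local Notation N := (2 ^ n)%N.
Local Notation W := (witt F 2 n).
Local Notation V := (subvs_of W).
Local Notation L := (zassenhaus F 2 n).
Local Notation E := (ad_e F n).
Local Notation w := (witt_vec F n).
Local Notation U := (u_alg L pF).
Local Notation wb := (wbasis F n).
Local Notation wbP := (wbasisP F n_gt0).
Local Notation zact := (act (pF := pF) (L := L) wbP).
Local Notation ann := (ann (pF := pF) n_gt0).

Let N_gt0 : (0 < N)%N. Proof. by rewrite expn_gt0. Qed.
Let N_gt1 : (1 < N)%N. Proof. by rewrite -{1}(expn0 2) ltn_exp2l. Qed.
Let topN : (N.-1 < N)%N. Proof. by rewrite ltn_predL. Qed.

(* d + x^(2^n - 1) d permutes w_0, ..., w_(2^n - 2) cyclically. *)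
Definition cyc : 'End(V) := E 0 + E N.-1.

Lemma cyc_wS a : (a.+1 < N)%N -> cyc (w a.+1) = w a.
Proof. by move=> aN; rewrite add_lfunE E0_w // E_w_out ?addr0 //; lia. Qed.

Lemma cyc_w0 : cyc (w 0) = w N.-2.
Proof.
rewrite add_lfunE E0_w // add0r E_w // addn0 /bcoef addn0 binn muln1.
by rewrite (_ : (0 < N.-1)%N) ?scale1r //; lia.
Qed.

Let exp_w m a : (m <= a)%N -> (a < N)%N -> lfun_exp cyc m (w a) = w (a - m).
Proof.
elim: m => [|m IHm] ma aN; first by rewrite /lfun_exp /= id_lfunE subn0.
rewrite -[lfun_exp _ _]/(cyc \o lfun_exp cyc m)%VF comp_lfunE IHm // 1?ltnW //.
have -> : (a - m = (a - m.+1).+1)%N by lia.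
by rewrite cyc_wS //; lia.
Qed.

Let expD k l : lfun_exp cyc (k + l) = (lfun_exp cyc k \o lfun_exp cyc l)%VF.
Proof. by elim: k => [|k IHk] /=; rewrite ?comp_lfun1l // IHk comp_lfunA. Qed.

Let exp1 : lfun_exp cyc 1 = cyc.
Proof. by rewrite /lfun_exp /= comp_lfun1r. Qed.

Let exp_period a : (a <= N.-2)%N -> lfun_exp cyc N.-1 (w a) = w a.
Proof.
move=> aN; have -> : N.-1 = (N.-2 - a + (1 + a))%N by lia.
have aN' : (a < N)%N by lia.
rewrite !expD !comp_lfunE (exp_w (leqnn a) aN') subnn id_lfunE cyc_w0 exp_w; first congr w; lia.
Qed.

(** The image of [cyc] lies in the span of w_0, ..., w_(2^n - 2), on which its power of exponent 2^n
    - 1 is the identity. *)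
Lemma cyc_expN : lfun_exp cyc N = cyc.
Proof.
have -> : lfun_exp cyc N = (lfun_exp cyc N.-1 \o cyc)%VF.
  by rewrite -[X in (_ \o X)%VF]exp1 -expD addn1 prednK.
apply: endV_eq => -[|a] aN; rewrite comp_lfunE.
  by rewrite cyc_w0 exp_period.
by rewrite cyc_wS // exp_period //; lia.
Qed.

Definition cyct : n.-tuple 'End(V) := [tuple lfun_exp cyc (2 ^ i) | i < n].

Let cyctE (i : 'I_n) : cyct`_i = lfun_exp cyc (2 ^ i).
Proof. by rewrite -tnth_nth tnth_mktuple. Qed.

Let exp_top i : (i < n)%N -> lfun_exp cyc (2 ^ i) (w N.-1) = w (N.-1 - 2 ^ i).
Proof. by move=> i_n; rewrite exp_w // -ltnS prednK // ltn_exp2l. Qed.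

Let cyc_indep (c : nat -> F) :
  \sum_(i < n) c i *: w (N.-1 - 2 ^ i)%N = 0 -> forall i, (i < n)%N -> c i = 0.
Proof.
move=> c0 i; apply: (w_indep_inj n_gt0 (f := fun i => N.-1 - 2 ^ i)%N) => //.
  by move=> j _; exact: leq_ltn_trans (leq_subr _ _) topN.
move=> j k jn kn e; have hj : (2 ^ j < N)%N by rewrite ltn_exp2l.
have hk : (2 ^ k < N)%N by rewrite ltn_exp2l.
by apply/eqP; rewrite -(eqn_exp2l (m := 2)) //; apply/eqP; lia.
Qed.

Lemma cyct_free : free cyct.
Proof.
apply/freeP => c c0 i.
pose c' k := if insub k is Some i then c i else 0.
have c'E (j : 'I_n) : c' j = c j by rewrite /c' valK.
rewrite -c'E; apply: cyc_indep (ltn_ord i); have /lfunP/(_ (w N.-1)) := c0.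
rewrite zero_lfunE sum_lfunE => h; rewrite -[RHS]h; apply: eq_bigr => j _.
by rewrite scale_lfunE cyctE exp_top // c'E.
Qed.

Lemma std_torus : torus 2 <<cyct>>%VS.
Proof.
have expC k l : lie_br (lfun_exp cyc k) (lfun_exp cyc l) = 0.
  by rewrite /lie_br -!expD addnC subrr.
have sqr k : p_map 2 (lfun_exp cyc k) = lfun_exp cyc (k + k).
  by rewrite expD; apply/lfunP => v; rewrite p_map2E comp_lfunE.
have spC x y : x \in <<cyct>>%VS -> y \in <<cyct>>%VS -> lie_br x y = 0.
  have br0l z : lie_br 0 z = 0 by apply/lfunP => v; rewrite lie_brE !zero_lfunE linear0 subrr.
  have br0r z : lie_br z 0 = 0 by rewrite lie_brC br0l oppr0.
  move=> /coord_span -> /coord_span ->; elim/big_rec: _ => [|i x' _ IH]; first by rewrite br0l.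
  rewrite lie_brPl IH addr0 cyctE; elim/big_rec: _ {IH} => [|j y' _ IH].
    by rewrite br0r scaler0.
  by rewrite lie_brPr cyctE expC scaler0 add0r.
have mem_cyc k : (k < n)%N -> lfun_exp cyc (2 ^ k) \in <<cyct>>%VS.
  move=> kn; rewrite -(cyctE (Ordinal kn)); apply/memv_span/mem_nth.
  by rewrite size_tuple.
have tR : restricted_subalgebra 2 <<cyct>>%VS.
  apply: restricted_span => // [i j|i]; first by rewrite !cyctE expC mem0v.
  rewrite cyctE sqr addnn -mul2n -expnS.
  have [i_n|ni] := ltnP i.+1 n; first exact: mem_cyc.
  have -> : i.+1 = n by apply/eqP; rewrite eqn_leq ni ltn_ord.
  rewrite cyc_expN; have := mem_cyc 0%N n_gt0.
  by rewrite expn0 /lfun_exp /= comp_lfun1r.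
apply: (injective_torus pF tR spC) => x xt x2.
pose c k := if insub k is Some i then coord cyct i x else 0.
have cE (i : 'I_n) : c i = coord cyct i x by rewrite /c valK.
have xE : x = \sum_(0 <= i < n) c i *: lfun_exp cyc (2 ^ i).
  rewrite big_mkord {1}(coord_span xt); apply: eq_bigr => i _; by rewrite cE cyctE.
pose y i := if (i < n)%N then lfun_exp cyc (2 ^ i) else 0.
have yt i : y i \in <<cyct>>%VS by rewrite /y; case: ifP => [/mem_cyc//|_]; rewrite mem0v.
have xy : x = \sum_(0 <= i < n) c i *: y i.
  by rewrite {1}xE !big_mkord; apply: eq_bigr => i _; rewrite /y ltn_ord.
have := x2; rewrite {1}xy (p_map_sum pF spC) // big_mkord => /lfunP/(_ (w N.-1)).
rewrite zero_lfunE sum_lfunE => h.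
(* The [2]-map permutes the spanning powers of [cyc] cyclically, so it squares the coefficients and
   rotates them; the last one returns to index 0. *)
pose c' j := if j is j'.+1 then c j' ^+ 2 else c n.-1 ^+ 2.
have c'0 : \sum_(j < n) c' j *: w (N.-1 - 2 ^ j)%N = 0.
  rewrite -[RHS]h [RHS](eq_bigr (fun i : 'I_n => c i ^+ 2 *:
      (if (i.+1 < n)%N then w (N.-1 - 2 ^ i.+1) else w (N.-1 - 2 ^ 0))%N)).
    have rot k (g : nat -> V) :
        \sum_(j < k) (if (j : nat) is j'.+1 then c j' ^+ 2 else c k.-1 ^+ 2) *: g j =
        \sum_(i < k) c i ^+ 2 *: (if (i.+1 < k)%N then g i.+1 else g 0%N).
      case: k => [|k]; first by rewrite !big_ord0.
      rewrite big_ord_recl [in RHS]big_ord_recr /= ltnn addrC; congr (_ + _).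
      by apply: eq_bigr => i _; rewrite /= ltnS ltn_ord.
    exact: (rot n (fun i => w (N.-1 - 2 ^ i)%N)).
  move=> i _; rewrite scale_lfunE /y ltn_ord sqr addnn -mul2n -expnS; congr (_ *: _).
  case: ltnP => [i_n|ni]; first exact: exp_top.
  have -> : i.+1 = n by apply/eqP; rewrite eqn_leq ni ltn_ord.
  by rewrite cyc_expN -(exp_top n_gt0) expn0 exp1.
have cz := cyc_indep c'0.
rewrite xE big_mkord big1 // => i _.
suff -> : c i = 0 by rewrite scale0r.
apply/eqP; rewrite -sqrf_eq0; apply/eqP.
have [i_n|ni] := ltnP i.+1 n; first exact: (cz i.+1 i_n).
have -> : (i : nat) = n.-1 by apply/eqP; rewrite eqn_leq -ltnS prednK // ltn_ord /= -ltnS prednK.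
exact: (cz 0%N n_gt0).
Qed.

Lemma std_torus_sub : (<<cyct>> <= L)%VS.
Proof.
apply/span_subvP => x /(nthP 0)[i]; rewrite size_tuple => i_n <-.
rewrite (cyctE (Ordinal i_n)) /= -iter_p_map2.
have [_ LP] := zassenhaus_restricted pF n_gt0.
by elim: i {i_n} => [|i IHi] /=; [rewrite memvD ?E_mem|apply: LP].
Qed.

Lemma dim_std_torus : \dim <<cyct>> = n.
Proof. by rewrite (eqP cyct_free) size_tuple. Qed.

Lemma cyc_mem : cyc \in <<cyct>>%VS.
Proof.
have <- : cyct`_(Ordinal n_gt0) = cyc by rewrite cyctE expn0 exp1.
by apply/memv_span/mem_nth; rewrite size_tuple.
Qed.

Let k0 : 'I_N.-1.+1 := ord0.

(** When the coordinate at w_0 vanishes, the eigenvalue equation becomes the recurrence c_(a+1) =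
    lam c_a. Hence eigenspaces are at most lines. *)
Lemma cyc_eigen lam y : cyc y = lam *: y -> coord wb k0 y = 0 -> y = 0.
Proof.
move=> yE y0; pose c a := if insub a is Some i then coord wb i y else 0.
have cE (i : 'I_N.-1.+1) : c i = coord wb i y by rewrite /c valK.
have yc : y = \sum_(a < N.-1.+1) c a *: w a.
  by rewrite {1}(wcoordE n_gt0 y); apply: eq_bigr => i _; rewrite cE.
have c00 : c 0%N = 0 by rewrite -y0 -(cE k0).
have yS : y = \sum_(a < N.-1) c a.+1 *: w a.+1.
  by rewrite {1}yc big_ord_recl /= c00 scale0r add0r.
have cycy : cyc y = \sum_(a < N.-1) c a.+1 *: w a.
  rewrite yS linear_sum; apply: eq_bigr => a _; rewrite linearZ /= cyc_wS //.
  by have := ltn_ord a; lia.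
pose g a := (if (a < N.-1)%N then c a.+1 else 0) - lam * c a.
have g0 a : (a < N.-1.+1)%N -> g a = 0.
  apply: (w_indep_inj n_gt0 (f := id)) => // [i|]; first by rewrite prednK.
  transitivity (cyc y - lam *: y); last by rewrite yE subrr.
  rewrite cycy {1}yc scaler_sumr; under eq_bigr do rewrite scalerBl -scalerA.
  rewrite sumrB; congr (_ - _); rewrite big_ord_recr /= ltnn scale0r addr0.
  by apply: eq_bigr => a' _; rewrite ltn_ord.
have cz a : (a < N.-1.+1)%N -> c a = 0.
  elim: a => [_|a IHa aN]; first exact: c00.
  have := g0 a (ltnW aN); rewrite /g -ltnS aN IHa ?mulr0 ?subr0 //; exact: ltnW.
by rewrite yc big1 // => a _; rewrite cz // scale0r.
Qed.

Section LocalIdempotents.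
Variables (m : nat) (T : m.-tuple 'End(V)).
Hypothesis Tb : basis_of <<cyct>>%VS T.
Hypothesis Tp : forall i : 'I_m, p_map 2 T`_i = T`_i.

Let tC x y : x \in <<cyct>>%VS -> y \in <<cyct>>%VS -> lie_br x y = 0.
Proof. by case: std_torus => _ h _; apply: h. Qed.

(** The image of e on W(1;n) lies in a single eigenspace of [cyc], at most a line, so e u e acts
    there as a scalar. The scalar is read off at w_0, or is 0 when e acts by zero. *)
Lemma std_idem_local c (u : U) : exists k : F,
  ann (idem pF L T c * u * idem pF L T c - k *: idem pF L T c).
Proof.
set e := idem pF L T c.
pose lam := \sum_(i < m) coord T i cyc * (c i)%:R.
have eig x : cyc (zact e x) = lam *: zact e x.
  rewrite {1}(coord_span (X := T) (v := cyc)); last by rewrite (span_basis Tb) cyc_mem.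
  rewrite sum_lfunE scaler_suml; apply: eq_bigr => i _.
  have TL : T`_i \in L.
    by apply: (subvP std_torus_sub); apply: (basis_mem Tb); rewrite -tnth_nth mem_tnth.
  rewrite scale_lfunE -[T`_i](vsprojK TL) -(act_gen pF wbP) -act_mul.
  rewrite -[u_gen _ _]/(tor pF L T i) (tor_idem pF std_torus_sub tC Tb Tp) //.
  by rewrite mulr_natl -scaler_nat actZ scalerA.
have [e0|/existsNP[x0 ex0]] := pselect (forall x, zact e x = 0).
  by exists 0 => x; rewrite scale0r subr0 -mulrA act_mul e0.
pose g := zact e x0; have g0 : coord wb k0 g != 0.
  by apply: contra_not_neq ex0 => g0; apply: (cyc_eigen (eig x0)).
have line x : zact e x = (coord wb k0 (zact e x) / coord wb k0 g) *: g.
  set r := _ / _; apply/eqP; rewrite -subr_eq0; apply/eqP.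
  have -> : zact e x - r *: g = zact e (- r *: x0 + x).
    by rewrite act_linear scaleNr addrC.
  apply: (cyc_eigen (eig _)); rewrite act_linear -/g linearP /= mulNr addrC.
  by rewrite /r mulfVK ?subrr.
set r := coord wb k0 (zact (e * u) g) / coord wb k0 g.
have ug : zact (e * u) g = r *: g by rewrite {1}act_mul line -act_mul.
exists r => x; rewrite actB actZ act_mul line linearZ /= ug !scalerA.
by rewrite mulrC subrr.
Qed.

End LocalIdempotents.

End StandardTorus.

(** * Projective modules over the Zassenhaus algebra *)

Section ZassenhausProjectives.
Variables (F : closedFieldType) (pF : 2%N \in [pchar F]) (n : nat).
Hypothesis n_gt0 : (0 < n)%N.
Local Notation L := (zassenhaus F 2 n).
Local Notation U := (u_alg L pF).
Local Notation V := (subvs_of (witt F 2 n)).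

Let LP : restricted_subalgebra 2 L := zassenhaus_restricted pF n_gt0.
Let wbP := wbasisP F n_gt0.

Lemma torus_comm (t : {vspace 'End(V)}) x y :
  torus 2 t -> x \in t -> y \in t -> lie_br x y = 0.
Proof. by case=> _ h _; apply: h. Qed.

Definition std_idem (e : U) : Prop :=
  exists (T : (\dim <<cyct F n>>).-tuple 'End(V)) c,
  [/\ basis_of <<cyct F n>> T, forall i : 'I_(\dim <<cyct F n>>), p_map 2 T`_i = T`_i & e = idem pF L T c].

Lemma std_idem_localP e : std_idem e -> local_idem (ann (pF := pF) n_gt0) e.
Proof.
move=> [T [c [Tb Tp ->]]].
have tL := std_torus_sub pF n_gt0.
have tC x y := @torus_comm _ x y (std_torus pF n_gt0).
split; first exact: (idemM pF tL tC Tb Tp).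
  exact: (idem_neq0 pF wbP LP tL tC Tb Tp).
move=> u; exact: (std_idem_local n_gt0 Tb Tp).
Qed.

Lemma std_idem_dim e : std_idem e -> has_dim (lideal e) (2 ^ (2 ^ n - 1))%N.
Proof.
move=> [T [c [Tb Tp ->]]].
have tL := std_torus_sub pF n_gt0.
have tC x y := @torus_comm _ x y (std_torus pF n_gt0).
have <- : (\dim L - \dim <<cyct F n>> = 2 ^ n - 1)%N.
  by rewrite dim_zassenhaus // (dim_std_torus pF n_gt0) addKn subn1.
exact: (lideal_idem_dim pF wbP LP tL tC Tb Tp).
Qed.

Lemma std_idem_one u : (forall e, std_idem e -> rad n_gt0 (u * e)) -> rad n_gt0 u.
Proof.
move=> h; have [T [Tb Tp]] := toral_basis pF (std_torus pF n_gt0).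
apply: (@idem_split F pF _ L _ T (rad n_gt0) (@radD _ pF _ n_gt0)) => c; apply: h.
by exists T, c.
Qed.

Lemma std_idem_rad e b : std_idem e -> b * e = b ->
  (forall u, ann n_gt0 (e * u * b)) -> rad n_gt0 b.
Proof.
by move=> /std_idem_localP[ee e0 _] be h; exact: rad_local_test ee e0 be h.
Qed.

Lemma projective_onto_std (P : lmodType U) : projective P -> (exists m : P, m != 0) ->
  exists2 e, std_idem e & exists f : {linear P -> lideal e}, forall y, exists x, f x = y.
Proof.
have [K RK] := rad_nilp_ex pF n_gt0.
exact: (projective_onto_local (@ann_rad _ pF _ n_gt0) (@rad_mull _ pF _ n_gt0) RK
  std_idem_localP std_idem_one std_idem_rad).
Qed.

Lemma std_indecomposable e : std_idem e -> indecomposable (lideal e).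
Proof.
have [K RK] := rad_nilp_ex pF n_gt0.
move=> /std_idem_localP.
exact: (local_indecomposable (@ann_rad _ pF _ n_gt0) (@rad_mull _ pF _ n_gt0) RK).
Qed.

Section Torus.
Variables (t : {vspace 'End(V)}) (tP : torus 2 t) (tL : (t <= L)%VS).
Variable T : (\dim t).-tuple 'End(V).
Hypothesis Tb : basis_of t T.
Hypothesis Tp : forall i : 'I_(\dim t), p_map 2 T`_i = T`_i.

Lemma torus_idem_onto_std c : exists2 e, std_idem e &
  exists f : {linear lideal (idem pF L T c) -> lideal e}, forall y, exists x, f x = y.
Proof.
have tC x y := @torus_comm _ x y tP.
apply: projective_onto_std; first exact/lideal_projective/(idemM pF tL tC Tb Tp).
exact: (lideal_idem_neq0 pF wbP LP tL tC Tb Tp).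
Qed.

Lemma torus_idem_dim c : has_dim (lideal (idem pF L T c)) (2 ^ (\dim L - \dim t))%N.
Proof.
have tC x y := @torus_comm _ x y tP.
exact: (lideal_idem_dim pF wbP LP tL tC Tb Tp).
Qed.

Lemma torus_idem_indecomposable c : \dim t = n -> indecomposable (lideal (idem pF L T c)).
Proof.
move=> tn; have [e eE [f fs]] := torus_idem_onto_std c.
have tdim : has_dim (lideal (idem pF L T c)) (2 ^ (2 ^ n - 1))%N.
  have <- : (\dim L - \dim t = 2 ^ n - 1)%N by rewrite tn dim_zassenhaus // addKn subn1.
  exact: torus_idem_dim.
have [_ /(_ erefl) finj] := has_dim_surj tdim (std_idem_dim eE) fs.
apply: (@indecomposable_iso _ _ _ f) (std_indecomposable eE).
have [g gE] := choice fs.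
by exists g => // x; apply: finj; rewrite gE.
Qed.

End Torus.

(* A torus t makes u(L) a sum of projective left ideals of dimension
   2^(dim L - dim t), and each of them maps onto some lideal e, e standard. *)
Lemma MT_zassenhaus : MT 2 L = n.
Proof.
apply/eqP; rewrite eqn_leq; apply/andP; split; last first.
  rewrite -[X in (X <= _)%N](dim_std_torus pF n_gt0).
  exact/MT_ge/std_torus_sub/n_gt0/pF/std_torus.
apply: MT_le => t tP tL; have [T [Tb Tp]] := toral_basis pF tP.
have [e eE [f fs]] := torus_idem_onto_std tP tL Tb Tp (fun=> false).
have [+ _] := has_dim_surj (torus_idem_dim tP tL Tb Tp (fun=> false)) (std_idem_dim eE) fs.
(* The exponents compare as 2^n - 1 <= n + 2^n - 1 - dim t; the bound on dim t excludes truncated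
   subtraction. *)
have := dimvS tL; rewrite dim_zassenhaus // leq_exp2l //.
set d := \dim t; have : (0 < 2 ^ n)%N by rewrite expn_gt0.
lia.
Qed.

Lemma max_pim_dim_zassenhaus : max_pim_dim 2 L = (2 ^ (2 ^ n - 1))%N.
Proof. by rewrite /max_pim_dim MT_zassenhaus dim_zassenhaus // addKn subn1. Qed.

Lemma pim_dim_zassenhaus (P : lmodType U) :
  projective P -> indecomposable P -> has_dim P (2 ^ (2 ^ n - 1))%N.
Proof.
move=> PP Pind; have [K RK] := rad_nilp_ex pF n_gt0.
have [e eE [f fbij]] := projective_indecomposable_local (@ann_rad _ pF _ n_gt0)
  (@rad_mull _ pF _ n_gt0) RK std_idem_localP std_idem_one std_idem_rad PP Pind.
exact: has_dim_iso fbij (std_idem_dim eE).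
Qed.

Lemma u_aug_gen x : u_aug pF L (u_gen pF x) = 0.
Proof. by rewrite /u_aug; case: u_aug_subproof => *; exact: u_liftE. Qed.

Lemma zassenhaus_max_0pim : has_max_0pim pF L.
Proof.
have [T [Tb Tp]] := toral_basis pF (std_torus pF n_gt0).
pose e := idem pF L T (fun=> false); have eE : std_idem e by exists T, (fun=> false).
exists (lideal e); last by rewrite max_pim_dim_zassenhaus; apply: std_idem_dim.
have [K RK] := rad_nilp_ex pF n_gt0.
apply: (local_cover (@ann_rad _ pF _ n_gt0) (@rad_mull _ pF _ n_gt0) RK (std_idem_localP eE)).
(* In weight 0 every factor is [tor i + 1], of augmentation 1, so this idempotent covers the trivial
   module. *)
rewrite /e /idem rmorph_prod big1 ?oner_eq0 // => i _.
by rewrite /tfac /tor rmorphD /= u_aug_gen add0r rmorph1.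
Qed.

End ZassenhausProjectives.

Unset Implicit Arguments.

Theorem mainTheorem1 (F : closedFieldType) (pF : 2%N \in [pchar F])
    (n : nat) (hn : (0 < n)%N)
    (t : {vspace 'End(subvs_of (witt F 2 n))})
    (tP : torus 2 t) (tW : (t <= zassenhaus F 2 n)%VS)
    (tmax : \dim t = MT 2 (zassenhaus F 2 n)) :
  (forall mu : torus_dual 2 t, indecomposable (ind_torus pF tP mu tW)) /\
  max_pim_dim 2 (zassenhaus F 2 n) = (2 ^ (2 ^ n - 1))%N /\
  (forall P : lmodType (u_alg (zassenhaus F 2 n) pF),
     projective P -> indecomposable P ->
     has_dim P (max_pim_dim 2 (zassenhaus F 2 n))) /\
  has_max_0pim pF (zassenhaus F 2 n).
Proof.
split=> [mu|]; last split; [|exact: max_pim_dim_zassenhaus|].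
  have [T [Tb Tp]] := toral_basis pF tP.
  apply: indecomposable_iso (ind_iso_bij pF tP tW mu Tb Tp) _.
  by apply: torus_idem_indecomposable => //; rewrite tmax MT_zassenhaus.
split; last exact: zassenhaus_max_0pim.
by rewrite max_pim_dim_zassenhaus //; exact: pim_dim_zassenhaus.
Qed.
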